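(* Let $p=p(n)\in(0,1]$ satisfy $np=\omega(\log n)^2$, where $\omega=\omega(n)\to\infty$ as $n\to\infty$. Then with high probability over the random bipartite graph $G=G_{n,n,p}$, $$\mathbf{E}[C(G)]=(1+o(1))\frac{\pi^2}{6p}.$$ That is, for every $\varepsilon>0$, the probability, over the random graph $G=G_{n,n,p}$, that $\left|\mathbf{E}[C(G)]-\frac{\pi^2}{6p}\right|\le \varepsilon\frac{\pi^2}{6p}$ tends to $1$ as $n\to\infty$. Here $\mathbf{E}[C(G)]$ is the expectation over the random edge costs, for fixed $G$.
   Context: $G_{n,n,p}$ is the random bipartite graph with vertex parts $A=\{a_1,\dots,a_n\}$ and $B=\{b_1,\dots,b_n\}$ in which each of the $n^2$ possible edges between $A$ and $B$ is present independently with probability $p$. Given a graph $G$, each edge is assigned an independent cost with the exponential distribution of rate $1$. $C(G)$ is the (random) minimum total cost of a perfect matching of $G$, assuming $G$ contains at least one (set $C(G)=+\infty$ if $G$ has none). An event $\mathcal{E}_n$ holds with high probability (w.h.p.) if $\Pr(\mathcal{E}_n)=1-o(1)$ as $n\to\infty$. *)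

(* Defs.v *)
From HB Require Import structures.
From mathcomp Require Import all_boot all_order all_algebra.
From mathcomp Require Import all_classical all_reals all_analysis.
Set Implicit Arguments.
Unset Strict Implicit.
Unset Printing Implicit Defensive.
Import Order.TTheory GRing.Theory Num.Theory.
Import numFieldNormedType.Exports.

Local Open Scope classical_set_scope.
Local Open Scope ring_scope.

Section power_probability.
Context {R : realType} {d : measure_display} {T : measurableType d}.
Variable P : probability T R.

Definition tuple_cons n (x : T * n.-tuple T) : n.+1.-tuple T :=
  [tuple of x.1 :: x.2].

Lemma measurable_tuple_cons n : measurable_fun setT (@tuple_cons n).
Proof. exact: measurable_cons. Qed.

HB.instance Definition _ n :=
  isMeasurableFun.Build _ _ _ _ (@tuple_cons n) (@measurable_tuple_cons n).

(* Power of P as a product measure; power_prob_box characterizes it. *)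
Fixpoint power_prob n : probability (n.-tuple T) R :=
  match n with
  | 0 => \d_[tuple]
  | n.+1 => distribution (P \x power_prob n)%E (@tuple_cons n)
  end.

Lemma power_prob_box n (A : 'I_n -> set T) :
  (forall i, measurable (A i)) ->
  power_prob n [set t | forall i, A i (tnth t i)] = (\prod_(i < n) P (A i))%E.
Proof.
elim: n A => [|n IH] A mA.
  rewrite big_ord0 /= /dirac indicE mem_set//=.
  by case.
rewrite big_ord_recl -IH; last by move=> i; exact: mA.
rewrite /= /distribution /pushforward.
rewrite (_ : _ @^-1` _ = A ord0 `*`
    [set t : n.-tuple T | forall i, A (lift ord0 i) (tnth t i)]); last first.
  apply/seteqP; split => [[x t] /= At|[x t] /= [A0 At] i].
    split => [|i]; first by have := At ord0; rewrite tnth0.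
    by have := At (lift ord0 i); rewrite tnthS.
  case: (unliftP ord0 i) => [j ->|->]; first by rewrite tnthS.
  by rewrite tnth0.
rewrite product_measure1E//.
rewrite (_ : [set t | _] = \bigcap_(i in [set: 'I_n])
   ((fun t : n.-tuple T => tnth t i) @^-1` A (lift ord0 i))).
  apply: fin_bigcap_measurable => // i _.
  by rewrite -[X in measurable X]setTI; apply: measurable_tnth.
by apply/seteqP; split => t /= At i; [move=> _|]; exact: At.
Qed.

End power_probability.

(* A bipartite graph with parts {a_i} and {b_j}, i, j < n, is its set of edges,
   the pair (i, j) standing for the edge a_i b_j. *)
Notation bigraph n := {set 'I_n * 'I_n}.

Definition perfect_matching n (G M : bigraph n) : bool :=
  [&& M \subset G,
      [forall i : 'I_n, #|[set e in M | e.1 == i]| == 1%N] &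
      [forall j : 'I_n, #|[set e in M | e.2 == j]| == 1%N]].

Definition min_matching_cost {R : realType} n (G : bigraph n)
    (w : 'I_n * 'I_n -> R) : \bar R :=
  (\big[mine/+oo]_(M : bigraph n | perfect_matching G M)
     (\sum_(e in M) w e)%:E)%E.

Definition exponential1 (R : realType) : probability (measurableTypeR R) R.
Proof.
by unshelve refine (exponential_prob (1 : R) : probability _ R); exact: ltr01.
Defined.

(* The costs are sampled for all n ^ 2 pairs; only those of the edges of G
   matter.  The k-th component of t is the cost of the k-th pair. *)
Definition expected_matching_cost (R : realType) n (G : bigraph n) : \bar R :=
  (\int[power_prob (exponential1 R) #|{: 'I_n * 'I_n}|]_t
     min_matching_cost G (fun e => tnth t (enum_rank e)))%E.

(* Pr (G_{n,n,p} \in E) *)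
Definition Pr_Gnnp {R : realType} n (p : R) (E : set (bigraph n)) : R :=
  \sum_(G : bigraph n | G \in E)
    \prod_(e : 'I_n * 'I_n) (if e \in G then p else 1 - p).

(* Main.v *)
Require Import Defs.
From HB Require Import structures.
From mathcomp Require Import all_boot all_order all_algebra.
From mathcomp Require Import perm ring lra zify.
Set Implicit Arguments.
Unset Strict Implicit.
Unset Printing Implicit Defensive.
Import Order.TTheory GRing.Theory Num.Theory.
Local Open Scope ring_scope.

(* Let S be a set of r rows of K_{n,n} with Exp(1) costs, and s in S.  When s is
   added to S \ s, an exchange along alternating paths shows that the marginal
   cost of a row i grows only if i ends up in a column b unused before; as a
   function of the cost x of (i, b) the increment is (min (x, be) - al)^+, and
   the event that (i, b) becomes used is al < x < be.  These have the same mean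
   under Exp(1), so that, summing over i and over the n - r + 1 free columns b,
   the marginal costs sum to the harmonic tail 1/n + ... + 1/(n - r + 1).  The
   expected cost on K_{n,n} is therefore sum_{k <= n} 1/k^2, which tends to
   pi^2/6.

   Cap all costs at a small kappa, also as the cost of the missing edges.  The
   minimum cost is base + min (x, slack) in each coordinate x, so replacing the
   pairs one by one compares the mean over G_{n,n,p} of the capped cost with the
   cost on K_{n,n} for costs of rate p (below) and p (1 - kappa) (above).

   If the edges of G of cost below theta form an expander, then every edge of an
   optimal capped matching lies on an alternating cycle of O(log n) light edges,
   hence costs less than kappa: the cap is harmless.  A union bound over pairs of
   vertex sets without light edges shows that expansion fails with polynomially
   small probability.  Changing one row of G changes the capped mean cost by at
   most kappa, which bounds its variance over G by n kappa^2 / 2 and gives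
   concentration, as 1/p is much larger than sqrt n kappa. *)

(** * Minimum cost matchings of sets of rows *)

(** Two requirements multiply to the square of the logarithm. Light edges must have density of order
    [ln n / n], so [n p theta] is at least a large multiple of [ln n]; alternating cycles have up to
    order [ln n] edges, so the cap is of order [theta ln n]. The cap must tend to 0, because it
    enters the upper bound on the mean as a factor [1 / (1 - kappa)]. The assumption on [n p] allows
    a cap of order [1 / omega].

    Two caps are needed. The lower comparison with the complete graph loses about
    [n^2 exp(- p K) / p], hence wants a large cap [K], while concentration wants the small cap
    [kappa]. The lower bound is therefore proved with cap [n] and carried over to [kappa]: when the
    light edges expand, capping at [kappa] gives the true cost, which no capped cost exceeds.

    The expectation for a fixed graph also includes the costs for which expansion fails. There the
    minimum is bounded by the sum of all costs, so the failure probability must beat a power of [n];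
    it is of order [n^-9], and Markov's inequality makes it at most [n^-4] for all but few
    graphs. *)

Section matching.
Context {R : realDomainType} {n : nat}.
Local Notation fn := {ffun 'I_n -> 'I_n}.
Local Notation weight := ('I_n * 'I_n -> R).
Implicit Types (S X Y K : {set 'I_n}) (f g : fn) (w : weight) (i s b : 'I_n).

(* A matching of the rows in S is an f that is injective on S; its values off S are
   irrelevant. *)
Definition inj_on S f := dinjectiveb f S.

Lemma inj_onP S f : reflect {in S &, injective f} (inj_on S f).
Proof. exact: dinjectiveP. Qed.

Lemma inj_on_sub S X f : X \subset S -> inj_on S f -> inj_on X f.
Proof.
move=> /subsetP XS /inj_onP fS; apply/inj_onP => x y xX yX; apply: fS; exact: XS.
Qed.

Definition cost S f w := \sum_(i in S) w (i, f i).

Definition mix K f g : fn := [ffun x => if x \in K then f x else g x].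

(* f and g are exchanged along the alternating path that leaves i, which ends in a
   column outside g @: Y or in a row of Y that is not in X, necessarily s. *)
Lemma exchange X Y f g i s : inj_on X f -> inj_on Y g -> i \in X -> i \notin Y ->
  Y :\ s \subset X ->
  exists D1 D2 f' g', [/\ inj_on D1 f' /\ inj_on D2 g',
    f' @: D1 \subset f @: X, g @: Y \subset g' @: D2,
    forall w, cost D1 f' w + cost D2 g' w = cost X f w + cost Y g w &
    (D1 = X :\ i /\ D2 = i |: Y) \/
    [/\ s \in Y, D1 = s |: (X :\ i) & D2 = i |: (Y :\ s)]].
Proof.
move=> /inj_onP fX /inj_onP gY iX iY YX.
(* [r k l] says that [l] holds under [g] the column that [k] holds under [f]. [K] collects the rows
   on the path that leaves [i], and exactly these rows trade their columns. *)
pose r (k l : 'I_n) := [&& k \in X, l \in Y & f k == g l].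
pose K := [set l | connect r i l].
have iK : i \in K by rewrite inE connect0.
have pred l : l \in K -> l != i -> exists2 k, k \in K & r k l.
  rewrite inE => /connectP[p]; case: (lastP p) => [_ ->|]; first by rewrite eqxx.
  move=> {}p x; rewrite rcons_path last_rcons => /andP[rp rx] -> _.
  by exists (last i p) => //; rewrite inE; apply/connectP; exists p.
have KY l : l \in K -> l != i -> l \in Y.
  by move=> lK li; have [k _ /and3P[]] := pred l lK li.
(* Rows that share a column are both in [K] or both outside it. Backwards this uses injectivity of
   [f]: the predecessor of [l] on the path is the only row of [X] in that column. This is what keeps
   both mixed functions injective. *)
have closed k l : k \in X -> l \in Y -> f k = g l -> (k \in K) = (l \in K).
  move=> kX lY e; apply/idP/idP => [|lK].
    by rewrite !inE => ik; apply: connect_trans ik (connect1 _); rewrite /r kX lY e eqxx.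
  have li : l != i by apply: contraNneq iY => <-.
  have [k' k'K /and3P[k'X _ /eqP e']] := pred l lK li.
  by rewrite (fX k k')// e e'.
pose D1 := (X :\: K) :|: (Y :&: K); pose D2 := (Y :\: K) :|: (X :&: K).
have D1E x : (x \in D1) = if x \in K then x \in Y else x \in X.
  by rewrite !inE; case: ifP => _; rewrite ?andbT ?andbF ?orbF.
have D2E x : (x \in D2) = if x \in K then x \in X else x \in Y.
  by rewrite !inE; case: ifP => _; rewrite ?andbT ?andbF ?orbF.
exists D1, D2, (mix K g f), (mix K f g); split; first split.
- apply/inj_onP => x y; rewrite !D1E !ffunE; case: ifPn => xK; case: ifPn => yK xD yD e.
  + exact: gY.
  + by move: yK; rewrite (closed y x)// xK.
  + by move: xK; rewrite (closed x y)// yK.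
  + exact: fX.
- apply/inj_onP => x y; rewrite !D2E !ffunE; case: ifPn => xK; case: ifPn => yK xD yD e.
  + exact: fX.
  + by move: yK; rewrite -(closed x y)// xK.
  + by move: xK; rewrite -(closed y x)// yK.
  + exact: gY.
- apply/subsetP => _ /imsetP[x xD ->]; move: xD; rewrite D1E ffunE.
  case: ifPn => xK xD; last exact: imset_f.
  have xi : x != i by apply: contraNneq iY => <-.
  by have [k _ /and3P[kX _ /eqP <-]] := pred x xK xi; exact: imset_f.
- apply/subsetP => _ /imsetP[x xY ->]; case: (boolP (x \in K)) => xK.
    have xi : x != i by apply: contraNneq iY => <-.
    have [k kK /and3P[kX _ /eqP <-]] := pred x xK xi.
    by apply/imsetP; exists k; rewrite ?D2E ?ffunE kK.
  by apply/imsetP; exists x; rewrite ?D2E ?ffunE (negbTE xK).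
- move=> w; rewrite /cost !(bigID (mem K) (fun i => i \in D1))/=.
  rewrite !(bigID (mem K) (fun i => i \in D2))/=.
  rewrite (bigID (mem K) (fun i => i \in X))/= (bigID (mem K) (fun i => i \in Y))/=.
  have e1 (A B : {set 'I_n}) (u v h : fn) :
    (forall x, x \in K -> (x \in A) = (x \in B)) -> {in K, u =1 v} ->
    \sum_(x in A | x \in K) w (x, u x) = \sum_(x in B | x \in K) w (x, v x).
    move=> AB uv; apply: eq_big => [x|x /andP[_ xK]]; last by rewrite uv.
    by case: (boolP (x \in K)) => xK; rewrite ?andbF// AB.
  have e2 (A B : {set 'I_n}) (u v h : fn) :
    (forall x, x \notin K -> (x \in A) = (x \in B)) ->
    (forall x, x \notin K -> u x = v x) ->
    \sum_(x in A | x \notin K) w (x, u x) = \sum_(x in B | x \notin K) w (x, v x).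
    move=> AB uv; apply: eq_big => [x|x /andP[_ xK]]; last by rewrite uv.
    by case: (boolP (x \in K)) => xK; rewrite ?andbF// AB.
  rewrite (e1 D1 Y _ g)//; first last.
  + by move=> x xK; rewrite ffunE xK.
  + by move=> x xK; rewrite D1E xK.
  rewrite (e2 D1 X _ f)//; first last.
  + by move=> x xK; rewrite ffunE (negbTE xK).
  + by move=> x xK; rewrite D1E (negbTE xK).
  rewrite (e1 D2 X _ f)//; first last.
  + by move=> x xK; rewrite ffunE xK.
  + by move=> x xK; rewrite D2E xK.
  rewrite (e2 D2 Y _ g)//; first last.
  + by move=> x xK; rewrite ffunE (negbTE xK).
  + by move=> x xK; rewrite D2E (negbTE xK).
  ring.
(* Each row of [K] other than [i] lies in [Y], hence in [X] unless it is [s]. The outcomes differ in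
   whether the path reaches an [s] outside [X]. *)
- clear -iK iX iY YX KY D1E D2E; clearbody D1 D2 K.
  have YX' l : l \in Y -> l != s -> l \in X.
    by move=> lY ls; apply: (subsetP YX); rewrite !inE ls.
  case: (boolP [&& s \in Y, s \notin X & s \in K]) => [/and3P[sY sX sK]|sN].
    have si : s != i by apply: contraNneq iY => <-.
    right; split => //; apply/setP => x; rewrite ?D1E ?D2E !inE.
    + case: ifPn => xK.
        have [->|xs] := eqVneq x s; first by rewrite sY.
        have [->|xi]/= := eqVneq x i; first exact: negbTE.
        by rewrite KY// YX'// KY.
      have xi : x != i by apply: contraNneq xK => ->.
      by have [xs|xs]/= := eqVneq x s; [move: xK; rewrite xs sK|rewrite xi].
    + case: ifPn => xK.
        have [->|xi]/= := eqVneq x i; first by [].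
        have [->|xs]/= := eqVneq x s; first exact: negbTE.
        by rewrite (KY x)// YX'// KY.
      have xi : x != i by apply: contraNneq xK => ->.
      have xs : x != s by apply: contraNneq xK => ->.
      by rewrite (negbTE xi) xs.
  have YX2 l : l \in Y -> l \in K -> l \in X.
    move=> lY lK; have [ls|] := eqVneq l s; last exact: YX'.
    by move: sN; rewrite -ls lY lK andbT/= negbK.
  left; split; apply/setP => x; rewrite ?D1E ?D2E !inE; case: ifPn => xK.
  + have [->|xi]/= := eqVneq x i; first exact: negbTE.
    by rewrite KY// YX2// KY.
  + by have xi : x != i by [apply: contraNneq xK => ->]; rewrite xi.
  + have [->|xi]/= := eqVneq x i; first by [].
    by rewrite (KY x)// YX2// KY.
  + by have xi : x != i by [apply: contraNneq xK => ->]; rewrite (negbTE xi).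
Qed.

Lemma exchange_lt (a b c d x : R) : a + b = c + d -> x <= a -> c < b -> x < d.
Proof. by move=> *; lra. Qed.

Lemma exchange_le (a b c d x y : R) : a + b = c + d -> x <= a -> y <= b -> y + x - c <= d.
Proof. by move=> *; lra. Qed.

(* The neutral value is itself attained as soon as P is inhabited. *)
Definition minc (P : pred fn) S w : R :=
  \big[Order.min/cost S (odflt [ffun i => i] [pick f | P f]) w]_(f | P f) cost S f w.

Lemma minc_le (P : pred fn) S w f : P f -> minc P S w <= cost S f w.
Proof. by move=> Pf; rewrite /minc (bigD1 f)//= ge_min lexx. Qed.

Lemma minc_ex (P : pred fn) S w f : P f -> exists2 g, P g & minc P S w = cost S g w.
Proof.
move=> Pf; rewrite /minc; case: pickP => [f0 Pf0/=|/(_ f)]; last by rewrite Pf.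
elim/big_ind : _ => [|x y [g Pg ->] [h Ph ->]|g Pg].
- by exists f0.
- by rewrite /Order.min; case: ifP => _; [exists g|exists h].
- by exists g.
Qed.

Definition mcost S w := minc (inj_on S) S w.
Definition mcost_avoid b S w := minc (fun f => inj_on S f && (b \notin f @: S)) S w.

Lemma inj_on_id S : inj_on S [ffun i => i].
Proof. by apply/inj_onP => x y _ _; rewrite !ffunE. Qed.

Lemma mcost_ex S w : exists2 f, inj_on S f & mcost S w = cost S f w.
Proof. exact: (minc_ex _ _ (inj_on_id S)). Qed.

Lemma mcost_le S w f : inj_on S f -> mcost S w <= cost S f w.
Proof. exact: minc_le. Qed.

Lemma avoid_ex b S : S != setT -> exists2 f, inj_on S f & b \notin f @: S.
Proof.
move=> /eqP/setP ST; have [c cS] : exists c, c \notin S.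
  apply/existsP; rewrite -negb_forall; apply/negP => /forallP h; apply: ST => x.
  by rewrite inE h.
exists [ffun x => tperm b c x]; first by apply/inj_onP => x y _ _; rewrite !ffunE => /perm_inj.
apply/imsetP => -[x xS]; rewrite ffunE => e; move: cS.
have -> : c = x by rewrite -(tpermK b c x) -e tpermL.
by rewrite xS.
Qed.

Lemma mcost_avoid_ex b S w : S != setT ->
  exists f, [/\ inj_on S f, b \notin f @: S & mcost_avoid b S w = cost S f w].
Proof.
move=> /(avoid_ex b)[f fS fb].
have [|g /andP[gS gb]] := @minc_ex (fun f => inj_on S f && (b \notin f @: S)) S w f.
  by rewrite fS.
by exists g.
Qed.

Lemma mcost_avoid_le b S w f : inj_on S f -> b \notin f @: S ->
  mcost_avoid b S w <= cost S f w.
Proof. by move=> fS fb; apply: minc_le; rewrite fS. Qed.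

Lemma mcost_le_avoid b S w : S != setT -> mcost S w <= mcost_avoid b S w.
Proof. by move=> /(mcost_avoid_ex b w)[f [fS _ ->]]; exact: mcost_le. Qed.

Lemma neqT_D1 S s : S :\ s != setT.
Proof. by apply/eqP => /setP/(_ s); rewrite !inE eqxx. Qed.

(* No minimum cost matching of the rows S uses the column b. *)
Definition spared b S w : bool :=
  [forall f : fn, inj_on S f && (b \in f @: S) ==> (mcost_avoid b S w < cost S f w)].

Lemma sparedP b S w : reflect
  (forall f, inj_on S f -> b \in f @: S -> mcost_avoid b S w < cost S f w) (spared b S w).
Proof.
apply: (iffP forallP) => [h f fS fb|h f]; first by have /implyP := h f; apply; rewrite fS.
by apply/implyP => /andP[]; exact: h.
Qed.

Lemma spared_mcost b S w : S != setT -> spared b S w -> mcost S w = mcost_avoid b S w.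
Proof.
move=> ST /sparedP h; apply/eqP; rewrite eq_le mcost_le_avoid//=.
have [f fS ->] := mcost_ex S w; case: (boolP (b \in f @: S)) => fb; last exact: mcost_avoid_le.
by apply: ltW; exact: h.
Qed.

(** Exchange optimal matchings of [S] and [S :\ s :\ i] along the path that leaves [i]: at the same
    total cost they become matchings of [S :\ i] and [S :\ s]. Passing [i] as the exceptional row
    excludes the second outcome of [exchange]. *)
Lemma mcost_supermodular S i s w : i \in S -> s \in S -> i != s ->
  mcost (S :\ i) w + mcost (S :\ s) w <= mcost S w + mcost (S :\ s :\ i) w.
Proof.
move=> iS sS si; have [f fS ->] := mcost_ex S w; have [g gS ->] := mcost_ex (S :\ s :\ i) w.
have [||D1 [D2 [f' [g' [[f'D g'D] _ _ <- [[D1E D2E]|[]]]]]]] :=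
  @exchange S (S :\ s :\ i) f g i i fS gS iS.
- by rewrite !inE eqxx.
- by apply/subsetP => x; rewrite !inE => /and4P[].
- have D2S : D2 = S :\ s by rewrite D2E setD1K// !inE si.
  rewrite D1E D2S in f'D g'D *.
  by apply: lerD; exact: mcost_le.
- by rewrite !inE eqxx.
Qed.

Lemma mcost_le_D1 S s w : (forall e, 0 <= w e) -> mcost (S :\ s) w <= mcost S w.
Proof.
move=> w0; have [f fS ->] := mcost_ex S w.
apply: (le_trans (mcost_le w (inj_on_sub (subsetDl _ _) fS))).
rewrite /cost [leRHS](bigID (mem [set s]))/= addrC.
rewrite (eq_bigl (fun i => (i \in S) && (i \notin [set s]))).
  by rewrite lerDl sumr_ge0.
by move=> x; rewrite !inE andbC.
Qed.

(** If a matching [g] of [S :\ i] used [b], exchange it with an optimal [b]-avoiding matching of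
    [S]. The result on [S] uses [b], so it is dearer than the latter, and the result on [S :\ i]
    avoids [b], so it is cheaper than [g]. Thus the columns in use only grow when rows are added. *)
Lemma spared_D1 b S i w : i \in S -> spared b S w -> S != setT -> spared b (S :\ i) w.
Proof.
move=> iS /sparedP h ST; apply/sparedP => g gS gb.
have [f [fS fb fE]] := mcost_avoid_ex b w ST.
have [||D1 [D2 [f' [g' [[f'D g'D] fX gY e [[D1E D2E]|[]]]]]]] :=
  @exchange S (S :\ i) f g i i fS gS iS.
- by rewrite !inE eqxx.
- by apply/subsetP => x; rewrite !inE => /and3P[].
- have D2S : D2 = S by rewrite D2E setD1K.
  rewrite D1E D2S in f'D g'D fX gY e.
  have f'b : b \notin f' @: (S :\ i) by apply: contra fb; exact: (subsetP fX).
  have g'b : b \in g' @: S by exact: (subsetP gY).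
  apply: exchange_lt (e w) (mcost_avoid_le w f'D f'b) _.
  by rewrite -fE; exact: h.
- by rewrite !inE eqxx.
Qed.

Lemma max_marginal_eq (x y z t u : R) : y + z <= x + t -> y <= u ->
  Order.min (x + t - z) u <= y -> x - y = Order.max (z - t) (x - u).
Proof.
move=> h1 h2; rewrite ge_min => h3.
apply/eqP; rewrite eq_le le_max ge_max; apply/andP; split; last first.
  by apply/andP; split; lra.
by case/orP: h3 => h3; apply/orP; [left|right]; lra.
Qed.

(* An optimal matching of [S :\ i] that uses b can be exchanged with one of [S :\ s],
   and then i keeps its marginal cost; one that avoids b gives the other term. *)
Lemma marginal_spared b S i s w : (forall e, 0 <= w e) -> i \in S -> s \in S ->
  spared b (S :\ s) w ->
  mcost S w - mcost (S :\ i) w =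
  Order.max (if i == s then 0 else mcost (S :\ s) w - mcost (S :\ s :\ i) w)
            (mcost S w - mcost_avoid b (S :\ i) w).
Proof.
move=> w0 iS sS sp; have [->|si] := eqVneq i s.
  rewrite -spared_mcost ?neqT_D1//; apply/esym/max_idPr.
  by rewrite subr_ge0 mcost_le_D1.
have H1 := mcost_supermodular w iS sS si.
have H2 := mcost_le_avoid b w (neqT_D1 S i).
suff H3 : Order.min (mcost S w + mcost (S :\ s :\ i) w - mcost (S :\ s) w)
   (mcost_avoid b (S :\ i) w) <= mcost (S :\ i) w.
  exact: max_marginal_eq.
have [g gS gE] := mcost_ex (S :\ i) w; rewrite ge_min.
case: (boolP (b \in g @: (S :\ i))) => gb; last by rewrite gE mcost_avoid_le// orbT.
have [f [fS fb fE]] := mcost_avoid_ex b w (neqT_D1 S s).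
have [|||D1 [D2 [f' [g' [[f'D g'D] fX gY e D12]]]]] :=
  @exchange (S :\ s) (S :\ i) f g i s fS gS.
- by rewrite !inE si.
- by rewrite !inE eqxx.
- by apply/subsetP => x; rewrite !inE => /and3P[-> _ ->].
have fE' : mcost (S :\ s) w = cost (S :\ s) f w by rewrite (spared_mcost _ sp) ?neqT_D1.
(* The first outcome yields matchings of [S :\ s :\ i] and of [S], which bounds the first term of
   the minimum. *)
case: D12 => [[D1E D2E]|[_ D1E D2E]].
  have D2S : D2 = S by rewrite D2E setD1K.
  rewrite D1E D2S in f'D g'D e.
  apply/orP; left; rewrite fE' gE.
  by apply: exchange_le (e w) _ _; exact: mcost_le.
(* In the second outcome the path ends in [s] and the two row sets are swapped. The new matching of
   [S :\ s] uses the spared column [b], so it is dearer than [f], and the [b]-avoiding one of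
   [S :\ i] is cheaper than [g]. *)
have D1S : D1 = S :\ i.
  rewrite D1E; apply/setP => x; rewrite !inE.
  by have [->|] := eqVneq x s; rewrite //= eq_sym si.
have D2S : D2 = S :\ s.
  rewrite D2E; apply/setP => x; rewrite !inE.
  by have [->|] := eqVneq x i; rewrite //= si.
rewrite D1S D2S in f'D g'D fX gY e.
have f'b : b \notin f' @: (S :\ i) by apply: contra fb; exact: (subsetP fX).
have g'b : b \in g' @: (S :\ s) by exact: (subsetP gY).
apply/orP; right; rewrite gE; apply/ltW.
apply: exchange_lt (e w) (mcost_avoid_le w f'D f'b) _.
by rewrite -fE; move/sparedP : sp; exact.
Qed.

Definition upd w e x : 'I_n * 'I_n -> R := fun e' => if e' == e then x else w e'.

(** Strict, as for [spared]: all minimum cost matchings of [S] put [i] in column [b]. As a condition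
    on the cost of [(i, b)] this is then a plain strict threshold. *)
Definition used i b S w : bool :=
  [forall f : fn, inj_on S f && (f i != b) ==> (mcost S w < cost S f w)].

Lemma usedP i b S w : reflect
  (forall f, inj_on S f -> f i != b -> mcost S w < cost S f w) (used i b S w).
Proof.
apply: (iffP forallP) => [h f fS fb|h f]; first by have /implyP := h f; apply; rewrite fS.
by apply/implyP => /andP[]; exact: h.
Qed.

Definition mcost_without i b S w := minc (fun f => inj_on S f && (f i != b)) S w.

Lemma cost_upd_notin S f w i b x : i \notin S -> cost S f (upd w (i, b) x) = cost S f w.
Proof.
move=> iS; apply: eq_bigr => j jS; rewrite /upd; case: eqP => // -[ji _].
by move: iS; rewrite -ji jS.
Qed.

Lemma cost_upd_neq S f w i b x : f i != b -> cost S f (upd w (i, b) x) = cost S f w.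
Proof.
move=> fi; apply: eq_bigr => j jS; rewrite /upd; case: eqP => // -[ji].
by rewrite ji => e; rewrite e eqxx in fi.
Qed.

Lemma costD1 S f w i : i \in S -> cost S f w = w (i, f i) + cost (S :\ i) f w.
Proof. exact: big_setD1. Qed.

Lemma cost_upd_eq S f w i b x : i \in S -> f i = b ->
  cost S f (upd w (i, b) x) = x + cost (S :\ i) f w.
Proof.
move=> iS fi; rewrite (costD1 _ _ iS) fi /upd eqxx cost_upd_notin//.
by rewrite !inE eqxx.
Qed.

Lemma inj_D1_notin S f i b : i \in S -> inj_on S f -> f i = b -> b \notin f @: (S :\ i).
Proof.
move=> iS /inj_onP fS <-; apply/imsetP => -[j]; rewrite !inE => /andP[ji jS] /fS e.
by move: ji; rewrite e// eqxx.
Qed.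

Definition set_fn f i b : fn := [ffun j => if j == i then b else f j].

Lemma inj_set_fn S f i b : i \in S -> inj_on (S :\ i) f -> b \notin f @: (S :\ i) ->
  inj_on S (set_fn f i b).
Proof.
move=> iS /inj_onP fS fb; apply/inj_onP => j k jS kS; rewrite !ffunE.
have [->|ji] := eqVneq j i; have [->|ki]// := eqVneq k i.
- by move=> e; case/negP: fb; rewrite e imset_f// !inE ki.
- by move=> e; case/negP: fb; rewrite -e imset_f// !inE ji.
- by apply: fS; rewrite !inE ?ji ?ki.
Qed.

Lemma cost_set_fn S f i b w : cost (S :\ i) (set_fn f i b) w = cost (S :\ i) f w.
Proof. by apply: eq_bigr => j; rewrite !inE ffunE => /andP[/negbTE -> _]. Qed.

Hypothesis n2 : (1 < n)%N.

Lemma without_ex i b S : exists2 f, inj_on S f & f i != b.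
Proof.
have [c cb] : exists c, c != b.
  have [b0|b0] := eqVneq (val b) 0; last by exists (Ordinal (ltnW n2)); rewrite -val_eqE/= eq_sym.
  by exists (Ordinal n2); rewrite -val_eqE/= b0.
exists [ffun j => tperm i c j]; last by rewrite ffunE tpermL.
by apply/inj_onP => j k _ _; rewrite !ffunE => /perm_inj.
Qed.

Lemma mcost_without_ex i b S w : exists g,
  [/\ inj_on S g, g i != b & mcost_without i b S w = cost S g w].
Proof.
have [f fS fb] := without_ex i b S.
have [|g /andP[gS gb] e] := @minc_ex (fun f => inj_on S f && (f i != b)) S w f.
  by rewrite fS.
by exists g.
Qed.

(** A matching either leaves the pair [(i, b)] out, at a cost free of [x], or consists of that pair
    and a matching of the other rows that avoids [b]. Both the increment identity and the comparison
    of graphs rest on this form. *)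
Lemma mcost_upd i b S w x : i \in S ->
  mcost S (upd w (i, b) x) =
  Order.min (mcost_without i b S w) (x + mcost_avoid b (S :\ i) w).
Proof.
move=> iS; set w' := upd _ _ _; apply/eqP; rewrite eq_le le_min ge_min.
apply/andP; split; first (apply/andP; split).
- have [g [gS gb ->]] := mcost_without_ex i b S w.
  by rewrite -(cost_upd_neq _ _ x gb); exact: mcost_le.
- have [f [fS fb ->]] := mcost_avoid_ex b w (neqT_D1 S i).
  rewrite -(cost_set_fn _ _ i b).
  rewrite -(@cost_upd_eq _ _ w _ b x)//; last by rewrite ffunE eqxx.
  by apply: mcost_le; exact: inj_set_fn.
- have [g gS ->] := mcost_ex S w'; apply/orP.
  have [gb|gb] := eqVneq (g i) b; [right|left].
    rewrite cost_upd_eq// lerD2l; apply: mcost_avoid_le.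
      exact: (inj_on_sub (subsetDl _ _) gS).
    exact: inj_D1_notin.
  by rewrite cost_upd_neq//; apply: minc_le; rewrite gS.
Qed.

Lemma mcost_avoid_upd i b c S w x : i \notin S -> S != setT ->
  mcost_avoid c S (upd w (i, b) x) = mcost_avoid c S w.
Proof.
move=> iS ST; apply/eqP; rewrite eq_le; apply/andP; split.
  have [f [fS fb ->]] := mcost_avoid_ex c w ST.
  by rewrite -(cost_upd_notin _ _ b x iS); exact: mcost_avoid_le.
have [f [fS fb ->]] := mcost_avoid_ex c (upd w (i, b) x) ST.
by rewrite (cost_upd_notin _ _ b x iS); exact: mcost_avoid_le.
Qed.

Lemma mcost_avoid_upd_same i b S w x : S != setT -> i \in S ->
  mcost_avoid b S (upd w (i, b) x) = mcost_avoid b S w.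
Proof.
have h f : i \in S -> b \notin f @: S -> f i != b.
  by move=> iS; apply: contraNneq => <-; exact: imset_f.
move=> ST iS; apply/eqP; rewrite eq_le; apply/andP; split.
  have [f [fS fb ->]] := mcost_avoid_ex b w ST.
  by rewrite -(cost_upd_neq S _ x (h _ iS fb)); exact: mcost_avoid_le.
have [f [fS fb ->]] := mcost_avoid_ex b (upd w (i, b) x) ST.
by rewrite (cost_upd_neq S _ x (h _ iS fb)); exact: mcost_avoid_le.
Qed.

Lemma used_upd i b S w x : i \in S -> used i b S (upd w (i, b) x) =
  (x + mcost_avoid b (S :\ i) w < mcost_without i b S w).
Proof.
move=> iS; apply/usedP/idP => [h|h f fS fb].
  have [g [gS gb e]] := mcost_without_ex i b S w.
  have := h g gS gb; rewrite mcost_upd// cost_upd_neq// e gt_min.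
  by rewrite ltxx.
rewrite mcost_upd// cost_upd_neq// gt_min; apply/orP; right; apply: (lt_le_trans h).
by apply: minc_le; rewrite fS.
Qed.

(* As functions of the cost x of (i, b), the increment of the marginal cost of i is
   [max 0 (min x be - al)] and the event that (i, b) is the new edge is
   [al < x < be], up to x = al; both have the same mean under Exp(1). *)
Lemma coordinate i b S s w : (forall e, 0 <= w e) -> i \in S -> s \in S ->
  exists (H : bool) al be, 0 <= al /\ forall x, 0 <= x ->
    let w' := upd w (i, b) x in
    [/\ (spared b (S :\ s) w')%:R * (mcost S w' - mcost (S :\ i) w' -
        (if i == s then 0 else mcost (S :\ s) w' - mcost (S :\ s :\ i) w')) =
        H%:R * Order.max 0 (Order.min x be - al),
      H && (al < x < be) -> spared b (S :\ s) w' && used i b S w' &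
      spared b (S :\ s) w' && used i b S w' -> H && (al <= x < be)].
Proof.
move=> w0 iS sS; pose S' := S :\ s.
pose al := if i == s then 0 else mcost_avoid b S' w - mcost_avoid b (S' :\ i) w.
pose be := mcost_without i b S w - mcost_avoid b (S :\ i) w.
(* The matchings that use [b] split in two. If another row holds [b], the condition does not involve
   [x] and is [H]; if [i] holds it, the cheapest one costs [x] plus [mcost_avoid b (S' :\ i) w],
   which gives the threshold [al]. If [i = s], the row is absent from [S'] and there is no
   threshold. *)
pose H := if i == s then spared b S' w else
  [forall f : fn, inj_on S' f && (b \in f @: (S' :\ i)) ==> (mcost_avoid b S' w < cost S' f w)].
have S'T : S' != setT by exact: neqT_D1.
have iS' : i != s -> i \in S' by rewrite !inE iS => ->.
exists H, al, be; split.
  rewrite /al; case: ifPn => // is_; rewrite subr_ge0.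
  have [f [fS fb ->]] := mcost_avoid_ex b w S'T.
  rewrite (costD1 f w (iS' is_)) -[leLHS]add0r; apply: lerD => //.
  apply: mcost_avoid_le; first exact: (inj_on_sub (subsetDl _ _) fS).
  by apply: contra fb; apply/subsetP/imsetS; exact: subsetDl.
move=> x x0 w'.
have w'0 e : 0 <= w' e by rewrite /w' /upd; case: ifP.
have sparedE : spared b S' w' = if i == s then H else H && (al < x).
  rewrite /H /al; have [is_|is_] := eqVneq i s.
    have iNS' : i \notin S' by rewrite is_ !inE eqxx.
    apply/sparedP/sparedP => h f fS fb.
      by have := h f fS fb; rewrite mcost_avoid_upd// cost_upd_notin.
    by rewrite mcost_avoid_upd// cost_upd_notin//; exact: h.
  apply/sparedP/andP => [h|[/forallP h1 h2] f fS fb].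
    split.
      apply/forallP => f; apply/implyP => /andP[fS fb].
      have fi : f i != b.
        apply/eqP => fi; move: fb; apply/negP; apply: inj_D1_notin => //; exact: iS'.
      have := h f fS; rewrite mcost_avoid_upd_same ?iS'// cost_upd_neq//; apply.
      by move: fb; apply/subsetP/imsetS; exact: subsetDl.
    have [f [fS fb fE]] := mcost_avoid_ex b w (neqT_D1 S' i).
    have := h (set_fn f i b) (inj_set_fn (iS' is_) fS fb).
    rewrite mcost_avoid_upd_same ?iS'// (@cost_upd_eq _ _ w i b) ?iS'//; last first.
      by rewrite ffunE eqxx.
    rewrite cost_set_fn -fE ltrBlDr; apply.
    by apply/imsetP; exists i; rewrite ?iS'// ffunE eqxx.
  rewrite mcost_avoid_upd_same ?iS'//; have [fi|fi] := eqVneq (f i) b.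
    rewrite cost_upd_eq ?iS'//; move: h2; rewrite ltrBlDr => h2; apply: (lt_le_trans h2).
    rewrite lerD2l; apply: mcost_avoid_le; last by apply: inj_D1_notin => //; exact: iS'.
    exact: (inj_on_sub (subsetDl _ _) fS).
  rewrite cost_upd_neq//; have /implyP := h1 f; apply; rewrite fS/=.
  case/imsetP: fb => j jS' bE; rewrite bE; apply: imset_f.
  by rewrite in_setD1 jS' andbT; apply: contraNneq fi => <-; rewrite bE.
have usedE : used i b S w' = (x < be) by rewrite used_upd// ltrBrDr.
split.
- case: (boolP (spared b S' w')) => sp; last first.
    rewrite mul0r; move: sp; rewrite sparedE; have [_|_] := eqVneq i s.
      by move=> /negbTE ->; rewrite mul0r.
    rewrite negb_and => /orP[/negbTE ->|]; first by rewrite mul0r.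
    rewrite -leNgt => xal; rewrite (_ : Order.max _ _ = 0) ?mulr0//; apply/max_idPl.
    by rewrite subr_le0 ge_min xal.
  have Ht : H by move: sp; rewrite sparedE; case: ifP => // _ /andP[].
  rewrite Ht !mul1r (marginal_spared w'0 iS sS sp).
  have iN (X : {set 'I_n}) : i \notin X :\ i by rewrite !inE eqxx.
  have -> : mcost_avoid b (S :\ i) w' = mcost_avoid b (S :\ i) w.
    by rewrite mcost_avoid_upd ?neqT_D1.
  have -> : (if i == s then 0 else mcost S' w' - mcost (S' :\ i) w') = al.
    rewrite /al; case: ifPn => // is_.
    rewrite (spared_mcost S'T sp) mcost_avoid_upd_same ?iS'//; congr (_ - _).
    have sp' : spared b (S' :\ i) w' by apply: spared_D1 sp _; [exact: iS'|].
    by rewrite (spared_mcost (neqT_D1 _ _) sp') mcost_avoid_upd ?neqT_D1.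
  rewrite mcost_upd//.
  have -> : Order.min (mcost_without i b S w) (x + mcost_avoid b (S :\ i) w)
    - mcost_avoid b (S :\ i) w = Order.min x be.
    rewrite /be addr_minl addrK minC; congr Order.min; ring.
  by rewrite addr_maxl subrr.
- move=> /andP[Ht /andP[ax xb]]; rewrite usedE xb andbT sparedE Ht ax.
  by case: ifP.
- rewrite usedE sparedE => /andP[h ->]; rewrite andbT.
  move: h; rewrite /al; case: (i == s); first by move=> ->.
  by move=> /andP[-> /ltW].
Qed.

(** An almost sure event on which the minimum cost matching is unique on [S], so that [spared] and
    [used] can be read off it. *)
Definition generic S w : bool :=
  [forall f : fn, forall g : fn, [&& inj_on S f, inj_on S g & cost S f w == cost S g w] ==>
    [forall i in S, f i == g i]].

Lemma genericP S w f g : generic S w -> inj_on S f -> inj_on S g ->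
  cost S f w = cost S g w -> {in S, f =1 g}.
Proof.
move=> /forallP/(_ f)/forallP/(_ g)/implyP h fS gS e.
have {}h := h _; move=> i iS; apply/eqP; move: i iS; apply/forall_inP; apply: h.
by rewrite fS gS e eqxx.
Qed.

Lemma spared_generic b S f w : S != setT -> generic S w -> inj_on S f ->
  mcost S w = cost S f w -> spared b S w = (b \notin f @: S).
Proof.
move=> ST gen fS fE; apply/idP/idP => [sp|fb].
  apply: contraTN isT => fb; have /sparedP/(_ f fS fb) := sp.
  by rewrite -fE (spared_mcost ST sp) ltxx.
apply/sparedP => g gS gb; apply: (le_lt_trans (mcost_avoid_le w fS fb)).
rewrite lt_neqAle -[leLHS]fE mcost_le// andbT; apply: contraNneq fb => e.
have fg := genericP gen fS gS e.
by rewrite (eq_in_imset fg).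
Qed.

Lemma used_generic i b S f w : i \in S -> generic S w -> inj_on S f ->
  mcost S w = cost S f w -> used i b S w = (f i == b).
Proof.
move=> iS gen fS fE; apply/usedP/eqP => [h|fb g gS gb].
  by apply/eqP; apply: contraTT isT => fb; have := h f fS fb; rewrite fE ltxx.
rewrite lt_neqAle mcost_le// andbT fE; apply: contraNneq gb => e.
by rewrite -(genericP gen fS gS e iS) fb.
Qed.

Lemma card_imset_inj S f : inj_on S f -> #|f @: S| = #|S|.
Proof. by move=> /inj_onP; exact: card_in_imset. Qed.

Lemma card_spared S w : S != setT -> generic S w ->
  \sum_b (spared b S w)%:R = (n - #|S|)%:R :> R.
Proof.
move=> ST gen; have [f fS fE] := mcost_ex S w.
under eq_bigr do rewrite (spared_generic _ ST gen fS fE).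
rewrite -(card_imset_inj fS) -natr_sum; congr (_%:R).
have -> : (n - #|f @: S| = #|~: (f @: S)|)%N by rewrite [RHS]cardsCs setCK card_ord.
rewrite -sum1_card.
by rewrite [RHS]big_mkcond/=; apply: eq_bigr => b _; rewrite inE; case: (_ \in _).
Qed.

(** The columns used for [S :\ s] are among those used for [S], by [spared_D1]. Their numbers differ
    by one, so exactly one column is new, and exactly one row holds it. *)
Lemma sum_spared_used S s w : s \in S -> generic S w -> generic (S :\ s) w ->
  \sum_(i in S) \sum_b (spared b (S :\ s) w && used i b S w)%:R = 1 :> R.
Proof.
move=> sS gen gen'; have [f fS fE] := mcost_ex S w.
have [g gS gE] := mcost_ex (S :\ s) w.
transitivity (\sum_(i in S) (f i \notin g @: (S :\ s))%:R : R).
  apply: eq_bigr => i iS; rewrite (bigD1 (f i))//= big1 ?addr0.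
    by rewrite (spared_generic _ _ gen' gS gE) ?neqT_D1// (used_generic _ iS gen fS fE)
      eqxx andbT.
  move=> b bf; rewrite (used_generic _ iS gen fS fE) [f i == b]eq_sym.
  by rewrite (negbTE bf) andbF.
have gf : g @: (S :\ s) \subset f @: S.
  (* With all rows present no column can be avoided, so [spared_D1] does not apply; but then every
     column is in use. *)
  have [ST|ST] := eqVneq S setT.
    suff -> : f @: S = setT by exact: subsetT.
    apply/eqP; rewrite eqEcard subsetT card_imset_inj// ST.
    by rewrite leqnn.
  apply/subsetP => b; apply: contraLR => fb.
  rewrite -(spared_generic _ (neqT_D1 S s) gen' gS gE); apply: spared_D1 => //.
  by rewrite (spared_generic _ ST gen fS fE).
rewrite -natr_sum -[RHS]/(1%:R); congr (_%:R).
transitivity #|f @: S :\: g @: (S :\ s)|; last first.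
  rewrite cardsD (setIidPr gf) !card_imset_inj// (cardsD1 s S) sS.
  by rewrite addnK.
rewrite -(big_imset (fun b => (b \notin g @: (S :\ s)) : nat))/=; last by move/inj_onP: fS.
rewrite -sum1_card [RHS](eq_bigl (fun b => (b \in f @: S) && (b \notin g @: (S :\ s)))).
  by rewrite big_mkcondr/=; apply: eq_bigr => b _; case: (_ \notin _).
by move=> b; rewrite inE andbC.
Qed.

End matching.

(** * Expanders and alternating cycles *)

Section expander.
Context {n : nat}.
Implicit Types (L : bigraph n) (X Y : {set 'I_n}).
Local Notation fn := {ffun 'I_n -> 'I_n}.

Definition hole L X Y : bool := [forall x in X, forall y in Y, (x, y) \notin L].

(** Doubling, up to a size just above [n / 2]: beyond it two sets of vertices must meet, and no
    further growth is wanted. *)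
Definition growth k : nat := minn k.*2 n./2.+1.

(* With Y the complement of the neighbourhood of X, this says that X has at least
   [growth #|X|] neighbours, and likewise with the two sides exchanged. *)
Definition expander L : bool :=
  [forall X : {set 'I_n}, forall Y : {set 'I_n}, hole L X Y ==>
    ((X != set0) ==> (growth #|X| + #|Y| <= n)%N) && ((Y != set0) ==> (growth #|Y| + #|X| <= n)%N)].

Lemma expanderP L : expander L -> forall X Y, hole L X Y ->
  (X != set0 -> (growth #|X| + #|Y| <= n)%N) /\ (Y != set0 -> (growth #|Y| + #|X| <= n)%N).
Proof.
move=> /forallP h X Y XY; have /forallP/(_ Y)/implyP/(_ XY)/andP[/implyP a /implyP b] := h X.
by split.
Qed.

Section alternating_cycle.
Variables (L : bigraph n) (f : fn) (i : 'I_n).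
Hypotheses (exL : expander L) (fT : inj_on [set: 'I_n] f).

Let finj : injective f.
Proof. by move=> x y; move/inj_onP : fT; apply; rewrite inE. Qed.

(** One step goes from row [k] along an edge of [L] to a column and back to a row along the matching
    [f]. *)
Let r : rel 'I_n := fun k l => (k, f l) \in L.

Fixpoint forth t : {set 'I_n} :=
  if t is t'.+1 then [set l | [exists k in forth t', r k l]] else [set i].
Fixpoint back t : {set 'I_n} :=
  if t is t'.+1 then [set k | [exists l in back t', r k l]] else [set i].

Lemma growth_step m t a a' c : (0 < a)%N -> (minn (2 ^ t) m.+1 <= a)%N ->
  (minn a.*2 m.+1 + c <= n)%N -> (a' + c = n)%N -> (0 < a' /\ minn (2 ^ t.+1) m.+1 <= a')%N.
Proof. by rewrite expnS; move: (2 ^ t)%N => q; split; lia. Qed.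

(** The columns under [f] of the rows not reached in [t.+1] steps form a hole with [forth t], so
    expansion bounds their number. *)
Lemma forth_growth t : (0 < #|forth t| /\ minn (2 ^ t) n./2.+1 <= #|forth t|)%N.
Proof.
elim: t => [|t [IH0 IH]]; first by rewrite /= cards1; split => //; lia.
have [|+ _] := expanderP exL (X := forth t) (Y := f @: ~: forth t.+1).
  apply/forall_inP => x xt; apply/forall_inP => _ /imsetP[l lt ->].
  move: lt; rewrite inE inE negb_exists => /forallP/(_ x).
  by rewrite xt.
rewrite -card_gt0 => /(_ IH0); rewrite card_imset// => h.
have e : (#|forth t.+1| + #|~: forth t.+1| = n)%N by rewrite cardsC card_ord.
exact: growth_step IH0 IH h e.
Qed.

Lemma back_growth t : (0 < #|back t| /\ minn (2 ^ t) n./2.+1 <= #|back t|)%N.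
Proof.
elim: t => [|t [IH0 IH]]; first by rewrite /= cards1; split => //; lia.
have [|_] := expanderP exL (X := ~: back t.+1) (Y := f @: back t).
  apply/forall_inP => x xt; apply/forall_inP => _ /imsetP[l lt ->].
  move: xt; rewrite inE inE negb_exists => /forallP/(_ l).
  by rewrite lt.
rewrite -card_gt0 card_imset// => /(_ IH0) h.
have e : (#|back t.+1| + #|~: back t.+1| = n)%N by rewrite cardsC card_ord.
exact: growth_step IH0 IH h e.
Qed.

Lemma forth_path t k : k \in forth t -> exists p, [/\ path r i p, size p = t & last i p = k].
Proof.
elim: t k => [k|t IH k]; first by rewrite inE => /eqP ->; exists [::].
rewrite inE => /exists_inP[l /IH[p [rp sp lp]] lk].
by exists (rcons p k); rewrite rcons_path rp lp lk size_rcons sp last_rcons.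
Qed.

Lemma back_path t k : k \in back t -> exists p, [/\ path r k p, size p = t & last k p = i].
Proof.
elim: t k => [k|t IH k]; first by rewrite inE => /eqP ->; exists [::].
rewrite inE => /exists_inP[l /IH[p [rp sp lp]] lk].
by exists (l :: p); rewrite /= lk rp sp lp.
Qed.

(** Both [forth t] and [back t] contain more than half of the rows, so they meet, which closes a
    walk of length [2 t] through [i]. *)
Lemma alternating_cycle t : (0 < t)%N -> (n./2 < 2 ^ t)%N ->
  exists s, [/\ uniq s, i \in s, (size s <= t.*2)%N &
    forall k, k \in s -> (k, f (next s k)) \in L].
Proof.
move=> t0 nt; have [_ h1] := forth_growth t; have [_ h2] := back_growth t.
have : (0 < #|forth t :&: back t|)%N.
  have h3 : (#|forth t :|: back t| <= n)%N by rewrite -[leqRHS]card_ord max_card.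
  have h4 := cardsUI (forth t) (back t).
  move: h1 h2 h3 h4 nt; move: #|_| #|_| #|_| #|_| (2 ^ t)%N => *; lia.
rewrite card_gt0 => /set0Pn[k]; rewrite inE => /andP[/forth_path[p [rp sp lp]]].
move=> /back_path[q [rq sq lq]].
have rpq : path r i (p ++ q) by rewrite cat_path rp lp.
have lpq : last i (p ++ q) = i by rewrite last_cat lp.
have spq : size (p ++ q) = t.*2 by rewrite size_cat sp sq addnn.
(* The walk is made simple from its second vertex on. Shortening it from [i], where it also ends,
   would leave the empty path. *)
case: (p ++ q) rpq lpq spq => [_ _|x u /= /andP[ix ru] lu su].
  by move=> /eqP; rewrite eq_sym double_eq0; lia.
case/shortenP: ru lu => v rv uv vu lv.
exists (x :: v); split => //.
- by rewrite -lv mem_last.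
- have : (size v <= size u)%N by apply: uniq_leq_size vu; case/andP: uv.
  by move: su => /=; lia.
have cyc : cycle r (x :: v) by rewrite /= rcons_path rv lv.
by move=> l lv'; exact: (next_cycle cyc lv').
Qed.

End alternating_cycle.
End expander.

Section capped_matching.
Context {R : realDomainType} {n : nat}.
Implicit Types (y : 'I_n * 'I_n -> R) (f : {ffun 'I_n -> 'I_n}) (L : bigraph n).

(** If the edge at [i] cost [kappa] or more, moving each row of the cycle through [i] to the column
    of the next row would replace edges of total cost at least [kappa] by at most [2 t] edges of
    cost at most [theta]. *)
Lemma optimal_below_cap L y f (kappa theta : R) t : (0 < t)%N -> (n./2 < 2 ^ t)%N ->
  expander L -> (forall e, 0 <= y e) -> (forall e, e \in L -> y e <= theta) ->
  0 <= theta -> theta * t.*2%:R < kappa ->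
  inj_on [set: 'I_n] f -> mcost [set: 'I_n] y = cost [set: 'I_n] f y ->
  forall i, y (i, f i) < kappa.
Proof.
move=> t0 nt exL y0 yL th0 thk fT fE i; rewrite ltNge; apply/negP => ki.
have [s [us is_ ss sL]] := alternating_cycle i exL fT t0 nt.
pose g : {ffun 'I_n -> 'I_n} := [ffun k => f (next s k)].
have gT : inj_on [set: 'I_n] g.
  apply/inj_onP => k l _ _; rewrite !ffunE => /(inj_onP _ _ fT) e.
  by apply: (can_inj (prev_next us)); apply: e; rewrite inE.
have := mcost_le y gT; rewrite fE; apply/negP; rewrite -ltNge.
rewrite /cost (bigID (mem s))/= [ltRHS](bigID (mem s))/=.
have -> : \sum_(k in [set: 'I_n] | k \notin s) y (k, g k) =
          \sum_(k in [set: 'I_n] | k \notin s) y (k, f k).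
  apply: eq_bigr => k /andP[_ ks]; rewrite ffunE; congr (y (k, f _)).
  by rewrite next_nth (negbTE ks).
rewrite ltrD2r.
have sE (F : 'I_n -> R) : \sum_(k in [set: 'I_n] | k \in s) F k = \sum_(k <- s) F k.
  by rewrite big_uniq//; apply: eq_bigl => k; rewrite inE.
rewrite !sE; apply: (@le_lt_trans _ _ (theta * t.*2%:R)).
  apply: (@le_trans _ _ (\sum_(k <- s) theta)).
    rewrite big_seq [leRHS]big_seq; apply: ler_sum => k ks.
    by rewrite ffunE; apply: yL; exact: sL.
  rewrite big_const_seq count_predT iter_addr_0 -[leLHS]mulr_natr ler_wpM2l//.
  by rewrite ler_nat.
apply: (lt_le_trans thk); apply: (le_trans ki).
by rewrite (big_rem i)//= lerDl sumr_ge0.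
Qed.

End capped_matching.

From mathcomp Require Import all_classical all_reals all_analysis.
From mathcomp Require Import measurable_realfun.
Import numFieldNormedType.Exports.
Local Open Scope classical_set_scope.
Local Open Scope ring_scope.

(** * Exponential costs *)

Section resampling.
Local Open Scope ereal_scope.
Context {R : realType} {d : measure_display} {T : measurableType d}.
Variable P : probability T R.

Definition tupd n (k : 'I_n) (x : T) (t : n.-tuple T) : n.-tuple T :=
  [tuple if i == k then x else tnth t i | i < n].

Lemma tupd_cons0 n x (z : T * n.-tuple T) :
  tupd ord0 x (tuple_cons z) = tuple_cons (x, z.2).
Proof.
apply: eq_from_tnth => i; rewrite tnth_mktuple.
case: (unliftP ord0 i) => [j ->|->]; last by rewrite tnth0.
by rewrite !tnthS.
Qed.

Lemma tupd_consS n (k : 'I_n) x (z : T * n.-tuple T) :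
  tupd (lift ord0 k) x (tuple_cons z) = tuple_cons (z.1, tupd k x z.2).
Proof.
apply: eq_from_tnth => i; rewrite tnth_mktuple.
case: (unliftP ord0 i) => [j ->|->]; last by rewrite !tnth0.
by rewrite !tnthS tnth_mktuple (inj_eq lift_inj).
Qed.

Lemma measurable_tupd n (k : 'I_n) :
  measurable_fun setT (fun z : n.-tuple T * T => tupd k z.2 z.1).
Proof.
apply/measurable_fun_tnthP => i /=.
rewrite (_ : _ \o _ = fun z : n.-tuple T * T => if i == k then z.2 else tnth z.1 i).
  case: (i == k); first exact: measurable_snd.
  exact: (@measurableT_comp _ _ _ _ _ _ (fun t : n.-tuple T => tnth t i) _ fst
    (measurable_tnth i) measurable_fst).
by apply/funext => z /=; rewrite tnth_mktuple.
Qed.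

Lemma measurable_tupdr n (k : 'I_n) (t : n.-tuple T) :
  measurable_fun setT (fun x => tupd k x t).
Proof.
exact: (measurableT_comp (@measurable_tupd n k) (pair1_measurable t)).
Qed.

Lemma measurable_resample n (k : 'I_n) (f : n.-tuple T -> \bar R) :
  measurable_fun [set: n.-tuple T] f -> (forall t, 0 <= f t) ->
  measurable_fun setT (fun t => \int[P]_x f (tupd k x t)).
Proof.
move=> mf f0.
apply: (@measurable_fun_fubini_tonelli_F _ _ _ _ R P
  (fun z : n.-tuple T * T => f (tupd k z.2 z.1))) => //.
exact: (measurableT_comp mf (measurable_tupd k)).
Qed.

Lemma integral_power_probS n (f : n.+1.-tuple T -> \bar R) :
  measurable_fun [set: n.+1.-tuple T] f -> (forall t, 0 <= f t) ->
  \int[power_prob P n.+1]_t f t =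
  \int[P]_x \int[power_prob P n]_t f (tuple_cons (x, t)).
Proof.
move=> mf f0; rewrite /= ge0_integral_distribution//.
rewrite (@fubini_tonelli1 _ _ _ _ _ P (power_prob P n) (fun z => f (tuple_cons z)))//.
exact: (measurableT_comp mf (@measurable_tuple_cons _ T n)).
Qed.

(** Independence enters through this identity: to compare two means it suffices to compare the inner
    integrals over one coordinate with all others frozen. *)
Lemma integral_resample n (k : 'I_n) (f : n.-tuple T -> \bar R) :
  measurable_fun [set: n.-tuple T] f -> (forall t, 0 <= f t) ->
  \int[power_prob P n]_t f t = \int[power_prob P n]_t \int[P]_x f (tupd k x t).
Proof.
elim: n k f => [[]//|n IH k f mf f0].
rewrite [RHS]integral_power_probS; last 2 first.
- exact: measurable_resample.
- by move=> t; exact: integral_ge0.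
rewrite integral_power_probS//.
have mfc : measurable_fun setT (fun z : T * n.-tuple T => f (tuple_cons z)).
  exact: (measurableT_comp mf (@measurable_tuple_cons _ T n)).
case: (unliftP ord0 k) => [j ->|->]; last first.
  under [RHS]eq_integral do under eq_integral do
    under eq_integral do rewrite tupd_cons0/=.
  rewrite integral_cst//= probability_setT mule1.
  exact: (@fubini_tonelli _ _ _ _ _ P (power_prob P n) (fun z => f (tuple_cons z))).
apply: eq_integral => x _.
under [RHS]eq_integral do under eq_integral do rewrite tupd_consS/=.
rewrite -(IH j (fun t => f (tuple_cons (x, t))))//.
exact: (measurableT_comp mfc (pair1_measurable x)).
Qed.

End resampling.

(** * The absolute value of one exponential cost *)

Section exponential_law.
Context {R : realType}.
Local Notation P := (exponential1 R).

Lemma exponential1E (A : set R) :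
  (P A = \int[lebesgue_measure]_(x in A) (exponential_pdf 1 x)%:E)%E.
Proof. by []. Qed.

Lemma exponential1_set1 (a : R) : P [set a] = 0%E.
Proof. by rewrite exponential1E integral_set1. Qed.

Lemma exponential1_lt0 : P `]-oo, 0[%classic = 0%E.
Proof.
rewrite exponential1E integral0_eq// => x /=.
by rewrite in_itv/= => x0; rewrite lt0_exponential_pdf.
Qed.

Lemma exponential1_itv0c (a : R) : 0 <= a ->
  P `[0, a]%classic = (1 - (expR (- a))%:E)%E.
Proof.
rewrite le_eqVlt => /predU1P[<-|a0].
  by rewrite set_itv1 exponential1_set1 oppr0 expR0 subee.
by have := exponential_prob_itv0c 1 a0; rewrite mulN1r => <-.
Qed.

Lemma exponential1_gt (a : R) : 0 <= a ->
  P [set x | a < `|x|] = (expR (- a))%:E.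
Proof.
move=> a0.
have m0 : measurable (`]-oo, 0[%classic : set R) by [].
have m1 : measurable (`[0, a]%classic : set R) by [].
have -> : P [set x | a < `|x|] = P (~` (`]-oo, 0[ `|` `[0, a])).
  rewrite -[LHS](@measureU0 _ _ _ P _ `]-oo, 0[%classic); last 3 first.
  - rewrite (_ : [set x | _] = (fun x : R => `|x|) @^-1` `]a, +oo[); last first.
      by apply/seteqP; split => x /=; rewrite in_itv/= andbT.
    by rewrite -[X in measurable X]setTI; apply: normr_measurable.
  - by [].
  - exact: exponential1_lt0.
  rewrite -[RHS](@measureU0 _ _ _ P _ `]-oo, 0[%classic); last 3 first.
  - by apply: measurableC; exact: measurableU.
  - by [].
  - exact: exponential1_lt0.
  congr (P _); apply/seteqP; split => x /=; rewrite !in_itv/=.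
    move=> [ax|x0]; last by right.
    have [x0|x0] := ltP x 0; first by right.
    left => -[//|/andP[_ xa]].
    by move: ax; rewrite ger0_norm// ltNge xa.
  move=> [h|x0]; last by right.
  have [x0|x0] := ltP x 0; first by right.
  left; rewrite ger0_norm// ltNge; apply/negP => xa; apply: h.
  by right; rewrite x0 xa.
rewrite probability_setC; last exact: measurableU.
rewrite measureU//; last first.
  apply/seteqP; split => // x /=; rewrite !in_itv/= => -[x0 /andP[]].
  by rewrite leNgt x0.
rewrite [X in (_ - (X + _))%E](_ : _ = 0%E); last exact: exponential1_lt0.
rewrite add0e [X in (_ - X)%E](_ : _ = 1 - (expR (- a))%:E)%E; last exact: exponential1_itv0c.
by rewrite -!EFinB; congr EFin; ring.
Qed.

Lemma measurable_excess (a : R) :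
  measurable_fun [set: measurableTypeR R] (fun x : R => Order.max 0 (`|x| - a)).
Proof.
apply: measurable_maxr => //; apply: measurable_funB => //.
Qed.

(** Memorylessness: the excess over [a] has tail [exp(- a) exp(- r)], which is integrated over
    [r]. *)
Lemma integral_excess (a : R) : 0 <= a ->
  (\int[P]_x (Order.max 0 (`|x| - a))%:E = (expR (- a))%:E)%E.
Proof.
move=> a0.
pose X : R -> R := fun x => Order.max 0 (`|x| - a).
pose mX := isMeasurableFun.Build _ _ _ _ _ (measurable_excess a).
pose X' : {RV P >-> R} := HB.pack X mX.
have := @ge0_expectation_ccdf _ _ _ P X'.
rewrite expectation_def => ->; last by move=> x; rewrite /= /X le_max lexx.
transitivity (\int[lebesgue_measure]_(r in `[0%R, +oo[)
    ((expR (- a))%:E * (exponential_pdf 1 r)%:E))%E.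
  apply: eq_integral => r; rewrite inE/= in_itv/= andbT => r0.
  rewrite exponential_pdfE// mul1r mulN1r -EFinM -expRD -opprD.
  rewrite -exponential1_gt ?addr_ge0//.
  rewrite /ccdf /distribution /pushforward; congr (P _).
  apply/seteqP; split => x /=; rewrite in_itv/= andbT /X lt_max ltrBrDl.
    by rewrite ltNge r0.
  by move=> ->; rewrite orbT.
rewrite ge0_integralZl//=; last 2 first.
- by apply: measurable_funTS; apply/measurable_EFinP; exact: measurable_exponential_pdf.
- by move=> x _; rewrite lee_fin exponential_pdf_ge0.
have : P `[0, +oo[%classic = 1%E.
  have := probability_setC P (measurable_itv `]-oo, (0:R)[).
  rewrite [X in (_ - X)%E](_ : _ = 0%E); last exact: exponential1_lt0.
  by rewrite sube0 setCitvl.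
rewrite exponential1E => ->; by rewrite mule1.
Qed.

Lemma integral_clamp (a b : R) : 0 <= a -> a <= b ->
  (\int[P]_x (Order.max 0 (Order.min `|x| b - a))%:E = (expR (- a) - expR (- b))%:E)%E.
Proof.
move=> a0 ab; have b0 := le_trans a0 ab.
have m (c : R) : measurable_fun [set: measurableTypeR R]
    (fun x : R => (Order.max 0 (`|x| - c))%:E).
  by apply/measurable_EFinP; exact: measurable_excess.
have := integral_excess a0.
have -> : (fun x : R => (Order.max 0 (`|x| - a))%:E) =
   (fun x : R => (Order.max 0 (Order.min `|x| b - a))%:E + (Order.max 0 (`|x| - b))%:E)%E.
  apply/funext => x; rewrite -EFinD; congr EFin; rewrite /Order.max /Order.min.
  by case: (ltP `|x| b) => h1; do ! case: ltP => ?; lra.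
rewrite ge0_integralD//; last 3 first.
- by move=> x _; rewrite lee_fin le_max lexx.
- apply/measurable_EFinP; apply: measurable_maxr => //; apply: measurable_funB => //.
  exact: measurable_minr.
- by move=> x _; rewrite lee_fin le_max lexx.
rewrite integral_excess//.
set I := integral _ _ _ => e.
have If : I \is a fin_num.
  by apply: contra_eqT e => /fin_numPn[] ->.
move: e; rewrite -(fineK If) -EFinD => -[<-].
by congr EFin; ring.
Qed.

Lemma measurable_gt_norm (a : R) : measurable ([set x | a < `|x|] : set (measurableTypeR R)).
Proof.
rewrite (_ : [set x | _] = (fun x : R => `|x|) @^-1` `]a, +oo[); last first.
  by apply/seteqP; split => x /=; rewrite in_itv/= andbT.
by rewrite -[X in measurable X]setTI; apply: normr_measurable.
Qed.

Lemma exponential1_between (a b : R) (B : set (measurableTypeR R)) :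
  0 <= a -> a <= b -> measurable B ->
  (forall x, a < `|x| < b -> B x) -> (forall x, B x -> a <= `|x| < b) ->
  P B = (expR (- a) - expR (- b))%:E.
Proof.
move=> a0 ab mB sub sup; have b0 := le_trans a0 ab.
(* The four points where the absolute value equals an end point. They form a null set, so open and
   closed ends need not be told apart. *)
pose N : set (measurableTypeR R) := ([set a] `|` [set - a]) `|` ([set b] `|` [set - b]).
have m1 (c : R) : measurable ([set c] : set (measurableTypeR R)) by [].
have mN : measurable N by do ! apply: measurableU.
have PN : P N = 0%E.
  have PU (A C : set (measurableTypeR R)) : measurable A -> measurable C ->
    P A = 0%E -> P C = 0%E -> P (A `|` C) = 0%E.
    by move=> mA mC A0 C0; rewrite measureU0.
  by apply: (PU); try (by apply: measurableU); apply: (PU) => //; exact: exponential1_set1.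
pose U c : set (measurableTypeR R) := [set x | c < `|x|].
have mU c : measurable (U c) by exact: measurable_gt_norm.
have e : P (U a) = P (B `|` U b).
  rewrite -[LHS](measureU0 (mU a) mN PN) -[RHS](measureU0 _ mN PN); last exact: measurableU.
  have inN x : `|x| = a \/ `|x| = b -> N x.
    have [x0|x0] := leP 0 x.
      by rewrite ger0_norm//= /N => -[]->; [left; left|right; left].
    by rewrite ltr0_norm//= /N => -[<-|<-]; rewrite opprK; [left; right|right; right].
  congr (P _); apply/seteqP; split => x [|]; try by right.
  - rewrite /U /= => ax; have [xb|bx|xb] := ltgtP `|x| b.
    + by left; left; apply: sub; rewrite ax.
    + by left; right.
    + by right; apply: inN; right.
  - move=> [/sup /andP[ax _]|]; last first.
      by rewrite /U/= => bx; left; exact: le_lt_trans bx.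
    move: ax; rewrite le_eqVlt => /predU1P[ax|ax]; last by left.
    by right; apply: inN; left.
move: e; rewrite [X in X = _]exponential1_gt// measureU//; last first.
  apply/seteqP; split => // x [/sup /andP[_ xb]]; rewrite /U/= => bx.
  by have := lt_trans xb bx; rewrite ltxx.
rewrite [X in (_ + X)%E](_ : _ = (expR (- b))%:E); last exact: exponential1_gt.
move=> e; have {e} : ((expR (- a))%:E = P B + (expR (- b))%:E)%E := e.
have Bf : P B \is a fin_num by exact: fin_num_measure.
rewrite -(fineK Bf) -EFinD => -[->].
by congr EFin; ring.
Qed.

(** The density of Exp(1) equals its tail, so for [H] and [al <= be] both sides are
    [exp(- al) - exp(- be)]; otherwise both vanish. *)
Lemma integral_coordinate (H : bool) (al be : R) (B : R -> bool) : 0 <= al ->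
  measurable_fun [set: measurableTypeR R] (fun x : R => B `|x|) ->
  (forall x, 0 <= x -> H && (al < x < be) -> B x) ->
  (forall x, 0 <= x -> B x -> H && (al <= x < be)) ->
  (\int[P]_x (H%:R * Order.max 0 (Order.min `|x| be - al))%:E =
   \int[P]_x (B `|x|%R)%:R%:E)%E.
Proof.
move=> al0 mB sub sup.
have mS : measurable ([set x | B `|x|] : set (measurableTypeR R)).
  by rewrite -[X in measurable X]setTI; exact: mB.
have -> : (\int[P]_x (B `|x|%R)%:R%:E = P [set x | B `|x|%R])%E.
  rewrite -[X in P X]setIT -integral_indic//; apply: eq_integral => x _.
  by rewrite indicE; congr ((nat_of_bool _)%:R%:E); apply/idP/idP; rewrite inE.
have [Ht|Hf] := boolP H; last first.
  under eq_integral do rewrite mul0r.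
  rewrite integral0 (_ : [set x | _] = set0) ?measure0//.
  by apply/seteqP; split => // x /= /(sup _ (normr_ge0 _)); rewrite (negbTE Hf).
under eq_integral do rewrite mul1r.
rewrite Ht/= in sub sup.
have [ab|ba] := leP al be.
  rewrite integral_clamp//; apply/esym/exponential1_between => //= x.
    exact: sub.
  exact: sup.
rewrite (_ : [set x | _] = set0) ?measure0; last first.
  apply/seteqP; split => // x /= /(sup _ (normr_ge0 _)) /andP[h1 h2].
  by have := lt_trans (le_lt_trans h1 h2) ba; rewrite ltxx.
apply: integral0_eq => x _; rewrite (_ : Order.max _ _ = 0)//.
by apply/max_idPl; rewrite subr_le0 ge_min (ltW ba) orbT.
Qed.

End exponential_law.

Lemma measurable_forall d (T : measurableType d) (I : finType) (b : I -> T -> bool) :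
  (forall i, measurable_fun setT (b i)) ->
  measurable_fun setT (fun t => [forall i, b i t]).
Proof.
move=> mb; rewrite (_ : (fun t => _) = (fun t => all (b^~ t) (enum I))); last first.
  apply/funext => t; apply/forallP/allP => [h i _|h i]; first exact: h.
  by apply: h; rewrite mem_enum.
elim: (enum I) => [|i s IH]/=; first exact: measurable_cst.
exact: measurable_and.
Qed.

Lemma measurable_natbool (R : realType) d (T : measurableType d) (b : T -> bool) :
  measurable_fun setT b -> measurable_fun setT (fun t => (b t)%:R : R).
Proof.
move=> mb; rewrite (_ : (fun t => _) = (fun t => if b t then 1 else 0)).
  exact: measurable_fun_ifT.
by apply/funext => t; case: (b t).
Qed.

Lemma measurable_implyb d (T : measurableType d) (c : bool) (b : T -> bool) :
  measurable_fun setT b -> measurable_fun setT (fun t => c ==> b t).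
Proof. by case: c => //= _; exact: measurable_cst. Qed.

(** * Expectations over all costs, and almost sure genericity *)

Section expectation.
Context {R : realType} {n : nat}.
Local Notation pair := ('I_n * 'I_n)%type.
Local Notation N := #|{: pair}|.
Local Notation P := (exponential1 R).
Local Notation mu := (power_prob P N).
Implicit Types (t : N.-tuple (measurableTypeR R)) (e : pair) (S : {set 'I_n}).

(* The absolute value changes a null set only and makes every cost nonnegative. *)
Definition wt t : pair -> R := fun e => `|tnth t (enum_rank e)|.

Lemma wt_ge0 t e : 0 <= wt t e. Proof. exact: normr_ge0. Qed.

Lemma wt_tupd e x t : wt (tupd (enum_rank e) x t) = upd (wt t) e `|x|.
Proof.
apply/funext => e'; rewrite /wt /upd tnth_mktuple (inj_eq enum_rank_inj).
by case: ifP.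
Qed.

Definition mfun d (T : measurableType d) (phi : (pair -> R) -> T) :=
  measurable_fun setT (fun t => phi (wt t)).

Definition E (phi : (pair -> R) -> R) : \bar R := (\int[mu]_t (phi (wt t))%:E)%E.

Lemma mfun_coord e : mfun (fun w => w e : R).
Proof.
have mt : measurable_fun [set: N.-tuple (measurableTypeR R)]
  (fun t => tnth t (enum_rank e) : R) by exact: measurable_tnth.
exact: (measurableT_comp (@normr_measurable R setT) mt).
Qed.

Lemma mfun_upd d (T : measurableType d)
  (phi : (pair -> R) -> T) e t :
  mfun phi -> measurable_fun [set: measurableTypeR R] (fun x : R => phi (upd (wt t) e `|x|)).
Proof.
move=> mphi; rewrite (_ : (fun x => _) = (fun t => phi (wt t)) \o
  (fun x : measurableTypeR R => tupd (enum_rank e) x t)).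
  exact: (measurableT_comp mphi (measurable_tupdr _ _)).
by apply/funext => x /=; rewrite wt_tupd.
Qed.

Lemma E_resample e (phi : (pair -> R) -> R) : mfun phi -> (forall t, 0 <= phi (wt t)) ->
  E phi = (\int[mu]_t \int[P]_x (phi (upd (wt t) e `|x|))%:E)%E.
Proof.
move=> mphi phi0; rewrite /E (integral_resample _ (enum_rank e)); last 2 first.
- exact/measurable_EFinP.
- by move=> t; rewrite lee_fin.
by apply: eq_integral => t _; apply: eq_integral => x _; rewrite wt_tupd.
Qed.

Lemma E_eq_coord e (phi psi : (pair -> R) -> R) : mfun phi -> mfun psi ->
  (forall t, 0 <= phi (wt t)) -> (forall t, 0 <= psi (wt t)) ->
  (forall t, \int[P]_x (phi (upd (wt t) e `|x|))%:E =
             \int[P]_x (psi (upd (wt t) e `|x|))%:E)%E -> E phi = E psi.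
Proof.
move=> mphi mpsi phi0 psi0 h; rewrite (E_resample e mphi)// (E_resample e mpsi)//.
by apply: eq_integral => t _.
Qed.

Lemma E_ge0 (phi : (pair -> R) -> R) : (forall t, 0 <= phi (wt t)) -> (0 <= E phi)%E.
Proof. by move=> h; apply: integral_ge0 => t _; rewrite lee_fin. Qed.

Lemma E_le (phi psi : (pair -> R) -> R) : mfun phi -> mfun psi -> (forall t, 0 <= phi (wt t)) ->
  (forall t, phi (wt t) <= psi (wt t)) -> (E phi <= E psi)%E.
Proof.
move=> mphi mpsi h0 h; apply: ge0_le_integral => //; try exact/measurable_EFinP.
all: by move=> t _; rewrite lee_fin// (le_trans (h0 t)).
Qed.

Lemma E_le_coord e (phi psi : (pair -> R) -> R) : mfun phi -> mfun psi ->
  (forall t, 0 <= phi (wt t)) -> (forall t, 0 <= psi (wt t)) ->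
  (forall t, \int[P]_x (phi (upd (wt t) e `|x|))%:E <=
             \int[P]_x (psi (upd (wt t) e `|x|))%:E)%E -> (E phi <= E psi)%E.
Proof.
move=> mphi mpsi phi0 psi0 h; rewrite (E_resample e mphi)// (E_resample e mpsi)//.
have p0 (f : (pair -> R) -> R) t : (forall t, 0 <= f (wt t)) ->
    (0 <= \int[P]_x (f (upd (wt t) e `|x|))%:E)%E.
  by move=> f0; apply: integral_ge0 => x _; rewrite lee_fin -wt_tupd.
have pm (f : (pair -> R) -> R) : mfun f -> (forall t, 0 <= f (wt t)) ->
    measurable_fun [set: N.-tuple (measurableTypeR R)]
      (fun t => \int[P]_x (f (upd (wt t) e `|x|))%:E)%E.
  move=> mf f0; rewrite (_ : (fun t => _) =
    fun t => (\int[P]_x (EFin \o (f \o wt)) (tupd (enum_rank e) x t))%E).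
    by apply: measurable_resample => [|t]; [exact/measurable_EFinP|rewrite lee_fin f0].
  by apply/funext => t; apply: eq_integral => x _; rewrite /= wt_tupd.
apply: ge0_le_integral => //; try exact: pm.
all: by move=> t _; exact: p0.
Qed.

Lemma ED (phi psi : (pair -> R) -> R) : mfun phi -> mfun psi -> (forall t, 0 <= phi (wt t)) ->
  (forall t, 0 <= psi (wt t)) -> (E (fun w => phi w + psi w)%R = E phi + E psi)%E.
Proof.
move=> mphi mpsi h0 h1; rewrite /E -ge0_integralD//; try exact/measurable_EFinP.
all: by move=> t _; rewrite lee_fin.
Qed.

Lemma EZ (c : R) (phi : (pair -> R) -> R) : mfun phi -> 0 <= c -> (forall t, 0 <= phi (wt t)) ->
  (E (fun w => c * phi w)%R = c%:E * E phi)%E.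
Proof.
move=> mphi c0 h0; rewrite /E -ge0_integralZl//; try exact/measurable_EFinP.
by move=> t _; rewrite lee_fin.
Qed.

Lemma Ecst (c : R) : E (fun=> c) = c%:E.
Proof.
rewrite /E integral_cst// [X in (_ * X)%E](_ : _ = 1%E) ?mule1//.
exact: (probability_setT (power_prob P N)).
Qed.

Lemma mfunD (phi psi : (pair -> R) -> R) : mfun phi -> mfun psi -> mfun (fun w => phi w + psi w).
Proof. exact: measurable_funD. Qed.

Lemma mfunB (phi psi : (pair -> R) -> R) : mfun phi -> mfun psi -> mfun (fun w => phi w - psi w).
Proof. exact: measurable_funB. Qed.

Lemma mfunM (phi psi : (pair -> R) -> R) : mfun phi -> mfun psi -> mfun (fun w => phi w * psi w).
Proof. exact: measurable_funM. Qed.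

Lemma mfun_sum (I : Type) (r : seq I) (Q : pred I) (phi : I -> (pair -> R) -> R) :
  (forall i, mfun (phi i)) -> mfun (fun w => \sum_(i <- r | Q i) phi i w).
Proof.
move=> m; rewrite /mfun.
under eq_fun do rewrite big_mkcond/=.
apply: measurable_sum => i; case: (Q i); [exact: m|exact: measurable_cst].
Qed.

Lemma E_sum (I : Type) (r : seq I) (Q : pred I) (phi : I -> (pair -> R) -> R) :
  (forall i, mfun (phi i)) -> (forall i t, 0 <= phi i (wt t)) ->
  (E (fun w => \sum_(i <- r | Q i) phi i w)%R = \sum_(i <- r | Q i) E (phi i))%E.
Proof.
move=> m h0; rewrite /E.
under eq_integral do rewrite -sumEFin big_mkcond/=.
rewrite ge0_integral_sum//.
- rewrite [RHS]big_mkcond/=; apply: eq_bigr => i _; case: (Q i) => //.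
  by rewrite integral0.
- by move=> i; case: (Q i) => /=; [by apply/measurable_EFinP; exact: m|exact: measurable_cst].
- by move=> i t _; case: (Q i) => //; rewrite lee_fin.
Qed.

Lemma mfun_cost_comp (F : (pair -> R) -> pair -> R) S f :
  (forall e, mfun (F^~ e)) -> mfun (fun w => cost S f (F w)).
Proof. by move=> mF; apply: mfun_sum => i; exact: mF. Qed.

Lemma mfun_cost S f : mfun (fun w => cost S f w).
Proof. by apply: (@mfun_cost_comp id) => e; exact: mfun_coord. Qed.

Lemma mfun_minc_comp (F : (pair -> R) -> pair -> R) (Q : pred {ffun 'I_n -> 'I_n}) S :
  (forall e, mfun (F^~ e)) -> mfun (fun w => minc Q S (F w)).
Proof.
move=> mF; rewrite /mfun /minc; elim: (index_enum _) => [|f r IH].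
  by under eq_fun do rewrite big_nil; exact: mfun_cost_comp.
under eq_fun do rewrite big_cons; case: (Q f) => //.
by apply: measurable_minr => //; exact: mfun_cost_comp.
Qed.

Lemma mfun_minc (Q : pred {ffun 'I_n -> 'I_n}) S : mfun (fun w => minc Q S w).
Proof. by apply: (@mfun_minc_comp id) => e; exact: mfun_coord. Qed.

Lemma mfun_lt (phi psi : (pair -> R) -> R) : mfun phi -> mfun psi -> mfun (fun w => phi w < psi w).
Proof. exact: measurable_fun_ltr. Qed.

Lemma mfun_eq (phi psi : (pair -> R) -> R) : mfun phi -> mfun psi -> mfun (fun w => phi w == psi w).
Proof.
move=> m1 m2; rewrite /mfun; under eq_fun do rewrite eq_le.
by apply: measurable_and; exact: measurable_fun_ler.
Qed.

Lemma mfun_spared b S : mfun (fun w => spared b S w).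
Proof.
apply: measurable_forall => f; apply: measurable_implyb.
by apply: mfun_lt; [exact: mfun_minc|exact: mfun_cost].
Qed.

Lemma mfun_used i b S : mfun (fun w => used i b S w).
Proof.
apply: measurable_forall => f; apply: measurable_implyb.
by apply: mfun_lt; [exact: mfun_minc|exact: mfun_cost].
Qed.

Lemma mfun_generic S : mfun (fun w => generic S w).
Proof.
apply: measurable_forall => f; apply: measurable_forall => g.
rewrite (_ : (fun t => _) = fun t => (inj_on S f && inj_on S g && ~~ [forall i in S, f i == g i]) ==>
    ~~ (cost S f (wt t) == cost S g (wt t))); last first.
  apply/funext => t.
  by case: (inj_on S f); case: (inj_on S g); case: (cost _ _ _ == _); case: [forall i in S, _].
apply: measurable_implyb.
by apply: measurable_neg; apply: mfun_eq; exact: mfun_cost.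
Qed.

Lemma E_coord e : E (fun w => w e) = 1%E.
Proof.
rewrite (E_resample e (@mfun_coord e) (fun t => wt_ge0 t e)).
transitivity (E (fun=> 1)); last exact: Ecst.
apply: eq_integral => t _; rewrite -[1]expR0 -oppr0 -integral_excess//.
apply: eq_integral => x _; rewrite /upd eqxx subr0; congr EFin.
by apply/esym/max_idPr.
Qed.

Lemma E_mcost_fin S : E (fun w => mcost S w) \is a fin_num.
Proof.
have m0 t : 0 <= mcost S (wt t).
  by have [f fS ->] := mcost_ex S (wt t); apply: sumr_ge0 => i _; exact: wt_ge0.
rewrite ge0_fin_numE ?E_ge0//.
apply: (@le_lt_trans _ _ (E (fun w => cost S [ffun i => i] w))).
  apply: E_le => // [||t]; [exact: mfun_minc|exact: mfun_cost|].
  by apply: mcost_le; exact: inj_on_id.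
rewrite E_sum => [|i|i t]; [|exact: mfun_coord|exact: wt_ge0].
under eq_bigr do rewrite E_coord.
by rewrite sumEFin ltry.
Qed.

Lemma exponential1_translate (a b : R) :
  (\int[exponential1 R]_x (`|x| + a == b)%:R%:E = 0)%E.
Proof.
have h (c : R) : (\int[exponential1 R]_x (x == c)%:R%:E = 0)%E.
  rewrite -(exponential1_set1 c) -[X in exponential1 R X]setIT -integral_indic//.
  apply: eq_integral => x _; rewrite indicE; congr ((nat_of_bool _)%:R%:E).
  by apply/eqP/idP => [->|]; rewrite inE.
have m (c : R) : measurable_fun [set: measurableTypeR R] (fun x : R => (x == c)%:R%:E : \bar R).
  apply/measurable_EFinP; apply: measurable_natbool.
  under eq_fun do rewrite eq_le.
  by apply: measurable_and; exact: measurable_fun_ler.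
apply/eqP; rewrite eq_le; apply/andP; split; last by apply: integral_ge0 => x _; rewrite lee_fin.
(* The equation forces [x] to be [b - a] or [a - b], so the integrand is at most a sum of two null
   indicators. *)
rewrite -(adde0 0%E) -{1}(h (b - a)) -(h (a - b)) -ge0_integralD//.
apply: ge0_le_integral => //; try exact: emeasurable_funD.
- apply/measurable_EFinP; apply: measurable_natbool.
  under eq_fun do rewrite eq_le.
  by apply: measurable_and; apply: measurable_fun_ler => //; apply: measurable_funD => //;
    exact: normr_measurable.
move=> x _; rewrite -EFinD lee_fin -natrD ler_nat.
case: eqP => // e; have [x0|x0] := leP 0 x.
  by move: e; rewrite ger0_norm// => <-; rewrite addrK eqxx.
move: e; rewrite ltr0_norm// => <-.
by rewrite (_ : a - (- x + a) = x) ?eqxx ?addn1//; ring.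
Qed.

(** Redraw the cost of [(i, f i)], which only the first matching pays: with the other costs fixed, a
    tie pins it to one value. *)
Lemma E_cost_eq S (f g : {ffun 'I_n -> 'I_n}) i : i \in S -> f i != g i ->
  E (fun w => (cost S f w == cost S g w)%:R) = 0%E.
Proof.
move=> iS fg; rewrite (E_resample (i, f i)) => [||t]; last 2 first.
- by apply: measurable_natbool; apply: mfun_eq; exact: mfun_cost.
- by [].
apply: integral0_eq => t _.
have gf : g i != f i by rewrite eq_sym.
under eq_integral do rewrite cost_upd_eq// (cost_upd_neq _ _ _ gf).
exact: exponential1_translate.
Qed.

Lemma E_not_generic S : E (fun w => (~~ generic S w)%:R) = 0%E.
Proof.
pose T3 := ({ffun 'I_n -> 'I_n} * {ffun 'I_n -> 'I_n} * 'I_n)%type.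
pose Q (z : T3) := (z.2 \in S) && (z.1.1 z.2 != z.1.2 z.2).
pose phi (z : T3) (w : pair -> R) : R := (Q z && (cost S z.1.1 w == cost S z.1.2 w))%:R.
have mphi z : mfun (phi z).
  rewrite /phi; case: (Q z) => /=; last exact: measurable_cst.
  by apply: measurable_natbool; apply: mfun_eq; exact: mfun_cost.
have phi0 z : E (phi z) = 0%E.
  rewrite /phi; case: (boolP (Q z)) => [/andP[iS fg]|_]/=; last by rewrite Ecst.
  exact: (E_cost_eq iS fg).
apply/eqP; rewrite eq_le E_ge0// andbT.
apply: (@le_trans _ _ (E (fun w => \sum_z phi z w))); last first.
  by rewrite E_sum => [|//|z t]; [rewrite big1|rewrite /phi].
apply: E_le => //; first by apply: measurable_natbool; apply: measurable_neg; exact: mfun_generic.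
  exact: mfun_sum.
move=> t; have [gen|] := boolP (generic S (wt t)); first by rewrite sumr_ge0.
rewrite /generic negb_forall => /existsP[f]; rewrite negb_forall => /existsP[g].
rewrite negb_imply => /andP[/and3P[_ _ fg]].
rewrite negb_forall => /existsP[i]; rewrite negb_imply => /andP[iS fgi].
by rewrite (bigD1 (f, g, i))//= /phi /Q/= iS fgi fg/= lerDl sumr_ge0.
Qed.

Lemma E_generic S1 S2 (phi psi : (pair -> R) -> R) : mfun phi -> mfun psi -> (forall t, 0 <= phi (wt t)) ->
  (forall t, 0 <= psi (wt t)) ->
  (forall t, generic S1 (wt t) -> generic S2 (wt t) -> phi (wt t) = psi (wt t)) -> E phi = E psi.
Proof.
move=> mphi mpsi p0 q0 h.
have ng S : mu [set t | ~~ generic S (wt t)] = 0%E.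
  rewrite -(E_not_generic S) /E -[X in mu X]setIT -integral_indic//; last first.
    by rewrite -[X in measurable X]setTI; apply: (measurable_neg) => //; exact: mfun_generic.
  apply: eq_integral => t _; rewrite indicE; congr ((nat_of_bool _)%:R%:E).
  by apply/idP/idP; rewrite inE.
have mg S : measurable [set t | ~~ generic S (wt t)].
  by rewrite -[X in measurable X]setTI; apply: (measurable_neg) => //; exact: mfun_generic.
apply: ge0_ae_eq_integral => //.
- exact/measurable_EFinP.
- exact/measurable_EFinP.
- by move=> t _; rewrite lee_fin.
- by move=> t _; rewrite lee_fin.
exists ([set t | ~~ generic S1 (wt t)] `|` [set t | ~~ generic S2 (wt t)]); split.
- exact: measurableU.
- by rewrite measureU0; [exact: ng|exact: mg|exact: mg|exact: ng].
move=> t /= ht; apply/orP; rewrite -negb_and; apply/negP => /andP[g1 g2].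
by apply: ht => _; rewrite h.
Qed.

End expectation.

(** * The expected cost on the complete graph *)

Section increments.
Context {R : realType} {n : nat}.
Hypothesis n2 : (1 < n)%N.
Implicit Types S : {set 'I_n}.
Local Notation weight := ('I_n * 'I_n -> R).

Definition ecost S : R := fine (E (fun w : weight => mcost S w)).

Lemma ecostE S : E (fun w : weight => mcost S w) = (ecost S)%:E.
Proof. by rewrite /ecost fineK// E_mcost_fin. Qed.

(** The growth of the marginal cost of row [i] when [s] is added to [S :\ s]. Row [s] itself is new,
    so its earlier marginal cost counts as 0. *)
Definition marginal S s i (w : weight) : R := mcost S w - mcost (S :\ i) w -
  (if i == s then 0 else mcost (S :\ s) w - mcost (S :\ s :\ i) w).

Lemma mfun_mcost S : mfun (fun w : weight => mcost S w).
Proof. exact: mfun_minc. Qed.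

Lemma mfun_marginal S s i : mfun (marginal S s i).
Proof.
apply: mfunB; first by apply: mfunB; exact: mfun_mcost.
by case: (i == s); [exact: measurable_cst|apply: mfunB; exact: mfun_mcost].
Qed.

Lemma sub_rearrange (a b c d : R) : b + c <= a + d -> 0 <= a - b - (c - d).
Proof. by move=> *; lra. Qed.

Lemma marginal_ge0 S s i (w : weight) : (forall e, 0 <= w e) -> i \in S -> s \in S ->
  0 <= marginal S s i w.
Proof.
move=> w0 iS sS; rewrite /marginal; case: eqP => [_|/eqP is_].
  by rewrite subr0 subr_ge0 mcost_le_D1.
by apply: sub_rearrange; exact: mcost_supermodular.
Qed.

Lemma mcost_ge0 S (w : weight) : (forall e, 0 <= w e) -> 0 <= mcost S w.
Proof. by move=> w0; have [f fS ->] := mcost_ex S w; apply: sumr_ge0. Qed.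

(** Additivity of [E] is available for nonnegative functions only; the mean of a difference is
    recovered from an identity between sums. *)
Lemma fin_rearrange (x : \bar R) (a b c d : R) :
  (x + (b%:E + c%:E) = a%:E + d%:E)%E -> x = (a - b - (c - d))%:E.
Proof.
case: x => [r| |]//; rewrite -!EFinD => -[e]; congr EFin.
by rewrite -[r](addrK (b + c)) e; ring.
Qed.

Lemma E_marginal S s i : i \in S -> s \in S -> E (marginal S s i) =
  (ecost S - ecost (S :\ i) - (if i == s then 0 else ecost (S :\ s) - ecost (S :\ s :\ i)))%:E.
Proof.
move=> iS sS; have m0 X t : 0 <= mcost X (wt t : weight) by exact/mcost_ge0/wt_ge0.
have d0 t : 0 <= marginal S s i (wt t) by apply: marginal_ge0 => // e; exact: wt_ge0.
have [is_|is_] := eqVneq i s.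
  rewrite (_ : _ - 0 = ecost S - ecost (S :\ i) - (0 - 0)); last by rewrite !subr0.
  apply: fin_rearrange; rewrite !adde0 -!ecostE -ED => //; try exact: mfun_mcost.
    congr E; apply/funext => w; rewrite /marginal is_ eqxx; ring.
  exact: mfun_marginal.
apply: fin_rearrange; rewrite -!ecostE -!ED => //; try (by move=> t; rewrite addr_ge0);
  try exact: mfun_mcost; try exact: mfun_marginal; try (by apply: mfunD; exact: mfun_mcost).
congr E; apply/funext => w; rewrite /marginal (negbTE is_); ring.
Qed.

Lemma E_spared_marginal S s i b : i \in S -> s \in S ->
  E (fun w : weight => (spared b (S :\ s) w)%:R * marginal S s i w) =
  E (fun w : weight => (spared b (S :\ s) w && used i b S w)%:R).
Proof.
move=> iS sS.
have m1 : mfun (fun w : weight => (spared b (S :\ s) w)%:R * marginal S s i w).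
  by apply: mfunM; [apply: measurable_natbool; exact: mfun_spared|exact: mfun_marginal].
have m2' : mfun (fun w : weight => spared b (S :\ s) w && used i b S w).
  by apply: measurable_and; [exact: mfun_spared|exact: mfun_used].
apply: (E_eq_coord (e := (i, b))) => //.
- exact: measurable_natbool.
- move=> t; apply: mulr_ge0 => //; apply: marginal_ge0 => // e; exact: wt_ge0.
move=> t; have [H [al [be [al0 h]]]] := coordinate n2 b (wt_ge0 t) iS sS.
rewrite -(@integral_coordinate R H al be (fun x => spared b (S :\ s) (upd (wt t) (i, b) x) &&
   used i b S (upd (wt t) (i, b) x)) al0).
- by apply: eq_integral => x _; have [<- _ _] := h `|x| (normr_ge0 _).
- exact: (mfun_upd (i, b) t m2').
- by move=> x x0 Hx; have [_ + _] := h x x0; apply.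
- by move=> x x0 Hx; have [_ _] := h x x0; apply.
Qed.

(** Sum [E_spared_marginal] over rows and columns. On the left, each free column contributes the
    total growth of the marginal costs, and almost surely there are [n - #|S :\ s|] of them. On the
    right, exactly one pair is newly used. *)
Lemma card_spared_marginal S s : s \in S ->
  (n - #|S :\ s|)%:R * (\sum_(i in S) (ecost S - ecost (S :\ i))
     - \sum_(i in S :\ s) (ecost (S :\ s) - ecost (S :\ s :\ i))) = 1.
Proof.
move=> sS; apply: EFin_inj.
have d0 i t : i \in S -> 0 <= marginal S s i (wt t).
  by move=> iS; apply: marginal_ge0 => // e; exact: wt_ge0.
pose psi i (w : weight) := \sum_b (spared b (S :\ s) w && used i b S w)%:R : R.
pose phi i (w : weight) := \sum_b (spared b (S :\ s) w)%:R * marginal S s i w.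
have mb i b : mfun (fun w : weight => (spared b (S :\ s) w && used i b S w)%:R : R).
  apply: measurable_natbool; apply: measurable_and; [exact: mfun_spared|exact: mfun_used].
have mbs i b : mfun (fun w : weight => (spared b (S :\ s) w)%:R * marginal S s i w).
  by apply: mfunM; [apply: measurable_natbool; exact: mfun_spared|exact: mfun_marginal].
have psi0 i w : 0 <= psi i w by apply: sumr_ge0.
have -> : 1%:E = E (fun w => \sum_(i in S) psi i w).
  rewrite -(@Ecst R n 1); apply: (@E_generic _ _ S (S :\ s)) => //.
  - exact: measurable_cst.
  - by apply: mfun_sum => i; apply: mfun_sum => b.
  - by move=> t; exact: sumr_ge0.
  - by move=> t g1 g2; rewrite -[LHS](sum_spared_used sS g1 g2).
rewrite E_sum => [|i|i t]; [|by apply: mfun_sum|by []].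
have psiE i : i \in S -> E (psi i) = ((n - #|S :\ s|)%:R%:E * E (marginal S s i))%E.
  move=> iS; rewrite -EZ//; [|exact: mfun_marginal|by move=> t; exact: d0].
  rewrite /psi E_sum//.
  transitivity (E (phi i)).
    rewrite /phi E_sum//; last by move=> b t; rewrite mulr_ge0// d0.
    by apply: eq_bigr => b _; rewrite E_spared_marginal.
  apply: (@E_generic _ _ S (S :\ s)) => //.
  - exact: mfun_sum.
  - by apply: mfunM; [exact: measurable_cst|exact: mfun_marginal].
  - by move=> t; apply: sumr_ge0 => b _; rewrite mulr_ge0// d0.
  - by move=> t; rewrite mulr_ge0// d0.
  move=> t g1 g2; rewrite /phi -mulr_suml; congr (_ * _).
  exact: card_spared (neqT_D1 S s) g2.
rewrite (eq_bigr _ psiE) -ge0_sume_distrr; last first.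
  by move=> i iS; apply: E_ge0 => t; exact: d0.
rewrite EFinM; congr (_ * _)%E.
transitivity (\sum_(i in S) (ecost S - ecost (S :\ i) -
    (if i == s then 0 else ecost (S :\ s) - ecost (S :\ s :\ i))))%:E.
  congr EFin; rewrite [RHS]big_split/=; congr (_ + _); rewrite sumrN; congr (- _).
  rewrite [RHS](big_setD1 s)//= eqxx add0r; apply: eq_bigr => i.
  by rewrite !inE => /andP[/negbTE ->].
by rewrite -sumEFin; apply: eq_bigr => i iS; rewrite E_marginal.
Qed.

Definition harmonic_tail r : R := \sum_(0 <= k < r) ((n - k)%:R)^-1.

Lemma sum_marginal_ecost S :
  \sum_(i in S) (ecost S - ecost (S :\ i)) = harmonic_tail #|S|.
Proof.
elim: {S}#|S| {-2}S (erefl #|S|) => [|r IH] S Sr.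
  by rewrite (cards0_eq Sr) big_set0 /harmonic_tail big_geq ?cards0.
have [s sS] : exists s, s \in S by apply/set0Pn; rewrite -card_gt0 Sr.
have S's : #|S :\ s| = r by apply/eqP; rewrite -eqSS -Sr (cardsD1 s S) sS.
have rn : (r < n)%N by rewrite -Sr -[leqRHS](card_ord n) max_card.
have := card_spared_marginal sS; rewrite (IH _ S's) S's => e.
rewrite Sr /harmonic_tail big_nat_recr//= -/(harmonic_tail r).
apply/eqP; rewrite addrC -subr_eq; apply/eqP.
apply: (@mulfI _ (n - r)%:R); first by rewrite pnatr_eq0 subn_eq0 -ltnNge.
by rewrite e divff// pnatr_eq0 subn_eq0 -ltnNge.
Qed.

(** By induction all sets [S :\ i] have the same expected cost, so the terms of [sum_marginal_ecost]
    are equal and one divides by their number. *)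
Lemma ecost_card S :
  ecost S = \sum_(0 <= r < #|S|) r.+1%:R^-1 * harmonic_tail r.+1.
Proof.
elim: {S}#|S| {-2}S (erefl #|S|) => [|r IH] S Sr.
  rewrite (cards0_eq Sr) big_geq ?cards0//; apply: EFin_inj; rewrite -ecostE -(@Ecst R n 0).
  congr E; apply/funext => w; have [f _ ->] := mcost_ex finset.set0 w.
  by rewrite /cost big_set0.
have := sum_marginal_ecost S; rewrite Sr big_nat_recr//=.
rewrite (eq_bigr (fun _ => ecost S - \sum_(0 <= r < r) r.+1%:R^-1 * harmonic_tail r.+1)).
  rewrite sumr_const Sr => <-.
  rewrite -[X in _ + _ * X]mulr_natl mulrA mulVf ?pnatr_eq0// mul1r; ring.
move=> i iS; have S'i : #|S :\ i| = r by apply/eqP; rewrite -eqSS -Sr (cardsD1 i S) iS.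
by rewrite (IH _ S'i) S'i.
Qed.

End increments.

(** * The partial sums of the series of inverse squares and their limit *)

Section zeta2.
Context {R : realType}.

Definition zeta2 n : R := \sum_(0 <= k < n) (k.+1%:R ^+ 2)^-1.

Lemma sum_shift (n r : nat) : (r < n)%N ->
  \sum_(0 <= k < r.+1) ((n.+1 - k)%:R)^-1 =
  \sum_(0 <= k < r.+1) ((n - k)%:R)^-1 + (n.+1%:R^-1 - (n - r)%:R^-1) :> R.
Proof.
move=> rn; rewrite big_nat_recl// subn0 [in RHS]big_nat_recr//=.
under eq_bigr do rewrite subSS.
ring.
Qed.

Lemma sum_harmonic_tail n :
  \sum_(0 <= r < n) r.+1%:R^-1 * \sum_(0 <= k < r.+1) ((n - k)%:R)^-1 = zeta2 n.
Proof.
elim: n => [|n IH]; first by rewrite /zeta2 !big_geq.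
have nz m : m.+1%:R != 0 :> R by rewrite pnatr_eq0.
(* Passing from [n] to [n + 1] changes the term of index [r] by exactly [- 1 / ((n + 1) (n - r))].
   These corrections cancel the new last term except for [1 / (n + 1)^2]. *)
rewrite big_nat_recr//= (eq_big_nat _ _ (F2 := fun r => r.+1%:R^-1 *
   \sum_(0 <= k < r.+1) ((n - k)%:R)^-1 - n.+1%:R^-1 * (n - r)%:R^-1)); last first.
  move=> r /andP[_ rn]; rewrite sum_shift// mulrDr; congr (_ + _).
  have -> : n.+1%:R = r.+1%:R + (n - r)%:R :> R by rewrite -natrD; congr (_%:R); lia.
  have : (n - r)%:R != 0 :> R by rewrite pnatr_eq0; lia.
  have := nz r.
  have : r.+1%:R + (n - r)%:R != 0 :> R by rewrite -natrD pnatr_eq0; lia.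
  by move=> *; field; apply/and3P; split.
rewrite big_split/= IH sumrN -mulr_sumr /zeta2 [in RHS]big_nat_recr//= -/(zeta2 n).
rewrite -addrA; congr (_ + _).
rewrite (big_nat_recl n)//= subn0.
under [X in _ + _ * (_ + X)]eq_bigr do rewrite subSS.
by rewrite mulrDr addrC -addrA subrr addr0 -invfM -expr2.
Qed.

Lemma mvt_le (f df : R -> R) (a b k : R) : a <= b ->
  (forall x, a <= x <= b -> is_derive x 1 f (df x)) ->
  (forall x, a <= x <= b -> df x <= k) -> f b - f a <= k * (b - a).
Proof.
move=> ab fd dk.
have [||c] := @MVT_segment R f df a b ab.
- by move=> x; rewrite in_itv/= => /andP[/ltW ax /ltW xb]; apply: fd; rewrite ax.
- apply: derivable_within_continuous => x; rewrite in_itv/= => xab.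
  by have := fd x xab => -[].
rewrite in_itv/= => cab ->; rewrite ler_wpM2r ?subr_ge0//; exact: dk.
Qed.

Lemma sin_le_id (x : R) : 0 <= x -> sin x <= x.
Proof.
move=> x0; have := @mvt_le sin cos 0 x 1 x0.
rewrite sin0 !subr0 mul1r; by apply => y _; exact: cos_le1.
Qed.

Lemma id_le_tan (x : R) : 0 <= x < pi / 2 -> x <= tan x.
Proof.
move=> /andP[x0 xpi].
have c0 y : 0 <= y <= x -> 0 < cos y.
  move=> /andP[y0 yx]; apply: cos_gt0_pihalf; rewrite (le_lt_trans yx)// andbT.
  by apply: lt_le_trans y0; rewrite oppr_lt0 divr_gt0// pi_gt0.
have := @mvt_le (fun y => - tan y) (fun y => - (cos y) ^- 2) 0 x (-1) x0.
rewrite tan0 oppr0 !subr0 mulN1r lerN2 addr0; apply => y yx.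
  have := @is_derive_tan R y; rewrite gt_eqF ?c0// => /(_ isT) h.
  exact: is_deriveN.
by rewrite lerN2 invf_ge1 ?exprn_gt0 ?c0// expr_le1 ?cos_le1// ltW// c0.
Qed.

Lemma inv_sin2_double (x : R) : sin (x *+ 2) != 0 ->
  (sin (x *+ 2) ^+ 2)^-1 = 4^-1 * ((sin x ^+ 2)^-1 + (cos x ^+ 2)^-1).
Proof.
rewrite sin_mulr2n -mulr_natr !mulf_eq0 !negb_or -andbA => /and3P[c0 s0 _].
have := cos2Dsin2 x; move: c0 s0; move: (cos x) (sin x) => c s c0 s0 e.
by rewrite -[LHS]mul1r -{1}e; field; rewrite c0 s0.
Qed.

Lemma sin_pihalfB (x : R) : sin (pi / 2 - x) = cos x.
Proof. by rewrite sinB sin_pihalf cos_pihalf; ring. Qed.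

Lemma odd_angle k m : (k < 2 ^ m)%N ->
  0 < (k.*2.+1%:R * pi / 2 ^+ m.+2 : R) < pi / 2.
Proof.
move=> km; have p0 : 0 < 2 ^+ m.+2 :> R by rewrite exprn_gt0.
apply/andP; split; first by apply: divr_gt0 => //; apply: mulr_gt0; rewrite ?pi_gt0 ?ltr0n.
rewrite ltr_pdivrMr// -subr_gt0.
have -> : pi / 2 * 2 ^+ m.+2 - k.*2.+1%:R * pi = (2 ^+ m.+1 - k.*2.+1%:R) * pi :> R.
  by rewrite [2 ^+ m.+2]exprS; field.
rewrite mulr_gt0 ?pi_gt0// subr_gt0 -natrX ltr_nat expnS; lia.
Qed.

(** Halving the angles: by [inv_sin2_double] each term is a quarter of the sum of the inverse
    squares of the sine and cosine of half its angle, and the cosines are sines of complementary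
    angles of the finer grid. *)
Lemma sum_inv_sin2 N : \sum_(0 <= k < 2 ^ N)
  (sin (k.*2.+1%:R * pi / 2 ^+ N.+2) ^+ 2)^-1 = 2 * 4 ^+ N :> R.
Proof.
elim: N => [|N IH].
  rewrite expn0 big_nat1 mul1r mulr1.
  have := @inv_sin2_double (pi / 4).
  have e : pi / 4 *+ 2 = pi / 2 :> R by rewrite -mulr_natr; field.
  have -> : cos (pi / 4) = sin (pi / 4) :> R.
    by rewrite -sin_pihalfB; congr sin; rewrite -e mulr2n addrK.
  rewrite e sin_pihalf expr1n invr1 oner_eq0 => /(_ isT).
  have -> : pi / 2 ^+ 2 = pi / 4 :> R by field.
  by move=> h; lra.
have h2 : (2 ^ N.+1 = 2 ^ N + 2 ^ N)%N by rewrite expnS mul2n addnn.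
rewrite h2 (big_cat_nat (n := 2 ^ N)) ?leq_addr//=.
(* The second half of the sum is reversed, so that each angle is paired with its complement to
   [pi / 2]. *)
rewrite -{2}[(2 ^ N)%N]add0n big_addn addnK [X in _ + X]big_nat_rev/= add0n -big_split/=.
rewrite (eq_big_nat _ _ (F2 := fun k => 4 *
  (sin (k.*2.+1%:R * pi / 2 ^+ N.+2) ^+ 2)^-1)).
  by rewrite -mulr_sumr IH exprS; ring.
move=> k /andP[_ kN]; pose y : R := k.*2.+1%:R * pi / 2 ^+ N.+3.
have p0 : 2 ^+ N != 0 :> R by rewrite expf_neq0.
have -> : k.*2.+1%:R * pi / 2 ^+ N.+2 = y *+ 2 :> R.
  by rewrite /y -mulr_natr !exprS; field.
rewrite inv_sin2_double; last first.
  have /andP[a0 a1] := odd_angle kN.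
  rewrite (_ : y *+ 2 = k.*2.+1%:R * pi / 2 ^+ N.+2); last first.
    by rewrite /y -mulr_natr !exprS; field.
  by rewrite gt_eqF// sin_gt0_pihalf// a0.
rewrite mulrA mulfV// mul1r; congr (_ + _^-1); congr (_ ^+ 2).
rewrite -sin_pihalfB; congr sin.
have -> : (2 ^ N - k.+1 + 2 ^ N).*2.+1 = (4 * 2 ^ N - k.*2.+1)%N by lia.
rewrite natrB; last by lia.
by rewrite natrM natrX /y !exprS; field.
Qed.

(** Since [sin y <= y <= tan y], the inverse square of [y] lies between that of [sin y] and the same
    minus 1. The factor [c] is the square of [pi / 2^(N+2)], which turns the angles into odd
    integers, and [sum_inv_sin2] evaluates the outer sums. *)
Lemma zeta2_odd N : pi ^+ 2 / 8 * (1 - 2^-1 ^+ N) <=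
  (\sum_(0 <= k < 2 ^ N) (k.*2.+1%:R ^+ 2)^-1 : R) <= pi ^+ 2 / 8.
Proof.
have p0 : 0 < 2 ^+ N :> R by rewrite exprn_gt0.
have pp := @pi_gt0 R.
pose c : R := pi ^+ 2 / 16 / 4 ^+ N.
have p4 : 4 ^+ N = 2 ^+ N * 2 ^+ N :> R by rewrite -exprMn; congr (_ ^+ _); ring.
have c0 : 0 <= c by rewrite /c !divr_ge0// ?exprn_ge0// ltW.
have e k : (k.*2.+1%:R ^+ 2)^-1 = c * ((k.*2.+1%:R * pi / 2 ^+ N.+2) ^+ 2)^-1.
  have k0 : k.*2.+1%:R != 0 :> R by rewrite pnatr_eq0.
  have pi0 : pi != 0 :> R by rewrite gt_eqF.
  have pn : 2 ^+ N != 0 :> R by rewrite gt_eqF.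
  rewrite /c p4 [2 ^+ N.+2]exprS [2 ^+ N.+1]exprS; move: k0 pi0 pn; move: (k.*2.+1%:R : R) (pi : R) (2 ^+ N : R) => a q m a0 q0 m0.
  by field; rewrite a0 q0 m0.
under eq_bigr do rewrite e.
rewrite -mulr_sumr.
have bnd k : (k < 2 ^ N)%N -> let y : R := k.*2.+1%:R * pi / 2 ^+ N.+2 in
   (sin y ^+ 2)^-1 - 1 <= (y ^+ 2)^-1 <= (sin y ^+ 2)^-1.
  move=> /odd_angle; move: (_ / _) => y /andP[y0 y1] /=.
  have s0 : 0 < sin y by rewrite sin_gt0_pihalf// y0.
  have c1 : 0 < cos y.
    by apply: cos_gt0_pihalf; rewrite y1 andbT (lt_trans _ y0)// oppr_lt0 divr_gt0.
  have t := @id_le_tan y; rewrite (ltW y0) y1 in t; have {t} := t isT.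
  rewrite /tan => yt; apply/andP; split.
    have -> : (sin y ^+ 2)^-1 - 1 = ((sin y / cos y) ^+ 2)^-1.
      have := cos2Dsin2 y; have := lt0r_neq0 s0; have := lt0r_neq0 c1.
      move: (cos y) (sin y) => c' s' h1 h2 h3.
      by rewrite -[X in X - _]mul1r -{1}h3; field; rewrite h1 h2.
    rewrite lef_pV2 ?posrE ?exprn_gt0 ?divr_gt0//.
    by apply: lerXn2r => //; rewrite nnegrE ltW// divr_gt0.
  rewrite lef_pV2 ?posrE ?exprn_gt0//.
  by apply: lerXn2r; rewrite ?nnegrE; [exact: ltW|exact: ltW|apply: sin_le_id; exact: ltW].
have ce : c * (2 * 4 ^+ N) = pi ^+ 2 / 8.
  by rewrite /c; field; rewrite expf_neq0.
apply/andP; split; last first.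
  rewrite -ce -sum_inv_sin2 ler_wpM2l// big_nat [leRHS]big_nat ler_sum// => k /andP[_ kN].
  by case/andP: (bnd k kN).
have ceN : pi ^+ 2 / 8 * 2^-1 ^+ N = 2 * c * 2 ^+ N.
  by rewrite /c p4 exprVn; field; rewrite gt_eqF.
rewrite mulrBr mulr1 ceN -{1}ce -sum_inv_sin2.
apply: (@le_trans _ _ (c * (\sum_(0 <= k < 2 ^ N)
  ((sin (k.*2.+1%:R * pi / 2 ^+ N.+2) ^+ 2)^-1 - 1)))).
  rewrite sumrB mulrBr lerB// sumr_const_nat subn0 natrX -mulrA ler_peMl ?ler1n//.
  by rewrite mulr_ge0// ltW.
rewrite ler_wpM2l// big_nat [leRHS]big_nat ler_sum// => k /andP[_ kN].
by case/andP: (bnd k kN).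
Qed.

Lemma zeta2_double n :
  zeta2 n.*2 = \sum_(0 <= k < n) (k.*2.+1%:R ^+ 2)^-1 + zeta2 n / 4.
Proof.
elim: n => [|n IH]; first by rewrite /zeta2 !big_geq// mul0r addr0.
rewrite doubleS /zeta2 !big_nat_recr//= -/(zeta2 n.*2) -/(zeta2 n) IH.
rewrite -doubleS -[n.+1.*2]muln2 natrM exprMn mulrDl.
have -> : (n.+1%:R ^+ 2 * 2 ^+ 2)^-1 = (n.+1%:R ^+ 2)^-1 / 4 :> R.
  by rewrite invfM; congr (_ * _^-1); ring.
ring.
Qed.

Lemma zeta2_le_double n : zeta2 n <= zeta2 n.*2.
Proof.
rewrite /zeta2 [leRHS](big_cat_nat (n := n)) ?leq_double//=; last by rewrite -addnn leq_addr.
by rewrite lerDl sumr_ge0// => k _; rewrite invr_ge0 exprn_ge0.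
Qed.

(** As [zeta2 n <= zeta2 n.*2], splitting off the even terms leaves three quarters of [zeta2 n]
    bounded by the odd sum, hence by [pi^2 / 8]. *)
Lemma zeta2_le n : zeta2 n <= pi ^+ 2 / 6.
Proof.
have nN : (n <= 2 ^ n)%N by rewrite ltnW// ltn_expl.
have oN : \sum_(0 <= k < n) (k.*2.+1%:R ^+ 2)^-1 <= pi ^+ 2 / 8 :> R.
  apply: (@le_trans _ _ (\sum_(0 <= k < 2 ^ n) (k.*2.+1%:R ^+ 2)^-1)).
    by rewrite [leRHS](big_cat_nat (n := n))//= lerDl sumr_ge0.
  by case/andP: (zeta2_odd n).
have := zeta2_le_double n; rewrite zeta2_double.
by move: oN; move: (\sum_(_ <= _ < _) _) (zeta2 n) (pi ^+ 2) => a b c *; lra.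
Qed.

(** The error constant [pi^2 / 2] is chosen to close the induction: [pi^2 / 8] from the odd terms
    and a quarter of itself from the even ones add up to one half of it. *)
Lemma zeta2_ge N : pi ^+ 2 / 6 - pi ^+ 2 / 2 * 2^-1 ^+ N <= zeta2 (2 ^ N).
Proof.
elim: N => [|N IH].
  rewrite expr0 mulr1 /zeta2 big_nat1 expr1n invr1.
  by apply: (@le_trans _ _ 0) => //; have := sqr_ge0 (@pi R); move: (pi ^+ 2) => *; lra.
rewrite expnS mul2n zeta2_double.
have /andP[oN _] := zeta2_odd N; move: oN IH; rewrite [2^-1 ^+ N.+1]exprS.
have := sqr_ge0 (@pi R); have : 0 <= (2^-1 : R) ^+ N by rewrite exprn_ge0.
move: (\sum_(_ <= _ < _) _) (zeta2 _) (pi ^+ 2) (2^-1 ^+ N) => a b c e e0 c0 h1 h2.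
have := mulr_ge0 e0 c0; lra.
Qed.

Lemma cvg_zeta2 : zeta2 n @[n --> \oo] --> (pi ^+ 2 / 6 : R).
Proof.
apply/cvgrPdist_le => e e0.
have [N hN] : exists N, pi ^+ 2 / 2 * 2^-1 ^+ N <= e :> R.
  have : (geometric (pi ^+ 2 / 2) 2^-1 : R^nat) @ \oo --> (0 : R).
    by apply: cvg_geometric; rewrite ger0_norm ?invr_ge0// invf_lt1// ltr1n.
  move=> /cvgrPdist_le /(_ e e0) [N _ /(_ N (leqnn N))].
  rewrite /= sub0r normrN => h; exists N; exact: le_trans (ler_norm _) h.
exists (2 ^ N)%N => // n /= nN.
rewrite ger0_norm ?subr_ge0 ?zeta2_le//.
have := zeta2_ge N; have : zeta2 (2 ^ N) <= zeta2 n.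
  by rewrite /zeta2 [leRHS](big_cat_nat (n := 2 ^ N))//= lerDl sumr_ge0.
by move: hN; move: (zeta2 _) (zeta2 _) (pi ^+ 2 / 6) (_ * _) => *; lra.
Qed.

End zeta2.

(** * Comparison of the random graph with the complete graph *)

Section random_graph.
Context {R : realType} {n : nat}.
Local Notation pair := ('I_n * 'I_n)%type.
Variable p : R.
Hypothesis p01 : 0 <= p <= 1.
Implicit Types (G H : bigraph n) (e : pair).

Definition wG G : R := \prod_(e : pair) (if e \in G then p else 1 - p).

Definition EG (g : bigraph n -> R) : R := \sum_G wG G * g G.

Lemma wG_ge0 G : 0 <= wG G.
Proof.
by apply: prodr_ge0 => e _; case: ifP => _; case/andP: p01 => // *; rewrite subr_ge0.
Qed.

Lemma EG_prod (h : pair -> bool -> R) :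
  EG (fun G => \prod_e h e (e \in G)) = \prod_e (p * h e true + (1 - p) * h e false).
Proof.
rewrite bigA_distr; apply: eq_big => [G|G _]; first by rewrite inE.
rewrite /wG -big_split/=; apply: eq_bigr => e _.
by case: (e \in G).
Qed.

Lemma EG_cst c : EG (fun=> c) = c.
Proof.
rewrite /EG -mulr_suml (_ : \sum_G wG G = 1) ?mul1r//.
transitivity (EG (fun G => \prod_(e : pair) 1)).
  by apply: eq_bigr => G _; rewrite big1 ?mulr1.
rewrite (EG_prod (fun _ _ => 1)) big1// => e _.
by rewrite !mulr1 subrKC.
Qed.

Lemma EG_le g h : (forall G, g G <= h G) -> EG g <= EG h.
Proof. by move=> gh; apply: ler_sum => G _; rewrite ler_wpM2l ?wG_ge0. Qed.

Lemma EG_ge0 g : (forall G, 0 <= g G) -> 0 <= EG g.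
Proof. by move=> g0; apply: sumr_ge0 => G _; rewrite mulr_ge0 ?wG_ge0. Qed.

Lemma EGD g h : EG (fun G => g G + h G) = EG g + EG h.
Proof. by rewrite /EG -big_split/=; apply: eq_bigr => G _; rewrite mulrDr. Qed.

Lemma EGZ c g : EG (fun G => c * g G) = c * EG g.
Proof. by rewrite /EG mulr_sumr; apply: eq_bigr => G _; rewrite mulrCA. Qed.

Lemma EGB g h : EG (fun G => g G - h G) = EG g - EG h.
Proof. by rewrite /EG -sumrB; apply: eq_bigr => G _; rewrite mulrBr. Qed.

Lemma EG_sum (I : finType) (Q : pred I) (g : I -> bigraph n -> R) :
  EG (fun G => \sum_(i | Q i) g i G) = \sum_(i | Q i) EG (g i).
Proof. by rewrite /EG exchange_big/=; apply: eq_bigr => G _; rewrite mulr_sumr. Qed.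

Lemma wG_edge e G : wG G = (if e \in G then p else 1 - p) *
  \prod_(e' | e' != e) (if e' \in G then p else 1 - p).
Proof. by rewrite /wG (bigD1 e). Qed.

(** Conditioning on the presence of [e]: the graphs are grouped in pairs that differ in [e] only. *)
Lemma EG_edge e g :
  EG g = EG (fun G => p * g (e |: G) + (1 - p) * g (G :\ e)).
Proof.
pose w' G := \prod_(e' | e' != e) (if e' \in G then p else 1 - p).
have w'U G : w' (e |: G) = w' G.
  by apply: eq_bigr => e' e'e; rewrite !inE (negbTE e'e).
have w'D G : w' (G :\ e) = w' G.
  by apply: eq_bigr => e' e'e; rewrite !inE e'e.
have split f : EG f = \sum_(G : bigraph n | e \in G) w' G * (p * f G + (1 - p) * f (G :\ e)).
  rewrite /EG (bigID (fun G => e \in G))/=.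
  rewrite [X in _ + X](reindex_onto (fun G => G :\ e) (fun G => e |: G))/=; last first.
    by move=> G eG; rewrite finset.setU1K.
  rewrite [X in _ + X](eq_bigl (fun G => e \in G)); last first.
    move=> G; rewrite !inE eqxx/=; apply/eqP/idP => [<-|eG]; last by rewrite finset.setD1K.
    by rewrite !inE eqxx.
  rewrite -big_split/=; apply: eq_bigr => G eG.
  rewrite !(wG_edge e) eG !inE eqxx/= -/(w' G) -/(w' (G :\ e)) w'D; ring.
rewrite (split g) (split (fun G => _)); apply: eq_bigr => G eG.
have -> : e |: G = G by apply/finset.setUidPr; rewrite finset.sub1set.
have -> : e |: (G :\ e) = G by rewrite finset.setD1K.
have -> : G :\ e :\ e = G :\ e by apply/finset.setP => x; rewrite !inE; case: eqP.
congr (_ * _); ring.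
Qed.

End random_graph.

Section one_coordinate.
Context {R : realType}.
Local Notation P := (exponential1 R).

Lemma integral_min (rho b : R) : 0 < rho -> 0 <= b ->
  (\int[P]_x (Order.min (`|x| / rho) b)%:E = ((1 - expR (- (rho * b))) / rho)%:E)%E.
Proof.
move=> rho0 b0; have rb0 : 0 <= rho * b by rewrite mulr_ge0// ltW.
have := integral_clamp (lexx 0) rb0; rewrite oppr0 expR0.
move=> e; rewrite [X in _ = X%:E]mulrC EFinM -e.
rewrite -ge0_integralZl//.
- apply: eq_integral => x _; rewrite -EFinM; congr EFin.
  rewrite addr0 (max_idPr _) ?le_min ?normr_ge0//.
  rewrite minr_pMr ?invr_ge0 ?(ltW rho0)// mulrC; congr Order.min.
  by rewrite mulrA mulVf ?mul1r// gt_eqF.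
- apply/measurable_EFinP; apply: measurable_maxr => //; apply: measurable_funD => //.
  by apply: measurable_minr => //; exact: normr_measurable.
- by move=> x _; rewrite lee_fin le_max lexx.
- by rewrite lee_fin invr_ge0 ltW.
Qed.

Lemma measurable_min_norm (rho b : R) :
  measurable_fun [set: measurableTypeR R] (fun x : R => Order.min (`|x| / rho) b).
Proof.
apply: measurable_minr => //; apply: measurable_funM => //.
Qed.

Lemma integral_affine_min (a c rho b : R) : 0 <= a -> 0 <= c -> 0 < rho -> 0 <= b ->
  (\int[P]_x (a + c * Order.min (`|x| / rho) b)%:E =
   (a + c * ((1 - expR (- (rho * b))) / rho))%:E)%E.
Proof.
move=> a0 c0 rho0 b0.
have m0 x : 0 <= Order.min (`|x| / rho) b by rewrite le_min b0 andbT divr_ge0// ltW.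
under eq_integral do rewrite EFinD EFinM.
rewrite ge0_integralD//; first last.
- apply: measurable_funeM; apply/measurable_EFinP; exact: measurable_min_norm.
- by move=> x _; rewrite -EFinM lee_fin mulr_ge0.
rewrite integral_cst// [X in (_ * X)%E](_ : _ = 1%E); last exact: (probability_setT P).
rewrite mule1 ge0_integralZl//.
- by rewrite integral_min// -EFinM -EFinD.
- apply/measurable_EFinP; exact: measurable_min_norm.
- by move=> x _; rewrite lee_fin.
Qed.

End one_coordinate.

(** * Replacing the pairs one by one *)

Section comparison.
Context {R : realType} {n : nat}.
Hypothesis n2 : (1 < n)%N.
Local Notation pair := ('I_n * 'I_n)%type.
Local Notation weight := (pair -> R).
Local Notation P := (exponential1 R).
Variables (p K rho : R).
Hypotheses (p01 : 0 <= p <= 1) (K0 : 0 <= K) (rho0 : 0 < rho).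
Implicit Types (G Z : bigraph n) (e : pair) (c y : weight).

Definition cap (K : R) (w : weight) : weight := fun e => Order.min (w e) K.

(* A missing edge gets the cap as its cost. *)
Definition gw (K : R) G c : weight := fun e => if e \in G then c e else K.

Lemma min_cap_split (a q z k : R) : 0 <= z -> 0 <= k ->
  Order.min a (Order.min z k + q) =
  Order.min a q + Order.min z (Order.min k (Order.max 0 (a - q))).
Proof.
move=> z0 k0; have [h1|h1] := leP 0 (a - q).
  have [h2|h2] := leP k (a - q); have [h3|h3] := leP z k; rewrite /Order.min;
  by do ! case: ltP => ?; lra.
rewrite (min_idPr k0) /Order.min.
by have [h3|h3] := ltP z k; do ! case: ltP => ?; lra.
Qed.

(** The minimum cost when the pair [e] is free of charge. *)
Definition base e y : R :=
  Order.min (mcost_without e.1 e.2 [set: 'I_n]%SET y) (mcost_avoid e.2 ([set: 'I_n]%SET :\ e.1) y).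
(** How far the minimum can still rise as the capped cost of [e] grows from 0. *)
Definition slack e y : R := Order.min K (Order.max 0
  (mcost_without e.1 e.2 [set: 'I_n]%SET y - mcost_avoid e.2 ([set: 'I_n]%SET :\ e.1) y)).

Lemma slack_bound e y : 0 <= slack e y <= K.
Proof. by rewrite /slack le_min K0 ge_min lexx le_max lexx. Qed.

Lemma base_ge0 e y : (forall e', 0 <= y e') -> 0 <= base e y.
Proof.
move=> y0; have c0 S f : 0 <= cost S f y by apply: sumr_ge0.
rewrite /base le_min; have [g [_ _ ->]] := mcost_without_ex n2 e.1 e.2 [set: 'I_n]%SET y.
by have [f [_ _ ->]] := mcost_avoid_ex e.2 y (neqT_D1 [set: 'I_n]%SET e.1); rewrite !c0.
Qed.

Lemma mcost_cap_upd e y z : 0 <= z ->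
  mcost [set: 'I_n]%SET (upd y e (Order.min z K)) = base e y + Order.min z (slack e y).
Proof.
case: e => i b z0; rewrite mcost_upd ?inE//.
exact: min_cap_split.
Qed.

(* Interpolates between the costs of rate 1 on G (Z empty) and the costs of rate rho
   on the complete graph (Z full). *)
Definition mixw Z G c : weight := cap K (fun e => if e \in Z then c e / rho else gw K G c e).

Definition mixcost Z c : R := EG p (fun G => mcost [set: 'I_n]%SET (mixw Z G c)).

Lemma mixw_ge0 Z G c : (forall e, 0 <= c e) -> forall e, 0 <= mixw Z G c e.
Proof.
move=> c0 e; rewrite /mixw /cap /gw le_min K0 andbT.
by case: ifP => _; [rewrite divr_ge0// ltW|case: ifP].
Qed.

Lemma mfun_mixcost Z : mfun (mixcost Z).
Proof.
apply: mfun_sum => G; apply: mfunM; first exact: measurable_cst.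
apply: mfun_minc_comp => e; rewrite /mixw /cap /gw.
apply: measurable_minr => //; case: (e \in Z).
  by apply: measurable_funM => //; exact: mfun_coord.
by case: (e \in G); [exact: mfun_coord|exact: measurable_cst].
Qed.

Lemma mixcost_ge0 Z c : (forall e, 0 <= c e) -> 0 <= mixcost Z c.
Proof.
by move=> c0; apply: EG_ge0 => // G; apply: mcost_ge0; exact: mixw_ge0.
Qed.

(** A missing edge costs [K], which is at least the slack, so its absence adds the full slack. *)
Lemma mixcost_upd_notin Z e c x : e \notin Z -> 0 <= x -> mixcost Z (upd c e x) =
  EG p (fun G => base e (mixw Z G c) + (1 - p) * slack e (mixw Z G c)
    + p * Order.min x (slack e (mixw Z G c))).
Proof.
move=> eZ x0; rewrite /mixcost (EG_edge p e); apply: eq_bigr => G _; congr (_ * _).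
have -> : mixw Z (e |: G) (upd c e x) = upd (mixw Z G c) e (Order.min x K).
  apply/funext => e'; rewrite /mixw /cap /gw /upd !inE.
  by have [->|] := eqVneq e' e; rewrite ?(negbTE eZ)//=; case: ifP.
have -> : mixw Z (G :\ e) (upd c e x) = upd (mixw Z G c) e (Order.min K K).
  apply/funext => e'; rewrite /mixw /cap /gw /upd !inE.
  by have [->|] := eqVneq e' e; rewrite ?(negbTE eZ)//=; case: ifP.
rewrite !mcost_cap_upd//.
have /andP[_ /min_idPr ->] := slack_bound e (mixw Z G c).
ring.
Qed.

Lemma mixcost_upd_in Z e c x : e \notin Z -> 0 <= x -> mixcost (e |: Z) (upd c e x) =
  EG p (fun G => base e (mixw Z G c) + Order.min (x / rho) (slack e (mixw Z G c))).
Proof.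
move=> eZ x0; apply: eq_bigr => G _; congr (_ * _).
rewrite -mcost_cap_upd ?divr_ge0 ?(ltW rho0)//; congr mcost.
apply/funext => e'; rewrite /mixw /cap /gw /upd !inE.
by have [->|] := eqVneq e' e.
Qed.

Lemma integral_EG (g : bigraph n -> R -> R) :
  (forall G, measurable_fun [set: measurableTypeR R] (fun x : R => g G x)) ->
  (forall G x, 0 <= g G x) ->
  (\int[P]_x (EG p (g^~ x))%:E = \sum_G (wG p G)%:E * \int[P]_x (g G x)%:E)%E.
Proof.
move=> mg g0.
under eq_integral do rewrite /EG -sumEFin.
rewrite ge0_integral_sum//.
- apply: eq_bigr => G _; under eq_integral do rewrite EFinM.
  rewrite ge0_integralZl//; first exact/measurable_EFinP.
    by move=> x _; rewrite lee_fin.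
  by rewrite lee_fin wG_ge0.
- by move=> G; apply/measurable_EFinP; apply: measurable_funM.
- by move=> G x _; rewrite lee_fin mulr_ge0// wG_ge0.
Qed.

(* The mean of min (b, cost of e), e being an edge of G with probability p. *)
Definition edge_mean b : R := p * (1 - expR (- b)) + (1 - p) * b.

Lemma integral_mixcost_notin Z e c : (forall e, 0 <= c e) -> e \notin Z ->
  (\int[P]_x (mixcost Z (upd c e `|x|))%:E =
   \sum_G (wG p G)%:E * (base e (mixw Z G c) + edge_mean (slack e (mixw Z G c)))%:E)%E.
Proof.
move=> c0 eZ; have /andP[p0 p1] := p01.
pose g G (x : R) := base e (mixw Z G c) + (1 - p) * slack e (mixw Z G c)
    + p * Order.min (`|x| / 1) (slack e (mixw Z G c)).
have q0 G : 0 <= base e (mixw Z G c) + (1 - p) * slack e (mixw Z G c).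
  have /andP[s0 _] := slack_bound e (mixw Z G c).
  by rewrite addr_ge0 ?base_ge0 ?mulr_ge0 ?subr_ge0//; exact: mixw_ge0.
under eq_integral => x _.
  rewrite mixcost_upd_notin//.
  rewrite (_ : EG p _ = EG p (g^~ x)); last first.
    by apply: eq_bigr => G _; rewrite /g divr1.
  over.
rewrite integral_EG; first last.
- move=> G x; have /andP[s0 _] := slack_bound e (mixw Z G c).
  by rewrite /g addr_ge0// mulr_ge0// le_min s0 divr1 normr_ge0.
- move=> G; apply: measurable_funD => //; apply: measurable_funM => //.
  exact: measurable_min_norm.
apply: eq_bigr => G _; have /andP[s0 _] := slack_bound e (mixw Z G c).
rewrite integral_affine_min//; congr (_ * _%:E)%E; rewrite /edge_mean mul1r; by field.
Qed.

Lemma integral_mixcost_in Z e c : (forall e, 0 <= c e) -> e \notin Z ->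
  (\int[P]_x (mixcost (e |: Z) (upd c e `|x|))%:E =
   \sum_G (wG p G)%:E * (base e (mixw Z G c) +
     (1 - expR (- (rho * slack e (mixw Z G c)))) / rho)%:E)%E.
Proof.
move=> c0 eZ.
pose g G (x : R) := base e (mixw Z G c) + 1 * Order.min (`|x| / rho) (slack e (mixw Z G c)).
have q0 G : 0 <= base e (mixw Z G c) by apply: base_ge0; exact: mixw_ge0.
under eq_integral => x _.
  rewrite mixcost_upd_in//.
  rewrite (_ : EG p _ = EG p (g^~ x)); last first.
    by apply: eq_bigr => G _; rewrite /g mul1r.
  over.
rewrite integral_EG; first last.
- move=> G x; have /andP[s0 _] := slack_bound e (mixw Z G c).
  by rewrite /g addr_ge0// mul1r le_min s0 andbT divr_ge0// ltW.
- move=> G; apply: measurable_funD => //; apply: measurable_funM => //.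
  exact: measurable_min_norm.
apply: eq_bigr => G _; have /andP[s0 _] := slack_bound e (mixw Z G c).
by rewrite integral_affine_min// mul1r.
Qed.

(** [Q] stands for either direction of the inequality, so that one induction over the pairs serves
    both bounds. *)
Lemma mixcost_ind (Q : \bar R -> \bar R -> Prop) :
  (forall x, Q x x) -> (forall y x z : \bar R, Q x y -> Q y z -> Q x z) ->
  (forall Z e, e \notin Z -> Q (E (mixcost Z)) (E (mixcost (e |: Z)))) ->
  Q (E (mixcost finset.set0)) (E (mixcost [set: pair]%SET)).
Proof.
move=> Qxx Qt Qs; suff h Z : Q (E (mixcost finset.set0)) (E (mixcost Z)) by exact: h.
elim: {Z}#|Z| {-2}Z (erefl #|Z|) => [|k IH] Z Zk; first by rewrite (cards0_eq Zk).
have [e eZ] : exists e, e \in Z by apply/set0Pn; rewrite -card_gt0 Zk.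
apply: (Qt (E (mixcost (Z :\ e)))).
  by apply: IH; apply/eqP; rewrite -eqSS -Zk (cardsD1 e Z) eZ.
by have := Qs (Z :\ e) e; rewrite finset.setD1K//; apply; rewrite !inE eqxx.
Qed.

(** The slack never exceeds the cap, so the scalar inequality is only required for [b <= K]. A small
    cap thus makes both laws comparable to second order. *)
Lemma comparison_upper :
  (forall b, 0 <= b <= K -> edge_mean b <= (1 - expR (- (rho * b))) / rho) ->
  (E (mixcost finset.set0) <= E (mixcost [set: pair]%SET))%E.
Proof.
move=> h; refine (@mixcost_ind (fun u v => (u <= v)%E) _ _ _) => [u|v u z|Z e eZ].
- exact: lexx.
- exact: le_trans.
apply: (E_le_coord (e := e)) => [||t|t|t]; try exact: mfun_mixcost.
- by apply: mixcost_ge0; exact: wt_ge0.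
- by apply: mixcost_ge0; exact: wt_ge0.
have w0 := @wt_ge0 R n t.
rewrite (integral_mixcost_notin w0 eZ) (integral_mixcost_in w0 eZ); apply: lee_sum => G _.
rewrite lee_wpmul2l ?lee_fin ?wG_ge0// lerD2l; apply: h; exact: slack_bound.
Qed.

Lemma comparison_lower :
  (forall b, 0 <= b <= K -> (1 - expR (- (rho * b))) / rho <= edge_mean b) ->
  (E (mixcost [set: pair]%SET) <= E (mixcost finset.set0))%E.
Proof.
move=> h; refine (@mixcost_ind (fun u v => (v <= u)%E) _ _ _) => [u|v u z h1 h2|Z e eZ].
- exact: lexx.
- exact: le_trans h1.
apply: (E_le_coord (e := e)) => [||t|t|t]; try exact: mfun_mixcost.
- by apply: mixcost_ge0; exact: wt_ge0.
- by apply: mixcost_ge0; exact: wt_ge0.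
have w0 := @wt_ge0 R n t.
rewrite (integral_mixcost_notin w0 eZ) (integral_mixcost_in w0 eZ); apply: lee_sum => G _.
rewrite lee_wpmul2l ?lee_fin ?wG_ge0// lerD2l; apply: h; exact: slack_bound.
Qed.

End comparison.

(** * Scalar inequalities between truncated means *)

Section exponential_inequalities.
Context {R : realType}.

Lemma mvt_ge0 (f df : R -> R) (b : R) : 0 <= b ->
  (forall x : R, is_derive x 1 f (df x)) -> (forall x, 0 <= x <= b -> 0 <= df x) ->
  f 0 <= f b.
Proof.
move=> b0 fd d0; have := @mvt_le R (fun x => - f x) (fun x => - df x) 0 b 0 b0.
rewrite mul0r opprK addrC subr_le0; apply=> x xb.
by rewrite oppr_le0 d0.
Qed.

Lemma is_derive_expN (k x : R) : is_derive x 1 (fun y => expR (- (k * y))) (- k * expR (- (k * x))).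
Proof.
have -> : (fun y => expR (- (k * y))) = expR \o (fun y : R => - k * y).
  by apply/funext => y /=; rewrite mulNr.
apply: is_derive_eq.
by rewrite /= scaler1 -mulNr; ring.
Qed.

Lemma expRN_le2 (y : R) : 0 <= y -> expR (- y) <= 1 - y + y ^+ 2 / 2.
Proof.
move=> y0; pose f (y : R) := 1 - y + y ^+ 2 / 2 - expR (- (1 * y)).
have : f 0 <= f y.
  apply: (@mvt_ge0 f (fun y => - 1 + y + expR (- (1 * y)))) => // [x|x _].
    have h := is_derive_expN 1 x; apply: is_derive_eq.
    by rewrite /= ?scaler0 ?scaler1 /GRing.scale/=; field.
  by rewrite mul1r; have := expR_ge1Dx (- x); lra.
rewrite /f mulr0 oppr0 expR0 mul1r expr0n/=.
by move: (expR (- y)) => e; lra.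
Qed.

Lemma expRN_ge3 (y : R) : 0 <= y -> 1 - y + y ^+ 2 / 2 - y ^+ 3 / 6 <= expR (- y).
Proof.
move=> y0; pose f (y : R) := expR (- (1 * y)) - (1 - y + y ^+ 2 / 2 - y ^+ 3 / 6).
have : f 0 <= f y.
  apply: (@mvt_ge0 f (fun y => - expR (- (1 * y)) + (1 - y + y ^+ 2 / 2))) => // [x|x /andP[x0 _]].
    have h := is_derive_expN 1 x; apply: is_derive_eq.
    by rewrite /= ?scaler0 ?scaler1 /GRing.scale/=; field.
  by rewrite mul1r; have := expRN_le2 x0; lra.
rewrite /f mulr0 oppr0 expR0 mul1r !expr0n/=.
by move: (expR (- y)) => e; lra.
Qed.

Lemma expRN_convex (p y : R) : 0 <= p <= 1 -> 0 <= y ->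
  expR (- (p * y)) <= 1 - p + p * expR (- y).
Proof.
move=> /andP[p0 p1] y0; pose f (y : R) := 1 - p + p * expR (- (1 * y)) - expR (- (p * y)).
have : f 0 <= f y.
  apply: (@mvt_ge0 f (fun y => - p * expR (- (1 * y)) + p * expR (- (p * y)))) => // [x|x /andP[x0 _]].
    have h := is_derive_expN 1 x; have h' := is_derive_expN p x; apply: is_derive_eq.
    by rewrite /= ?scaler0 ?scaler1 /GRing.scale/=; ring.
  rewrite mul1r mulNr addrC subr_ge0 ler_wpM2l// ler_expR lerN2 ler_piMl//.
rewrite /f !mulr0 oppr0 expR0 mul1r.
by move: (expR (- y)) (expR _) => e e'; lra.
Qed.

(** By Taylor bounds the left side is at most [b - p b^2 / 2 + p b^3 / 6], and the right side at
    least [b - p (1 - k) b^2 / 2]. Lowering the rate by the factor [1 - k] absorbs the cubic term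
    because [b <= k]. *)
Lemma edge_mean_le (p k b : R) : 0 < p -> 0 <= k -> k <= 1 / 2 -> 0 <= b <= k ->
  edge_mean p b <= (1 - expR (- (p * (1 - k) * b))) / (p * (1 - k)).
Proof.
move=> p0 k0 k1 /andP[b0 bk].
have r0 : 0 < p * (1 - k) by rewrite mulr_gt0//; lra.
have rb0 : 0 <= p * (1 - k) * b by rewrite mulr_ge0// ltW.
rewrite ler_pdivlMr//.
have h1 : edge_mean p b <= b - p * (1 - k) * (b ^+ 2 / 2).
  rewrite /edge_mean; have := expRN_ge3 b0; move: (expR _) => e he.
  have : p * (1 - b + b ^+ 2 / 2 - b ^+ 3 / 6) <= p * e by rewrite ler_wpM2l// ltW.
  have : 0 <= p * b ^+ 2 * (k / 2 - b / 6).
    by rewrite !mulr_ge0 ?sqr_ge0 ?(ltW p0)//; lra.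
  lra.
apply: (le_trans (ler_wpM2r (ltW r0) h1)).
have := expRN_le2 rb0; move: (expR _) => e he; lra.
Qed.

(** Both sides vanish at 0, and the derivative of the difference is nonnegative by convexity of the
    exponential. *)
Lemma edge_mean_ge (p b : R) : 0 < p -> p <= 1 -> 0 <= b ->
  (1 - expR (- (p * b))) / p <= edge_mean p b.
Proof.
move=> p0 p1 b0; have p01 : 0 <= p <= 1 by rewrite (ltW p0).
pose f (b : R) := p * (1 - expR (- (1 * b))) + (1 - p) * b - (1 - expR (- (p * b))) / p.
have : f 0 <= f b.
  apply: (@mvt_ge0 f (fun b => 1 - p + p * expR (- b) - expR (- (p * b)))) => // [x|x /andP[x0 _]].
    have h := is_derive_expN 1 x; have h' := is_derive_expN p x; apply: is_derive_eq.
    by rewrite /= ?scaler0 ?scaler1 /GRing.scale/= mul1r; field; rewrite gt_eqF.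
  by rewrite subr_ge0; exact: expRN_convex.
rewrite /f !mulr0 oppr0 expR0 mul1r /edge_mean subrr mulr0 mul0r addr0 subr0.
by rewrite subr_ge0.
Qed.

End exponential_inequalities.

(** * The cost on the complete graph, scaled and capped *)

Section complete_graph.
Context {R : realType} {n : nat}.
Hypothesis n2 : (1 < n)%N.
Local Notation pair := ('I_n * 'I_n)%type.
Local Notation weight := (pair -> R).
Local Notation P := (exponential1 R).
Implicit Types S : {set 'I_n}.

Lemma E_mcost_complete : E (fun w : weight => mcost [set: 'I_n]%SET w) = (zeta2 n)%:E.
Proof.
rewrite ecostE (ecost_card n2) cardsT card_ord /harmonic_tail.
by rewrite sum_harmonic_tail.
Qed.

Lemma mcost_scale (a : R) (w : weight) S : 0 <= a -> mcost S (fun e => w e * a) = mcost S w * a.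
Proof.
have cS f : cost S f (fun e => w e * a) = cost S f w * a by rewrite /cost mulr_suml.
move=> a0; apply/eqP; rewrite eq_le; apply/andP; split.
  by have [f fS ->] := mcost_ex S w; rewrite -cS mcost_le.
have [f fS ->] := mcost_ex S (fun e => w e * a).
by rewrite cS ler_wpM2r// mcost_le.
Qed.

Lemma mcost_mono (w w' : weight) S : (forall e, w e <= w' e) -> mcost S w <= mcost S w'.
Proof.
move=> h; have [f fS ->] := mcost_ex S w'; apply: (le_trans (mcost_le w fS)).
exact: ler_sum.
Qed.

Lemma sum_graph_le (h : weight) S (f : 'I_n -> 'I_n) : (forall e, 0 <= h e) ->
  \sum_(i in S) h (i, f i) <= \sum_e h e.
Proof.
move=> h0; have -> : \sum_e h e = \sum_i \sum_j h (i, j).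
  by rewrite pair_bigA/=; apply: eq_bigr => -[].
rewrite [leRHS](bigID (fun i => i \in S))/=.
apply: ler_wpDr; first by apply: sumr_ge0 => i _; apply: sumr_ge0.
by apply: ler_sum => i _; rewrite (bigD1 (f i))//= lerDl sumr_ge0.
Qed.

(** Keep the matching that is optimal for the capped costs and pay the excesses of its edges,
    crudely bounded by those of all pairs. *)
Lemma mcost_cap_excess (k : R) (w : weight) S :
  mcost S w <= mcost S (cap k w) + \sum_e Order.max 0 (w e - k).
Proof.
have [f fS ->] := mcost_ex S (cap k w); apply: (le_trans (mcost_le w fS)).
apply: (@le_trans _ _ (\sum_(i in S) (cap k w (i, f i) + Order.max 0 (w (i, f i) - k)))).
  apply: ler_sum => i _; rewrite /cap /Order.min /Order.max.
  by do 2 case: ltP => ?; lra.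
rewrite big_split/= lerD2l.
by apply: (@sum_graph_le (fun e => Order.max 0 (w e - k))) => e; rewrite le_max lexx.
Qed.

Lemma mfun_max0 (k a : R) e : mfun (fun c : weight => Order.max 0 (c e / a - k)).
Proof.
apply: measurable_maxr => //; apply: measurable_funB => //.
by apply: measurable_funM => //; exact: mfun_coord.
Qed.

Lemma E_excess (a k : R) e : 0 < a -> 0 <= k ->
  E (fun c : weight => Order.max 0 (c e / a - k)) = (expR (- (a * k)) / a)%:E.
Proof.
move=> a0 k0; rewrite (E_resample e (@mfun_max0 k a e)); last by move=> t; rewrite le_max lexx.
transitivity (E (fun _ : weight => expR (- (a * k)) / a)); last exact: Ecst.
apply: eq_integral => t _.
have ak0 : 0 <= a * k by rewrite mulr_ge0// ltW.
rewrite mulrC EFinM -integral_excess// -ge0_integralZl//.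
- apply: eq_integral => x _; rewrite -EFinM /upd eqxx; congr EFin.
  rewrite maxr_pMr ?invr_ge0 ?(ltW a0)// mulr0; congr Order.max.
  by field; rewrite gt_eqF.
- by apply/measurable_EFinP; exact: measurable_excess.
- by move=> x _; rewrite lee_fin le_max lexx.
- by rewrite lee_fin invr_ge0 ltW.
Qed.

Lemma mfun_mcost_comp (F : weight -> weight) S :
  (forall e, mfun (F^~ e)) -> mfun (fun w => mcost S (F w)).
Proof. exact: mfun_minc_comp. Qed.

Lemma E_mcost_scale (a : R) : 0 < a ->
  E (fun c : weight => mcost [set: 'I_n]%SET (fun e => c e / a)) = (zeta2 n / a)%:E.
Proof.
move=> a0; have ia0 : 0 <= a^-1 by rewrite invr_ge0 ltW.
rewrite mulrC EFinM -E_mcost_complete -EZ//.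
- by congr E; apply/funext => w; rewrite mcost_scale// mulrC.
- exact: mfun_minc.
- by move=> t; apply: mcost_ge0; exact: wt_ge0.
Qed.

Lemma mixcost_setT (p K rho : R) (c : weight) : 0 <= p <= 1 ->
  mixcost p K rho [set: pair]%SET c = mcost [set: 'I_n]%SET (cap K (fun e => c e / rho)).
Proof.
move=> p01; rewrite /mixcost -[RHS](EG_cst (n := n) p).
apply: eq_bigr => G _; congr (_ * mcost _ _).
by apply/funext => e; rewrite /mixw /cap inE.
Qed.

Lemma measurable_scaled (a : R) e : mfun (fun c : weight => c e / a).
Proof. by apply: measurable_funM => //; exact: mfun_coord. Qed.

Lemma E_mixcost_setT_le (p K rho : R) : 0 <= p <= 1 -> 0 <= K -> 0 < rho ->
  (E (fun c : weight => mixcost p K rho [set: pair]%SET c) <= (zeta2 n / rho)%:E)%E.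
Proof.
move=> p01 K0 rho0; rewrite -E_mcost_scale//; apply: E_le => [||t|t].
- exact: mfun_mixcost.
- by apply: mfun_mcost_comp => e; exact: measurable_scaled.
- by apply: mixcost_ge0 => //; exact: wt_ge0.
rewrite mixcost_setT//; apply: mcost_mono => e.
by rewrite /cap ge_min lexx.
Qed.

Lemma E_mixcost_setT_ge (p K rho : R) : 0 <= p <= 1 -> 0 <= K -> 0 < rho ->
  ((zeta2 n / rho - (n * n)%:R * (expR (- (rho * K)) / rho))%:E <=
   E (fun c : weight => mixcost p K rho [set: pair]%SET c))%E.
Proof.
move=> p01 K0 rho0; rewrite EFinB leeBlDr// -E_mcost_scale//.
have -> : ((n * n)%:R * (expR (- (rho * K)) / rho))%:E =
    E (fun c : weight => \sum_e Order.max 0 (c e / rho - K)).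
  rewrite E_sum => [|e|e t]; [|exact: mfun_max0|by rewrite le_max lexx].
  under eq_bigr do rewrite E_excess//.
  by rewrite sumEFin sumr_const cardT/= -cardT card_prod card_ord mulr_natl.
rewrite -ED => [|||t|t].
- apply: E_le => [||t|t].
  + by apply: mfun_mcost_comp => e; exact: measurable_scaled.
  + by apply: mfunD; [exact: mfun_mixcost|apply: mfun_sum => e; exact: mfun_max0].
  + by apply: mcost_ge0 => e; rewrite divr_ge0 ?wt_ge0// ltW.
  + rewrite mixcost_setT//; exact: mcost_cap_excess.
- exact: mfun_mixcost.
- by apply: mfun_sum => e; exact: mfun_max0.
- by apply: mixcost_ge0 => //; exact: wt_ge0.
- by apply: sumr_ge0 => e _; rewrite le_max lexx.
Qed.

Lemma E_mixcost_le (p K : R) : 0 < p -> p <= 1 -> 0 <= K -> K <= 1 / 2 ->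
  (E (fun c : weight => mixcost p K 1 finset.set0 c) <= (zeta2 n / (p * (1 - K)))%:E)%E.
Proof.
move=> p0 p1 K0 K1; have r0 : 0 < p * (1 - K) by rewrite mulr_gt0//; lra.
have p01 : 0 <= p <= 1 by rewrite (ltW p0).
apply: le_trans (E_mixcost_setT_le p01 K0 r0).
(* With [Z] empty no pair has the scaled cost, so the rate may be changed freely. *)
rewrite (_ : mixcost p K 1 finset.set0 = mixcost p K (p * (1 - K)) finset.set0).
  by apply: comparison_upper => // b bK; exact: edge_mean_le.
apply/funext => c; apply: eq_bigr => G _; congr (_ * mcost _ _).
by apply/funext => e; rewrite /mixw /cap inE.
Qed.

Lemma E_mixcost_ge (p K : R) : 0 < p -> p <= 1 -> 0 <= K ->
  ((zeta2 n / p - (n * n)%:R * (expR (- (p * K)) / p))%:E <=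
   E (fun c : weight => mixcost p K 1 finset.set0 c))%E.
Proof.
move=> p0 p1 K0; have p01 : 0 <= p <= 1 by rewrite (ltW p0).
apply: (le_trans (E_mixcost_setT_ge p01 K0 p0)).
rewrite (_ : mixcost p K 1 finset.set0 = mixcost p K p finset.set0).
  by apply: comparison_lower => // b /andP[b0 _]; exact: edge_mean_ge.
apply/funext => c; apply: eq_bigr => G _; congr (_ * mcost _ _).
by apply/funext => e; rewrite /mixw /cap inE.
Qed.

End complete_graph.

(** * The cost of a fixed graph *)

Section perfect_matchings.
Context {R : realType} {n : nat}.
Local Notation pair := ('I_n * 'I_n)%type.
Local Notation weight := (pair -> R).
Implicit Types (G M : bigraph n) (c w : weight) (f : {ffun 'I_n -> 'I_n}).

Definition graph_of f : bigraph n := [set (i, f i) | i : 'I_n]%SET.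

Lemma sum_graph_of f w : \sum_(e in graph_of f) w e = cost [set: 'I_n]%SET f w.
Proof.
rewrite /graph_of big_imset/=; last by move=> i j _ _ [].
by apply: eq_bigl => i; rewrite !inE.
Qed.

Lemma perfect_graph_of G f : inj_on [set: 'I_n]%SET f -> (forall i, (i, f i) \in G) ->
  perfect_matching G (graph_of f).
Proof.
move=> fT fG; have finj : injective f by move=> x y; move/inj_onP : fT; apply; rewrite inE.
apply/and3P; split.
- by apply/fintype.subsetP => _ /imsetP[i _ ->].
- apply/forallP => i; rewrite (_ : [set e in _ | _]%SET = [set (i, f i)]%SET) ?cards1//.
  apply/finset.setP => -[j k]; rewrite !inE/=; apply/andP/eqP => [[/imsetP[l _ [-> ->]] /eqP ->]//|[-> ->]].
  by split => //; apply/imsetP; exists i.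
- apply/forallP => j; pose g := invF finj.
  rewrite (_ : [set e in _ | _]%SET = [set (g j, j)]%SET) ?cards1//.
  apply/finset.setP => -[k l]; rewrite !inE/=; apply/andP/eqP => [[/imsetP[m _ [-> ->]] /eqP <-]|[-> ->]].
    by rewrite /g invF_f.
  by split => //; apply/imsetP; exists (g j) => //; rewrite /g f_invF.
Qed.

Lemma perfect_matching_graph G M : perfect_matching G M ->
  exists2 f, inj_on [set: 'I_n]%SET f & M = graph_of f.
Proof.
move=> /and3P[_ /forallP h1 /forallP h2].
have ex i : {j | [set e in M | e.1 == i]%SET = [set (i, j)]%SET}.
  apply: cid; have /cards1P[[i' j] e] := h1 i; exists j.
  have : (i', j) \in [set e in M | e.1 == i]%SET by rewrite e inE.
  by rewrite inE/= => /andP[_ /eqP ii]; rewrite e ii.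
pose f : {ffun 'I_n -> 'I_n} := [ffun i => sval (ex i)].
have fE i j : ((i, j) \in M) = (j == f i).
  rewrite ffunE; have := svalP (ex i); move: (sval _) => k e.
  have : ((i, j) \in [set e in M | e.1 == i]%SET) = ((i, j) == (i, k)) by rewrite e inE.
  by rewrite inE eqxx andbT => ->; rewrite xpair_eqE eqxx.
exists f.
  apply/inj_onP => i j _ _ e; have /cards1P[x xE] := h2 (f i).
  have h k : f k = f i -> (k, f i) = x.
    move=> ki; apply/eqP; have : (k, f i) \in [set e in M | e.2 == f i]%SET.
      by rewrite inE/= eqxx andbT fE ki.
    by rewrite xE inE.
  by have := h i erefl; rewrite -(h j (esym e)) => -[].
apply/finset.setP => -[i j]; rewrite fE; apply/eqP/imsetP => [->|[k _ [-> ->]]//].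
by exists i.
Qed.

Lemma min_matching_cost_le G M w : perfect_matching G M ->
  (min_matching_cost G w <= (\sum_(e in M) w e)%:E)%E.
Proof. by move=> GM; rewrite /min_matching_cost (bigD1 M)//= ge_min lexx. Qed.

Lemma min_matching_cost_ge G w (x : \bar R) :
  (forall M, perfect_matching G M -> x <= (\sum_(e in M) w e)%:E)%E ->
  (x <= min_matching_cost G w)%E.
Proof.
move=> h; rewrite /min_matching_cost; elim/big_ind : _ => [|y z xy xz|M GM].
- exact: leey.
- by rewrite le_min xy.
- exact: h.
Qed.

Lemma capped_le_min_matching_cost (K : R) G c :
  ((mcost [set: 'I_n]%SET (cap K (gw K G c)))%:E <= min_matching_cost G c)%E.
Proof.
apply: min_matching_cost_ge => M GM; have [f fT ME] := perfect_matching_graph GM.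
rewrite lee_fin ME sum_graph_of; apply: (le_trans (mcost_le _ fT)).
apply: ler_sum => i _; have iG : (i, f i) \in G.
  by case/and3P: GM => /fintype.subsetP MG _ _; apply: MG; rewrite ME; apply/imsetP; exists i.
by rewrite /cap /gw iG ge_min lexx.
Qed.

Definition light (theta : R) G c : bigraph n := [set e in G | c e < theta]%SET.

(** All edges of a capped optimum cost less than [kappa], so they are edges of [G] that the cap does
    not touch, and the optimum is a perfect matching of [G]. *)
Lemma min_matching_cost_expander (theta kappa : R) t G c :
  (0 < t)%N -> (n./2 < 2 ^ t)%N -> 0 <= theta -> theta * t.*2%:R < kappa ->
  (forall e, 0 <= c e) -> expander (light theta G c) ->
  (exists M, perfect_matching G M) /\
  min_matching_cost G c = (mcost [set: 'I_n]%SET (cap kappa (gw kappa G c)))%:E.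
Proof.
move=> t0 nt th0 thk c0 exL; set y := cap _ _.
have k0 : 0 <= kappa by apply: le_trans (ltW thk); rewrite mulr_ge0.
have y0 e : 0 <= y e by rewrite /y /cap /gw le_min k0 andbT; case: ifP.
have [f fT fE] := mcost_ex [set: 'I_n]%SET y.
have below i : y (i, f i) < kappa.
  apply: (optimal_below_cap t0 nt exL y0 _ th0 thk fT fE) => e.
  rewrite inE => /andP[eG ct]; rewrite /y /cap /gw eG.
  by apply: le_trans (ltW ct); rewrite ge_min lexx.
(* A missing edge costs exactly [kappa], which the strict bound excludes. *)
have fG i : (i, f i) \in G.
  by have := below i; rewrite /y /cap /gw; case: ifP => // _; rewrite minxx ltxx.
have GM := perfect_graph_of fT fG.
split; first by exists (graph_of f).
apply/eqP; rewrite eq_le capped_le_min_matching_cost andbT.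
apply: (le_trans (min_matching_cost_le c GM)); rewrite lee_fin sum_graph_of fE.
apply: ler_sum => i _; have := below i; rewrite /y /cap /gw fG gt_min ltxx orbF => ck.
by rewrite le_min lexx ltW.
Qed.

Lemma min_matching_cost_le_sum G c : (forall e, 0 <= c e) ->
  (exists M, perfect_matching G M) -> (min_matching_cost G c <= (\sum_e c e)%:E)%E.
Proof.
move=> c0 [M GM]; apply: (le_trans (min_matching_cost_le c GM)); rewrite lee_fin.
by rewrite [leRHS](bigID (mem M))/= lerDl sumr_ge0.
Qed.

End perfect_matchings.

(** * The probability that the light edges fail to expand *)

Section expander_probability.
Context {R : realType} {n : nat}.
Local Notation pair := ('I_n * 'I_n)%type.
Local Notation weight := (pair -> R).
Local Notation P := (exponential1 R).
Implicit Types (G L : bigraph n) (c : weight) (X Y : {set 'I_n}).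

Lemma sum_pow_card (a : R) : \sum_(X : {set 'I_n}) a ^+ #|X| = (1 + a) ^+ n.
Proof.
rewrite addrC -[in RHS](card_ord n) -prodr_const bigA_distr/=.
apply: eq_big => [X|X _]; first by rewrite inE.
by rewrite -big_mkcond/= prodr_const.
Qed.

Definition bad_pair X Y : bool := (X != finset.set0) && (n < growth (n := n) #|X| + #|Y|)%N.

Lemma not_expander_le L : (~~ expander L)%:R <=
  \sum_(X : {set 'I_n}) \sum_(Y : {set 'I_n} | bad_pair X Y)
    ((hole L X Y)%:R + (hole L Y X)%:R) :> R.
Proof.
have s0 X Y : 0 <= (hole L X Y)%:R + (hole L Y X)%:R :> R by rewrite addr_ge0.
have [exL|] := boolP (expander L); first by do 2 (apply: sumr_ge0 => ? _).
rewrite negb_forall => /existsP[X]; rewrite negb_forall => /existsP[Y].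
rewrite negb_imply => /andP[hXY]; rewrite negb_and !negb_imply -!ltnNge => /orP[] bXY.
  rewrite (bigD1 X)//= (bigD1 Y)//= hXY -!addrA lerDl !addr_ge0//.
    by do ! (apply: sumr_ge0 => ? _).
  by do ! (apply: sumr_ge0 => ? _).
rewrite (bigD1 Y)//= (bigD1 X)//= hXY [_ + 1]addrC -!addrA lerDl !addr_ge0//.
  by do ! (apply: sumr_ge0 => ? _).
by do ! (apply: sumr_ge0 => ? _).
Qed.

Lemma mfun_lt_theta (theta : R) e : mfun (fun c : weight => c e < theta).
Proof. by apply: mfun_lt; [exact: mfun_coord|exact: measurable_cst]. Qed.

Lemma mfun_expander (theta : R) G : mfun (fun c : weight => expander (light theta G c)).
Proof.
apply: measurable_forall => X; apply: measurable_forall => Y.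
set b := _ && _; rewrite (_ : (fun t => _) = fun t => ~~ b ==> ~~ hole (light theta G (wt t)) X Y).
  apply: measurable_implyb; apply: measurable_neg.
  apply: measurable_forall => x; apply: measurable_implyb.
  apply: measurable_forall => y; apply: measurable_implyb.
  apply: measurable_neg.
  under eq_fun do rewrite inE.
  by apply: measurable_and; [exact: measurable_cst|exact: mfun_lt_theta].
by apply/funext => t; rewrite implybNN.
Qed.

(** Independence of the costs in product form, by redrawing the coordinates of [Z] one after the
    other. *)
Lemma E_prod (h : R -> R) (Z : {set pair}) (m : R) : (forall x, 0 <= h x) ->
  measurable_fun [set: measurableTypeR R] h -> (\int[P]_x (h `|x|)%:E = m%:E)%E ->
  E (fun c : weight => \prod_(e in Z) h (c e)) = (m ^+ #|Z|)%:E.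
Proof.
move=> h0 mh hm.
have mhc e : mfun (fun c : weight => h (c e)).
  exact: (measurableT_comp mh (@mfun_coord R n e)).
have mprod (A : {set pair}) : mfun (fun c : weight => \prod_(e in A) h (c e)).
  rewrite /mfun; under eq_fun do rewrite -big_enum.
  elim: (enum A) => [|e s IH]; first by under eq_fun do rewrite big_nil; exact: measurable_cst.
  by under eq_fun do rewrite big_cons; apply: measurable_funM => //; exact: mhc.
elim: {Z}#|Z| {-2}Z (erefl #|Z|) => [|k IH] Z Zk.
  rewrite (cards0_eq Zk) cards0 expr0 -(@Ecst R n 1); congr E; apply/funext => c.
  by rewrite big_set0.
have [e eZ] : exists e, e \in Z by apply/set0Pn; rewrite -card_gt0 Zk.
rewrite (E_resample e) => [||t]; [|exact: mprod|exact: prodr_ge0].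
have Z'k : #|Z :\ e| = k by apply/eqP; rewrite -eqSS -Zk (cardsD1 e Z) eZ.
rewrite Zk exprS EFinM -[in X in _ ^+ X]Z'k -(IH _ Z'k) /E.
rewrite -ge0_integralZl//; last 3 first.
- by apply/measurable_EFinP; exact: mprod.
- by move=> t _; rewrite lee_fin; exact: prodr_ge0.
- by rewrite -hm; apply: integral_ge0 => x _; rewrite lee_fin.
apply: eq_integral => t _; rewrite -hm -ge0_integralZr//; last 3 first.
- apply/measurable_EFinP; apply: (measurableT_comp mh); exact: normr_measurable.
- by move=> x _; rewrite lee_fin.
- by rewrite lee_fin; exact: prodr_ge0.
apply: eq_integral => x _; rewrite (big_setD1 e)//= /upd eqxx EFinM; congr (_ * _%:E)%E.
by apply: eq_bigr => e'; rewrite !inE => /andP[/negbTE ->].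
Qed.

Variables (p theta : R).
Hypotheses (p01 : 0 <= p <= 1) (theta0 : 0 <= theta).

(** The probability that a given pair is a light edge. *)
Let q := p * (1 - expR (- theta)).

Lemma integral_not_light :
  (\int[P]_x (1 - p * (`|x| < theta)%R%:R)%:E = (1 - q)%:E)%E.
Proof.
have /andP[p0 p1] := p01.
have mb : measurable_fun [set: measurableTypeR R] (fun x : R => `|x| < theta).
  by apply: measurable_fun_ltr => //; exact: normr_measurable.
have B : (\int[P]_x ((`|x| < theta)%R%:R)%:E = (1 - expR (- theta))%:E)%E.
  have := @integral_coordinate R true 0 theta (fun x => x < theta) (lexx 0).
  move=> <-//; last 2 first.
  - by move=> x _ /and3P[].
  - by move=> x x0 ->; rewrite x0.
  under eq_integral do rewrite mul1r.
  by rewrite (@integral_clamp R 0)// oppr0 expR0.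
have : (\int[P]_x (1 - p * (`|x| < theta)%R%:R)%:E + \int[P]_x (p * (`|x| < theta)%R%:R)%:E = 1%:E)%E.
  rewrite -ge0_integralD//.
  - under eq_integral do rewrite -EFinD subrK.
    by rewrite integral_cst// mul1e; exact: (probability_setT P).
  - by move=> x _; rewrite lee_fin subr_ge0; case: (_ < _)%R; rewrite ?mulr1 ?mulr0.
  - apply/measurable_EFinP; apply: measurable_funB => //; apply: measurable_funM => //.
    exact: measurable_natbool.
  - by move=> x _; rewrite lee_fin mulr_ge0.
  - apply/measurable_EFinP; apply: measurable_funM => //.
    exact: measurable_natbool.
under [X in (_ + X)%E = _ -> _]eq_integral do rewrite EFinM.
rewrite [X in (_ + X)%E = _ -> _]ge0_integralZl//; last first.
  by apply/measurable_EFinP; exact: measurable_natbool.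
rewrite B -EFinM -/q.
case: (integral _ _ _) => [r| |]//; rewrite -EFinD => -[<-].
by congr EFin; ring.
Qed.

Definition fail_prob : R := EG p (fun G => fine (E (fun c : weight => (~~ expander (light theta G c))%:R))).

Lemma EG_hole c X Y : EG p (fun G => (hole (light theta G c) X Y)%:R) =
  \prod_(e in finset.setX X Y) (1 - p * (c e < theta)%R%:R).
Proof.
pose h e b : R := if (e \in finset.setX X Y) && (c e < theta) && b then 0 else 1.
transitivity (EG p (fun G => \prod_e h e (e \in G))).
  apply: eq_bigr => G _; congr (_ * _); rewrite /h.
  have [hl|] := boolP (hole _ X Y).
    rewrite big1// => -[x y] _; case: ifP => // /andP[/andP[]]; rewrite finset.in_setX => /andP[xX yY] cl eG.
    by move: hl => /forall_inP/(_ x xX)/forall_inP/(_ y yY); rewrite inE eG cl.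
  rewrite negb_forall => /existsP[x]; rewrite negb_imply => /andP[xX].
  rewrite negb_forall => /existsP[y]; rewrite negb_imply negbK inE => /andP[yY /andP[eG cl]].
  by rewrite (bigD1 (x, y))//= finset.in_setX xX yY cl eG/= mul0r.
rewrite EG_prod [RHS]big_mkcond/=; apply: eq_bigr => e _; rewrite /h andbT andbF.
case: (e \in _) => /=; last by rewrite !mulr1 subrKC.
by case: (_ < _); rewrite ?mulr1 ?mulr0; ring.
Qed.

Lemma E_hole X Y : E (fun c : weight => EG p (fun G => (hole (light theta G c) X Y)%:R)) =
  ((1 - q) ^+ (#|X| * #|Y|))%:E.
Proof.
rewrite -cardsX -(@E_prod (fun x => 1 - p * (x < theta)%R%:R))//.
- by congr E; apply/funext => c; rewrite EG_hole.
- by move=> x; rewrite subr_ge0; case/andP: p01 => *; case: (_ < _); rewrite ?mulr1 ?mulr0.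
- apply: measurable_funB => //; apply: measurable_funM => //.
  by apply: measurable_natbool; exact: measurable_fun_ltr.
- exact: integral_not_light.
Qed.

Lemma mfun_EG (g : bigraph n -> weight -> R) : (forall G, mfun (g G)) ->
  mfun (fun c : weight => EG p (fun G => g G c)).
Proof.
by move=> mg; apply: mfun_sum => G; apply: mfunM => //; exact: measurable_cst.
Qed.

Lemma E_EG (g : bigraph n -> weight -> R) : (forall G, mfun (g G)) ->
  (forall G t, 0 <= g G (wt t)) -> (forall G, E (g G) \is a fin_num) ->
  E (fun c : weight => EG p (fun G => g G c)) = (EG p (fun G => fine (E (g G))))%:E.
Proof.
move=> mg g0 gf; rewrite /EG E_sum => [|G|G t]; last 2 first.
- by apply: mfunM => //; exact: measurable_cst.
- by rewrite mulr_ge0// wG_ge0.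
rewrite -sumEFin; apply: eq_bigr => G _.
by rewrite EZ ?wG_ge0// EFinM fineK.
Qed.

Lemma E_bool_fin (b : weight -> bool) : mfun b -> E (fun c => (b c)%:R : R) \is a fin_num.
Proof.
move=> mb; rewrite ge0_fin_numE; last by apply: E_ge0.
apply: (@le_lt_trans _ _ (E (fun _ : weight => 1 : R))); last by rewrite Ecst ltry.
apply: E_le => //; first exact: measurable_natbool.
- exact: measurable_cst.
- by move=> t; case: (b _).
Qed.

Lemma mfun_hole X Y G : mfun (fun c : weight => hole (light theta G c) X Y).
Proof.
apply: measurable_forall => x; apply: measurable_implyb.
apply: measurable_forall => y; apply: measurable_implyb.
apply: measurable_neg.
under eq_fun do rewrite inE.
by apply: measurable_and; [exact: measurable_cst|exact: mfun_lt_theta].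
Qed.

Lemma fail_prob_le_sum : fail_prob <=
  \sum_(X : {set 'I_n}) \sum_(Y : {set 'I_n} | bad_pair X Y) 2 * (1 - q) ^+ (#|X| * #|Y|).
Proof.
rewrite -lee_fin /fail_prob -E_EG//; last 2 first.
- by move=> G; apply: measurable_natbool; apply: measurable_neg; exact: mfun_expander.
- by move=> G; apply: E_bool_fin; apply: measurable_neg; exact: mfun_expander.
have mh X Y G : mfun (fun c : weight => (hole (light theta G c) X Y)%:R : R).
  by apply: measurable_natbool; exact: mfun_hole.
pose h X Y (c : weight) := EG p (fun G => (hole (light theta G c) X Y)%:R).
have mhE X Y : mfun (h X Y) by apply: mfun_EG.
have h0 X Y c : 0 <= h X Y c by apply: EG_ge0.
apply: (@le_trans _ _ (E (fun c : weight => \sum_(X : {set 'I_n})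
  \sum_(Y : {set 'I_n} | bad_pair X Y) (h X Y c + h Y X c)))).
  apply: E_le => [||t|t].
  - apply: mfun_EG => G; apply: measurable_natbool; apply: measurable_neg; exact: mfun_expander.
  - by apply: mfun_sum => X; apply: mfun_sum => Y; apply: mfunD.
  - exact: EG_ge0.
  - rewrite -/(EG p _); apply: (le_trans (EG_le p01 (fun G => not_expander_le _))).
    rewrite EG_sum; apply: ler_sum => X _; rewrite EG_sum; apply: ler_sum => Y _.
    by rewrite EGD.
rewrite E_sum => [|X|X t]; last 2 first.
- by apply: mfun_sum => Y; apply: mfunD.
- by apply: sumr_ge0 => Y _; rewrite addr_ge0.
rewrite -sumEFin; apply: lee_sum => X _.
rewrite E_sum => [|Y|Y t]; last 2 first.
- by apply: mfunD.
- by rewrite addr_ge0.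
rewrite -sumEFin; apply: lee_sum => Y _.
rewrite ED// /h !E_hole [(#|Y| * _)%N]mulnC -EFinD lee_fin.
by rewrite mulr_natl mulr2n.
Qed.

Let a := expR (- (q * n%:R / 2)).

(** A bad pair has [#|Y| >= n / 2], so the power is at most [a ^+ #|X|]. It also has
    [#|~: Y| < 2 #|X|], so the powers of [n] inserted on the right multiply to at least 1; they make
    the double sum factor. *)
Lemma bad_pair_le X Y : (0 < n)%N -> bad_pair X Y -> 2 * (1 - q) ^+ (#|X| * #|Y|) <=
  2 * ((n%:R ^+ 2 * a) ^+ #|X| * (n%:R^-1) ^+ #|~: Y|).
Proof.
move=> n0 /andP[X0]; rewrite -card_gt0 in X0; rewrite /growth => nXY.
have nY : (#|Y| + #|~: Y| = n)%N by rewrite cardsC card_ord.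
have q0 : 0 <= q.
  rewrite /q mulr_ge0//; first by case/andP: p01.
  by rewrite subr_ge0 -expR0 ler_expR lerNl oppr0.
have q1 : q <= 1.
  case/andP: p01 => p0 p1; apply: le_trans p1; rewrite /q ler_piMr// gerBl expR_ge0.
rewrite ler_wpM2l//; apply: (@le_trans _ _ (a ^+ #|X|)).
  apply: (@le_trans _ _ (expR (- q) ^+ (#|X| * #|Y|))).
    apply: lerXn2r; rewrite ?nnegrE ?subr_ge0 ?expR_ge0//.
    exact: expR_ge1Dx.
  rewrite mulnC exprM; apply: lerXn2r; rewrite ?nnegrE ?exprn_ge0 ?expR_ge0//.
  rewrite -expRM_natl /a ler_expR mulrN lerN2 [leRHS]mulrC -mulrA ler_wpM2l//.
  rewrite ler_pdivrMr// -natrM ler_nat; lia.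
rewrite exprMn mulrAC ler_peMl ?exprn_ge0 ?expR_ge0// -exprM exprVn.
by rewrite ler_pdivlMr ?exprn_gt0 ?ltr0n// mul1r ler_weXn2l ?ler1n//; lia.
Qed.

(** Once the restriction on [Y] is dropped, the sums over [X] and [Y] are separate binomial
    expansions. The empty [X] is never bad, whence the [- 1]. *)
Lemma fail_prob_le : (0 < n)%N ->
  fail_prob <= 2 * (1 + n%:R^-1) ^+ n * ((1 + n%:R ^+ 2 * a) ^+ n - 1).
Proof.
move=> n0; apply: (le_trans fail_prob_le_sum).
apply: (@le_trans _ _ (\sum_(X : {set 'I_n} | X != finset.set0)
   \sum_(Y : {set 'I_n}) 2 * ((n%:R ^+ 2 * a) ^+ #|X| * (n%:R^-1) ^+ #|~: Y|))).
  rewrite (bigID (fun X : {set 'I_n} => X != finset.set0))/= [X in _ + X]big1 ?addr0; last first.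
    by move=> X X0; rewrite big1// => Y; rewrite /bad_pair (negbTE X0).
  apply: ler_sum => X X0; rewrite [leRHS](bigID (bad_pair X))/=.
  apply: ler_wpDr; last by apply: ler_sum => Y; exact: bad_pair_le.
  by apply: sumr_ge0 => Y _; rewrite !mulr_ge0 ?exprn_ge0 ?mulr_ge0 ?exprn_ge0 ?expR_ge0 ?invr_ge0.
have sY : \sum_(Y : {set 'I_n}) (n%:R^-1) ^+ #|~: Y| = (1 + n%:R^-1) ^+ n :> R.
  rewrite -sum_pow_card (reindex_inj (@finset.setC_inj _))/=.
  by apply: eq_bigr => Y _; rewrite finset.setCK.
have sX : \sum_(X : {set 'I_n} | X != finset.set0) (n%:R ^+ 2 * a) ^+ #|X| =
    (1 + n%:R ^+ 2 * a) ^+ n - 1 :> R.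
  by rewrite -sum_pow_card [in RHS](bigD1 finset.set0)//= cards0 expr0 addrC addrK.
rewrite -sX -sY mulr_sumr le_eqVlt; apply/orP; left; apply/eqP; apply: eq_bigr => X _.
by rewrite mulr_sumr mulr_suml; apply: eq_bigr => Y _; ring.
Qed.

End expander_probability.

(** * Concentration *)

Section variance.
Context {R : realType} {n : nat}.
Variable p : R.
Hypothesis p01 : 0 <= p <= 1.
Implicit Types (G H : bigraph n) (A : {set 'I_n}).

Definition rowmix A G H : bigraph n := [set e | if e.1 \in A then e \in H else e \in G]%SET.

Lemma rowmixE A G H e : (e \in rowmix A G H) = if e.1 \in A then e \in H else e \in G.
Proof. by rewrite inE. Qed.

Lemma rowmixK A G H : rowmix A (rowmix A G H) (rowmix A H G) = G.
Proof. by apply/finset.setP => e; rewrite !rowmixE; case: (e.1 \in A). Qed.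

Definition EG2 (Psi : bigraph n -> bigraph n -> R) : R := EG p (fun G => EG p (Psi G)).

Lemma EG2E Psi : EG2 Psi = \sum_(z : bigraph n * bigraph n) wG p z.1 * wG p z.2 * Psi z.1 z.2.
Proof.
rewrite /EG2 /EG -(pair_bigA _ (fun G H => wG p G * wG p H * Psi G H))/=.
by apply: eq_bigr => G _; rewrite mulr_sumr; apply: eq_bigr => H _; rewrite mulrA.
Qed.

Lemma wG_rowmix A G H : wG p (rowmix A G H) * wG p (rowmix A H G) = wG p G * wG p H.
Proof.
rewrite /wG -!big_split/=; apply: eq_bigr => e _; rewrite !rowmixE.
by case: (e.1 \in A); rewrite // mulrC.
Qed.

(** Trading rows between two independent copies is an involution that preserves their joint
    weight. *)
Lemma EG2_swap A Psi : EG2 Psi = EG2 (fun G H => Psi (rowmix A G H) (rowmix A H G)).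
Proof.
rewrite !EG2E (reindex_inj (h := fun z => (rowmix A z.1 z.2, rowmix A z.2 z.1)))/=.
  by apply: eq_bigr => -[G H] _ /=; rewrite wG_rowmix.
apply: (can_inj (g := fun z => (rowmix A z.1 z.2, rowmix A z.2 z.1))) => -[G H] /=.
by rewrite !rowmixK.
Qed.

Lemma ord_neq (i a : 'I_n) : i != a -> (i == a :> nat) = false.
Proof. exact: negbTE. Qed.

Definition rows_lt j : {set 'I_n} := [set k : 'I_n | (k < j)%N]%SET.

Variables (g : bigraph n -> R) (kappa : R).
Hypothesis g_row : forall (a : 'I_n) G H, (forall e, e.1 != a -> (e \in G) = (e \in H)) ->
  `|g G - g H| <= kappa.

Let kappa0 (a : 'I_n) : 0 <= kappa.
Proof. by apply: le_trans (@g_row a finset.set0 finset.set0 _) => //. Qed.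

(* Exchanging the row a of G with that of H negates the second factor. *)
Lemma covariance_row (a : 'I_n) :
  EG2 (fun G H => g G * (g (rowmix (rows_lt a) G H) - g (rowmix (rows_lt a.+1) G H)))
  <= kappa ^+ 2 / 2.
Proof.
set T := EG2 _.
pose D G H := g (rowmix (rows_lt a) G H) - g (rowmix (rows_lt a.+1) G H).
have TE : T = EG2 (fun G H => g (rowmix [set a]%SET G H) * - D G H).
  rewrite /T (EG2_swap [set a]%SET); apply: eq_bigr => G _; congr (_ * _).
  apply: eq_bigr => H _; congr (_ * _); congr (_ * _).
  rewrite /D opprB; congr (g _ - g _); apply/finset.setP => e; rewrite !rowmixE !inE.
    by have [->|ea] := eqVneq e.1 a; rewrite ?ltnn ?ltnSn// ltnS [(e.1 <= a)%N]leq_eqVlt (ord_neq ea).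
  by have [->|ea] := eqVneq e.1 a; rewrite ?ltnn ?ltnSn// ltnS [(e.1 <= a)%N]leq_eqVlt (ord_neq ea).
(* Averaging [T] with its swapped form leaves a product of two differences, each between graphs that
   differ in row [a] only. This is where the factor one half comes from. *)
have : T + T = EG2 (fun G H => (g G - g (rowmix [set a]%SET G H)) * D G H).
  rewrite {2}TE /T /EG2 -EGD; apply: eq_bigr => G _; congr (_ * _).
  rewrite -EGD; apply: eq_bigr => H _; congr (_ * _); rewrite /D; ring.
have : EG2 (fun G H => (g G - g (rowmix [set a]%SET G H)) * D G H) <= kappa ^+ 2.
  rewrite -(EG_cst (n := n) p (kappa ^+ 2)); apply: EG_le => // G.
  rewrite -[leRHS](EG_cst (n := n) p); apply: EG_le => // H.
  apply: (le_trans (ler_norm _)); rewrite normrM expr2.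
  apply: ler_pM => //; apply: (g_row (a := a)) => e ea; rewrite !rowmixE !inE.
    by rewrite (negbTE ea).
  by rewrite ltnS [(e.1 <= a)%N]leq_eqVlt (ord_neq ea).
by lra.
Qed.

(** With an independent copy [H], the variance is the mean of [g G * (g G - g H)]. Replacing the
    rows of [G] by those of [H] one at a time telescopes the second factor. *)
Lemma variance_le : EG p (fun G => (g G - EG p g) ^+ 2) <= n%:R * (kappa ^+ 2 / 2).
Proof.
have -> : EG p (fun G => (g G - EG p g) ^+ 2) = EG2 (fun G H => g G * (g G - g H)).
  rewrite /EG2; have -> : (fun G => EG p (fun H => g G * (g G - g H))) =
      (fun G => g G * g G - EG p g * g G).
    by apply/funext => G; rewrite EGZ EGB EG_cst//; ring.
  have -> : (fun G => (g G - EG p g) ^+ 2) =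
      (fun G => g G * g G - EG p g * g G - EG p g * (g G - EG p g)).
    by apply/funext => G; ring.
  by rewrite [LHS]EGB [X in _ - X = _]EGZ [X in _ - _ * X = _]EGB EG_cst// subrr mulr0 subr0.
have -> : EG2 (fun G H => g G * (g G - g H)) = \sum_(a < n)
    EG2 (fun G H => g G * (g (rowmix (rows_lt a) G H) - g (rowmix (rows_lt a.+1) G H))).
  rewrite /EG2 -EG_sum; apply: eq_bigr => G _; congr (_ * _).
  rewrite -EG_sum; apply: eq_bigr => H _; congr (_ * _).
  rewrite -mulr_sumr; congr (_ * _).
  rewrite -(big_mkord xpredT (fun a => g (rowmix (rows_lt a) G H) - g (rowmix (rows_lt a.+1) G H))).
  rewrite -[LHS]opprB -[RHS]opprK -sumrN; congr (- _).
  under eq_bigr do rewrite opprB.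
  rewrite telescope_sumr//; congr (g _ - g _); apply/finset.setP => e; rewrite rowmixE inE.
    by rewrite ltn_ord.
  by rewrite ltn0.
apply: (@le_trans _ _ (\sum_(a < n) kappa ^+ 2 / 2)).
  by apply: ler_sum => a _; exact: covariance_row.
by rewrite sumr_const card_ord mulr_natl.
Qed.

Lemma chebyshev_EG (t : R) : 0 < t ->
  EG p (fun G => (t < `|g G - EG p g|)%R%:R) <= n%:R * (kappa ^+ 2 / 2) / t ^+ 2.
Proof.
move=> t0; rewrite ler_pdivlMr ?exprn_gt0// mulrC -EGZ; apply: le_trans variance_le.
apply: EG_le => // G; case: ltP => h; last by rewrite mulr0 sqr_ge0.
rewrite mulr1 -(real_normK (num_real (g G - EG p g))); apply: lerXn2r; rewrite ?nnegrE ?(ltW t0)//.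
exact: ltW.
Qed.

Lemma markov_EG (h : bigraph n -> R) (t : R) : 0 < t -> (forall G, 0 <= h G) ->
  EG p (fun G => (t < h G)%R%:R) <= EG p h / t.
Proof.
move=> t0 h0; rewrite ler_pdivlMr// mulrC -EGZ; apply: EG_le => // G.
by case: ltP => th; rewrite ?mulr1 ?mulr0// ltW.
Qed.

End variance.

(** * Expected cost for a fixed graph against the capped cost *)

Section fixed_graph.
Context {R : realType} {n : nat}.
Hypothesis n2 : (1 < n)%N.
Local Notation pair := ('I_n * 'I_n)%type.
Local Notation weight := (pair -> R).
Local Notation N := #|{: pair}|.
Local Notation P := (exponential1 R).
Local Notation mu := (power_prob P N).
Implicit Types (G : bigraph n) (c : weight).

Lemma measurable_min_matching_cost (T : N.-tuple (measurableTypeR R) -> weight) G :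
  (forall e, measurable_fun setT (fun t => T t e)) ->
  measurable_fun setT (fun t => min_matching_cost G (T t)).
Proof.
move=> mT; rewrite /min_matching_cost; elim: (index_enum _) => [|M r IH].
  by under eq_fun do rewrite big_nil; exact: measurable_cst.
under eq_fun do rewrite big_cons; case: (perfect_matching G M) => //.
apply: measurable_mine => //; apply/measurable_EFinP.
under eq_fun do rewrite big_mkcond/=.
by apply: measurable_sum => e; case: (e \in M); [exact: mT|exact: measurable_cst].
Qed.

Lemma negative_coordinate (k : 'I_N) : mu [set t | tnth t k < 0] = 0%E.
Proof.
have mk : measurable [set t : N.-tuple (measurableTypeR R) | (tnth t k : R) < 0].
  rewrite -[X in measurable X]setTI.
  have : measurable_fun setT (fun t : N.-tuple (measurableTypeR R) => (tnth t k : R) < 0).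
    by apply: measurable_fun_ltr => //; exact: measurable_tnth.
  by move=> /(_ measurableT [set true]); apply.
rewrite -[X in mu X]setIT -integral_indic// (integral_resample P k); last 2 first.
- by apply/measurable_EFinP; exact: measurable_indic.
- by move=> t; rewrite lee_fin.
apply: integral0_eq => t _.
transitivity (\int[P]_x (\1_(`]-oo, 0[%classic : set R) x)%:E)%E.
  apply: eq_integral => x _; rewrite !indicE; congr ((nat_of_bool _)%:R%:E).
  by apply/idP/idP; rewrite !inE/= tnth_mktuple eqxx in_itv.
by rewrite integral_indic// setIT; exact: exponential1_lt0.
Qed.

(** Almost surely all sampled costs are nonnegative, so they may be replaced by their absolute
    values. *)
Lemma expected_matching_costE G :
  expected_matching_cost R G = (\int[mu]_t min_matching_cost G (wt t))%E.
Proof.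
apply: ae_eq_integral => //.
- by apply: measurable_min_matching_cost => e; exact: measurable_tnth.
- by apply: measurable_min_matching_cost => e; exact: (@mfun_coord R n e).
pose B (k : 'I_N) := [set t : N.-tuple (measurableTypeR R) | (tnth t k : R) < 0].
have mB k : measurable (B k).
  rewrite -[X in measurable X]setTI.
  have : measurable_fun setT (fun t : N.-tuple (measurableTypeR R) => (tnth t k : R) < 0).
    by apply: measurable_fun_ltr => //; exact: measurable_tnth.
  by move=> /(_ measurableT [set true]); apply.
have neg k : mu.-negligible (B k) by exists (B k); split => //; exact: negative_coordinate.
pose F (j : nat) := if insub j is Some k then B k else set0.
have : mu.-negligible (\bigcup_j F j).
  apply: negligible_bigcup => j; rewrite /F; case: insub => [k|]; first exact: neg.
  exact: negligible_set0.
apply: negligibleS => t /= ht; apply: contrapT => h; apply: ht => _.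
congr min_matching_cost; apply/funext => e; rewrite /wt ger0_norm// leNgt.
apply/negP => neg_e; apply: h; exists (enum_rank e) => //.
by rewrite /F valK.
Qed.

Definition gcost (kappa : R) G : R :=
  fine (E (fun c : weight => mcost [set: 'I_n]%SET (cap kappa (gw kappa G c)))).

Definition fail (theta : R) G : R :=
  fine (E (fun c : weight => (~~ expander (light theta G c))%:R)).

Lemma mfun_capped (kappa : R) G :
  mfun (fun c : weight => mcost [set: 'I_n]%SET (cap kappa (gw kappa G c))).
Proof.
apply: mfun_mcost_comp => e; apply: measurable_minr => //.
by rewrite /gw; case: (e \in G); [exact: mfun_coord|exact: measurable_cst].
Qed.

Lemma capped_ge0 (kappa : R) G c : 0 <= kappa -> (forall e, 0 <= c e) ->
  forall e, 0 <= cap kappa (gw kappa G c) e.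
Proof. by move=> k0 c0 e; rewrite /cap /gw le_min k0 andbT; case: ifP. Qed.

Lemma capped_le (kappa : R) G c :
  mcost [set: 'I_n]%SET (cap kappa (gw kappa G c)) <= n%:R * kappa.
Proof.
apply: (le_trans (mcost_le _ (inj_on_id _))).
apply: (@le_trans _ _ (\sum_(i in [set: 'I_n]%SET) kappa)).
  by apply: ler_sum => i _; rewrite /cap ge_min lexx orbT.
by rewrite sumr_const cardsT card_ord mulr_natl.
Qed.

Lemma gcostE (kappa : R) G : 0 <= kappa ->
  E (fun c : weight => mcost [set: 'I_n]%SET (cap kappa (gw kappa G c))) = (gcost kappa G)%:E.
Proof.
move=> k0; have m0 t : 0 <= mcost [set: 'I_n]%SET (cap kappa (gw kappa G (wt t))).
  by apply: mcost_ge0; apply: capped_ge0 => // e; exact: wt_ge0.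
rewrite /gcost fineK// ge0_fin_numE ?E_ge0//.
apply: (@le_lt_trans _ _ (E (fun _ : weight => n%:R * kappa))); last by rewrite Ecst ltry.
apply: E_le => // [||t]; [exact: mfun_capped|exact: measurable_cst|exact: capped_le].
Qed.

Lemma mfun_fail (theta : R) G : mfun (fun c : weight => (~~ expander (light theta G c))%:R : R).
Proof. by apply: measurable_natbool; apply: measurable_neg; exact: mfun_expander. Qed.

Lemma failE (theta : R) G :
  E (fun c : weight => (~~ expander (light theta G c))%:R) = (fail theta G)%:E.
Proof. by rewrite /fail fineK//; apply: E_bool_fin; apply: measurable_neg; exact: mfun_expander. Qed.

Lemma fail_ge0 (theta : R) G : 0 <= fail theta G.
Proof. by rewrite -lee_fin -failE E_ge0. Qed.

Lemma gcost_le_expected (kappa : R) G : 0 <= kappa ->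
  ((gcost kappa G)%:E <= expected_matching_cost R G)%E.
Proof.
move=> k0; rewrite -gcostE// expected_matching_costE /E.
have m0 t : (0 <= (mcost [set: 'I_n]%SET (cap kappa (gw kappa G (wt t))))%:E)%E.
  by rewrite lee_fin; apply: mcost_ge0; apply: capped_ge0 => // e; exact: wt_ge0.
apply: ge0_le_integral => //.
- by apply/measurable_EFinP; exact: mfun_capped.
- by apply: measurable_min_matching_cost => e; exact: (@mfun_coord R n e).
- by move=> t _; exact: capped_le_min_matching_cost.
Qed.

(** Where expansion holds, the capped cost is exact. Where it fails, the cost is at most the sum of
    all costs, each at most [k] plus its excess over [k]; the excesses have mean [exp(- k)] each. *)
Lemma expected_le_gcost (theta kappa k : R) s G : (0 < s)%N -> (n./2 < 2 ^ s)%N ->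
  0 <= theta -> theta * s.*2%:R < kappa -> 0 <= k -> fail theta G < 1 ->
  (expected_matching_cost R G <=
    (gcost kappa G + ((n * n)%:R * k * fail theta G + (n * n)%:R * expR (- k)))%:E)%E.
Proof.
move=> s0 ns th0 thk k0 f1.
have kappa0 : 0 <= kappa by apply: le_trans (ltW thk); rewrite mulr_ge0.
have w0 (t : N.-tuple (measurableTypeR R)) : forall e : pair, 0 <= wt t e by move=> e; exact: wt_ge0.
(* As failure is not almost sure, some choice of costs gives an expander, and then [G] has a perfect
   matching whatever the costs. *)
have PM : exists M, perfect_matching G M.
  apply: contrapT => noPM; move: f1; rewrite -lte_fin -failE.
  have -> : E (fun c : weight => (~~ expander (light theta G c))%:R) = E (fun _ : weight => 1 : R).
    apply: eq_integral => t _; have [exL|//] := boolP (expander _).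
    by have [] := min_matching_cost_expander s0 ns th0 thk (w0 t) exL.
  by rewrite Ecst ltxx.
have le t : (min_matching_cost G (wt t) <=
    (mcost [set: 'I_n]%SET (cap kappa (gw kappa G (wt t))) +
     ((n * n)%:R * k * (~~ expander (light theta G (wt t)))%:R +
      \sum_e Order.max 0 (wt t e / 1 - k)))%:E)%E.
  have m0 : 0 <= \sum_e Order.max 0 (wt t e / 1 - k) by apply: sumr_ge0 => e _; rewrite le_max lexx.
  have [exL|nexL] := boolP (expander _).
    have [_ ->] := min_matching_cost_expander s0 ns th0 thk (w0 t) exL.
    by rewrite lee_fin lerDl mulr0 add0r.
  apply: (le_trans (min_matching_cost_le_sum (w0 t) PM)); rewrite lee_fin mulr1.
  apply: ler_wpDl; first by apply: mcost_ge0; exact: capped_ge0.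
  have -> : (n * n)%:R * k = \sum_(e : pair) k.
    by rewrite sumr_const cardT/= -cardT card_prod card_ord mulr_natl.
  rewrite -big_split/=; apply: ler_sum => e _; rewrite divr1 /Order.max.
  by case: ltP => ?; lra.
have mm : mfun (fun c : weight => \sum_e Order.max 0 (c e / 1 - k)).
  by apply: mfun_sum => e; exact: mfun_max0.
have m0 (t : N.-tuple (measurableTypeR R)) : 0 <= \sum_e Order.max 0 (wt t e / 1 - k).
  by apply: sumr_ge0 => e _; rewrite le_max lexx.
have mf : mfun (fun c : weight => (n * n)%:R * k * (~~ expander (light theta G c))%:R).
  by apply: mfunM; [exact: measurable_cst|exact: mfun_fail].
have mc0 t : 0 <= mcost [set: 'I_n]%SET (cap kappa (gw kappa G (wt t))).
  by apply: mcost_ge0; exact: capped_ge0.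
have f0 t : 0 <= (n * n)%:R * k * (~~ expander (light theta G (wt t)))%:R :> R.
  by rewrite !mulr_ge0.
have E3 : E (fun c : weight => \sum_e Order.max 0 (c e / 1 - k)) = ((n * n)%:R * expR (- k))%:E.
  rewrite E_sum => [|e|e t]; [|exact: mfun_max0|by rewrite le_max lexx].
  under eq_bigr do rewrite E_excess// mul1r divr1.
  by rewrite sumEFin sumr_const cardT/= -cardT card_prod card_ord mulr_natl.
have E2 : E (fun c : weight => (n * n)%:R * k * (~~ expander (light theta G c))%:R) =
    ((n * n)%:R * k * fail theta G)%:E.
  by rewrite EZ ?failE//; [exact: mfun_fail|rewrite mulr_ge0].
rewrite !EFinD -gcostE// -E2 -E3 -(ED mf mm f0 m0).
have <- := ED (@mfun_capped kappa G) (mfunD mf mm) mc0 (fun t => addr_ge0 (f0 t) (m0 t)).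
rewrite expected_matching_costE; apply: ge0_le_integral => //.
- by move=> t _; apply: (le_trans _ (capped_le_min_matching_cost kappa _ _)); rewrite lee_fin.
- by apply: measurable_min_matching_cost => e; exact: (@mfun_coord R n e).
- by apply/measurable_EFinP; exact: (mfunD (@mfun_capped kappa G) (mfunD mf mm)).
Qed.

(** The matching that is optimal for one graph is used for the other; only its edge in row [a]
    changes price, by at most [kappa]. *)
Lemma gcost_row (kappa : R) (a : 'I_n) (G H : bigraph n) : 0 <= kappa ->
  (forall e, e.1 != a -> (e \in G) = (e \in H)) -> `|gcost kappa G - gcost kappa H| <= kappa.
Proof.
move=> k0.
have key G1 G2 : (forall e, e.1 != a -> (e \in G1) = (e \in G2)) ->
    gcost kappa G1 <= gcost kappa G2 + kappa.
  move=> G12; rewrite -lee_fin EFinD -!gcostE// -(@Ecst R n kappa) -ED; last 4 first.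
  - exact: mfun_capped.
  - exact: measurable_cst.
  - by move=> t; apply: mcost_ge0; apply: capped_ge0 => // e; exact: wt_ge0.
  - by [].
  apply: E_le => [||t|t].
  - exact: mfun_capped.
  - by apply: mfunD; [exact: mfun_capped|exact: measurable_cst].
  - by apply: mcost_ge0; apply: capped_ge0 => // e; exact: wt_ge0.
  have [f fT ->] := mcost_ex [set: 'I_n]%SET (cap kappa (gw kappa G2 (wt t))).
  apply: (le_trans (mcost_le _ fT)).
  have aT : a \in [set: 'I_n]%SET by rewrite inE.
  rewrite /cost (bigD1 a aT)/= [in leRHS](bigD1 a aT)/=.
  rewrite (eq_bigr (fun i => cap kappa (gw kappa G2 (wt t)) (i, f i))); last first.
    by move=> i /andP[_ ia]; rewrite /cap /gw G12.
  have u0 : 0 <= cap kappa (gw kappa G2 (wt t)) (a, f a).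
    by apply: capped_ge0 => // e; exact: wt_ge0.
  have u1 : cap kappa (gw kappa G1 (wt t)) (a, f a) <= kappa by rewrite /cap ge_min lexx orbT.
  have aux (x y z k : R) : 0 <= y -> x <= k -> x + z <= y + z + k by move=> *; lra.
  exact: aux u0 u1.
move=> GH; rewrite ler_norml; apply/andP; split.
  by rewrite lerBrDl lerBlDr; apply: key => e ea; rewrite GH.
by rewrite lerBlDl; exact: key.
Qed.

Variables (p : R).
Hypothesis p01 : 0 < p <= 1.

Let p01' : 0 <= p <= 1. Proof. by case/andP: p01 => /ltW -> ->. Qed.

Lemma EG_gcostE (kappa : R) : 0 <= kappa ->
  E (mixcost (n := n) p kappa 1 finset.set0) = (EG p (gcost kappa))%:E.
Proof.
move=> k0; rewrite -E_EG//; last 3 first.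
- by move=> G; exact: mfun_capped.
- by move=> G t; apply: mcost_ge0; apply: capped_ge0 => // e; exact: wt_ge0.
- by move=> G; rewrite gcostE.
congr E; apply/funext => c; apply: eq_bigr => G _; congr (_ * mcost _ _).
by apply/funext => e; rewrite /mixw /cap inE.
Qed.

Lemma EG_gcost_le (kappa : R) : 0 <= kappa -> kappa <= 1 / 2 ->
  EG p (gcost kappa) <= zeta2 n / (p * (1 - kappa)).
Proof.
by case/andP: p01 => p0 p1 k0 k1; rewrite -lee_fin -EG_gcostE// E_mixcost_le.
Qed.

(** On expansion, capping at [kappa] yields the true cost, which bounds the cost capped at [k].
    Otherwise the latter is at most [n k]. *)
Lemma gcost_le_fail (theta kappa k : R) s G : (0 < s)%N -> (n./2 < 2 ^ s)%N ->
  0 <= theta -> theta * s.*2%:R < kappa -> 0 <= k ->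
  gcost k G <= gcost kappa G + n%:R * k * fail theta G.
Proof.
move=> s0 ns th0 thk k0.
have kappa0 : 0 <= kappa by apply: le_trans (ltW thk); rewrite mulr_ge0.
have w0 (t : N.-tuple (measurableTypeR R)) : forall e : pair, 0 <= wt t e.
  by move=> e; exact: wt_ge0.
have mc0 (K : R) (t : N.-tuple (measurableTypeR R)) : 0 <= K -> 0 <= mcost [set: 'I_n]%SET (cap K (gw K G (wt t))).
  by move=> K0; apply: mcost_ge0; exact: (capped_ge0 G K0 (w0 t)).
have nk0 : 0 <= n%:R * k by rewrite mulr_ge0.
rewrite -lee_fin EFinD EFinM -failE -!gcostE//.
have mf : mfun (fun c : weight => n%:R * k * (~~ expander (light theta G c))%:R).
  by apply: mfunM; [exact: measurable_cst|exact: mfun_fail].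
have f0 t : 0 <= n%:R * k * (~~ expander (light theta G (wt t)))%:R :> R by rewrite mulr_ge0.
rewrite -(EZ (mfun_fail theta G) nk0) -?(ED (@mfun_capped kappa G) mf (fun t => mc0 kappa t kappa0) f0) => [|t //].
apply: E_le => [||t|t].
- exact: mfun_capped.
- exact: (mfunD (@mfun_capped kappa G) mf).
- exact: mc0.
have [exL|nexL] := boolP (expander (light theta G (wt t))).
  rewrite mulr0 addr0 -lee_fin.
  have [_ <-] := min_matching_cost_expander s0 ns th0 thk (w0 t) exL.
  exact: capped_le_min_matching_cost.
rewrite mulr1; apply: ler_wpDl; first exact: mc0.
exact: capped_le.
Qed.

(** The comparison is applied at the large cap [k], where the truncation error is small, and
    transferred to [kappa]. *)
Lemma EG_gcost_ge (theta kappa k : R) s : (0 < s)%N -> (n./2 < 2 ^ s)%N ->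
  0 <= theta -> theta * s.*2%:R < kappa -> 0 <= k ->
  zeta2 n / p - (n * n)%:R * (expR (- (p * k)) / p) - n%:R * k * fail_prob (n := n) p theta
    <= EG p (gcost kappa).
Proof.
case/andP: p01 => p0 p1 s0 ns th0 thk k0; rewrite lerBlDr.
apply: (@le_trans _ _ (EG p (gcost k))).
  by rewrite -lee_fin -EG_gcostE// E_mixcost_ge.
rewrite /fail_prob -EGZ -EGD; apply: EG_le => // G.
exact: gcost_le_fail thk k0.
Qed.

End fixed_graph.

(** * Bounds with explicit error terms *)

Section quantitative.
Context {R : realType}.

Lemma Pr_GnnpE n (p : R) (A : set (bigraph n)) :
  Pr_Gnnp p A = EG p (fun G => (G \in A)%:R).
Proof.
rewrite /Pr_Gnnp /EG big_mkcond/=; apply: eq_bigr => G _.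
by case: (G \in A); rewrite ?mulr1 ?mulr0.
Qed.

Lemma Pr_Gnnp_le1 n (p : R) (A : set (bigraph n)) : 0 <= p <= 1 -> Pr_Gnnp p A <= 1.
Proof.
move=> p01; rewrite Pr_GnnpE -[leRHS](EG_cst (n := n) p); apply: EG_le => // G.
by case: (G \in A).
Qed.

(** The three [eps] are the deviation of [gcost] from its mean, the distance of that mean from [L],
    and the contribution of failed expansion. The excluded graphs are counted by Chebyshev's
    inequality for [gcost] and Markov's for [fail]. *)
Lemma Pr_Gnnp_close n s (p kappa theta k eps d L : R) : (1 < n)%N -> 0 < p <= 1 ->
  (0 < s)%N -> (n./2 < 2 ^ s)%N -> 0 <= theta -> theta * s.*2%:R < kappa -> 0 <= k ->
  0 < d -> d < 1 -> 0 < eps ->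
  `|EG p (gcost (n := n) kappa) - L| <= eps ->
  (n * n)%:R * k * d + (n * n)%:R * expR (- k) <= eps ->
  1 - (n%:R * (kappa ^+ 2 / 2) / eps ^+ 2 + fail_prob (n := n) p theta / d) <=
  Pr_Gnnp p [set G : bigraph n |
     (`|expected_matching_cost R G - L%:E| <= (3 * eps)%:E)%E].
Proof.
move=> n2 p01 s0 ns th0 thk k0 d0 d1 eps0 hL hk.
have p01' : 0 <= p <= 1 by case/andP: p01 => /ltW -> ->.
have kappa0 : 0 <= kappa by apply: le_trans (ltW thk); rewrite mulr_ge0.
rewrite Pr_GnnpE.
have row (a : 'I_n) (G H : bigraph n) : (forall e, e.1 != a -> (e \in G) = (e \in H)) ->
    `|gcost kappa G - gcost kappa H| <= kappa by exact: gcost_row.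
have C := chebyshev_EG p01' row eps0.
have M := markov_EG p01' d0 (@fail_ge0 R n theta).
rewrite /fail_prob; apply: (@le_trans _ _ (1 - (EG p (fun G : bigraph n => (eps < `|gcost kappa G - EG p (gcost kappa)|)%R%:R) +
   EG p (fun G => (d < fail theta G)%R%:R)))).
  by rewrite lerD2l lerN2; apply: lerD; [exact: C|exact: M].
rewrite -EGD -[X in X - _ <= _](EG_cst (n := n) p) -EGB; apply: EG_le => // G.
have [h1|h1] := ltP eps `|gcost kappa G - EG p (gcost kappa)|.
  by rewrite opprD addrA subrr sub0r (@le_trans _ _ 0)// oppr_le0.
have [h2|h2] := ltP d (fail theta G); first by rewrite add0r subrr.
rewrite addr0 subr0 (_ : _ \in _)// inE/=.
have f1 : fail theta G < 1 by exact: le_lt_trans d1.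
have := expected_le_gcost s0 ns th0 thk k0 f1.
have := gcost_le_expected G kappa0.
have hf : (n * n)%:R * k * fail theta G <= (n * n)%:R * k * d.
  by rewrite ler_wpM2l// mulr_ge0.
case: (expected_matching_cost R G) => [x| |]//.
rewrite !lee_fin => g1 g2; move: h1 hL; rewrite !ler_norml => /andP[a1 a2] /andP[b1 b2].
move: g1 g2 a1 a2 b1 b2 hf hk; move: (gcost _ _) (EG _ _) (_ * fail _ _) (_ * d) (_ * expR _).
move=> u v y z q *; apply/andP; split; lra.
Qed.

Lemma expR1_le4 : expR 1 <= 4 :> R.
Proof.
have h : 2^-1 <= expR (- 2^-1) :> R by have := @expR_ge1Dx R (- 2^-1); lra.
have : 4^-1 <= expR (- 1) :> R.
  have -> : - 1 = - 2^-1 + - 2^-1 :> R by lra.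
  rewrite expRD (_ : 4^-1 = 2^-1 * 2^-1); last by rewrite -invfM; congr (_^-1); ring.
  by apply: ler_pM.
by rewrite expRN lef_pV2 ?posrE ?expR_gt0.
Qed.

Lemma expR_le_affine (x : R) : 0 <= x -> x <= 2^-1 -> expR x <= 1 + 2 * x.
Proof.
move=> x0 x1; have h := @expR_ge1Dx R (- x).
have x1' : 0 < 1 - x by lra.
apply: (@le_trans _ _ (1 - x)^-1).
  by rewrite -[leLHS]invrK -expRN lef_pV2 ?posrE ?expR_gt0.
rewrite -div1r ler_pdivrMr//.
have : 0 <= x * (1 - 2 * x) by rewrite mulr_ge0//; lra.
lra.
Qed.

(** The hypothesis makes the exponential factor at most [n^-12]. Three powers of [n] are lost in
    [(1 + n^2 a)^n - 1], and 16 is 2 times the bound 4 on [(1 + 1/n)^n] times the 2 of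
    [expR_le_affine]. *)
Lemma fail_prob_small n (p theta : R) : (1 < n)%N -> 0 <= p <= 1 -> 0 <= theta ->
  12 * ln n%:R <= p * (1 - expR (- theta)) * n%:R / 2 ->
  fail_prob (n := n) p theta <= 16 * (n%:R^-1) ^+ 9.
Proof.
move=> n2 p01 th0 hq; have n0 : (0 < n)%N by lia.
have nR : 0 < n%:R :> R by rewrite ltr0n.
apply: (le_trans (fail_prob_le p01 th0 n0)).
set a := expR _; have a0 : 0 <= a by exact: expR_ge0.
have ha : a <= (n%:R^-1) ^+ 12.
  rewrite /a; apply: (@le_trans _ _ (expR (- (12 * ln n%:R)))); first by rewrite ler_expR lerN2.
  by rewrite -mulrN expRM_natl expRN lnK.
have y0 : 0 <= n%:R * (n%:R ^+ 2 * a) by rewrite !mulr_ge0.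
have hy : n%:R * (n%:R ^+ 2 * a) <= (n%:R^-1) ^+ 9.
  rewrite mulrA -exprS; apply: (@le_trans _ _ (n%:R ^+ 3 * (n%:R^-1) ^+ 12)).
    by rewrite ler_wpM2l// exprn_ge0.
  rewrite (_ : 12 = 3 + 9)%N// exprD mulrA -exprMn mulfV ?gt_eqF// expr1n mul1r//.
have h9 : (n%:R^-1) ^+ 9 <= 2^-1 :> R.
  have h2 : n%:R^-1 <= 2^-1 :> R by rewrite lef_pV2 ?posrE// ler_nat.
  apply: le_trans h2; apply: ler_iXnr => //; rewrite ?invr_ge0//.
  by rewrite invf_le1// ler1n.
have e1 : (1 + n%:R ^+ 2 * a) ^+ n <= 1 + 2 * (n%:R^-1) ^+ 9.
  apply: (@le_trans _ _ (expR (n%:R * (n%:R ^+ 2 * a)))).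
    rewrite expRM_natl; apply: lerXn2r; rewrite ?nnegrE ?expR_ge0 ?expR_ge1Dx//.
    by rewrite addr_ge0// mulr_ge0// exprn_ge0.
  apply: (le_trans (expR_le_affine y0 (le_trans hy h9))).
  by rewrite lerD2l ler_wpM2l.
have e2 : (1 + n%:R^-1) ^+ n <= 4 :> R.
  apply: le_trans expR1_le4; rewrite -[in leRHS](@mulfV _ n%:R) ?gt_eqF// expRM_natl.
  by apply: lerXn2r; rewrite ?nnegrE ?expR_ge0 ?expR_ge1Dx// addr_ge0// invr_ge0.
have z0 : 0 <= (n%:R^-1 : R) ^+ 9 by rewrite exprn_ge0// invr_ge0.
have e3 : 0 <= (1 + n%:R ^+ 2 * a) ^+ n - 1.
  by rewrite subr_ge0 exprn_ege1// lerDl mulr_ge0// exprn_ge0.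
apply: (@le_trans _ _ (2 * 4 * (2 * (n%:R^-1) ^+ 9))).
  apply: ler_pM => //.
    by rewrite ler_wpM2l.
  by rewrite lerBlDl.
by move: (_ ^+ 9) z0 => z z0; lra.
Qed.

Lemma trunc_log_le_ln n : (1 < n)%N -> (trunc_log 2 n).+1%:R <= 4 * ln n%:R :> R.
Proof.
move=> n2; set s := trunc_log 2 n; have n0 : (0 < n)%N by lia.
have ln2 : 2^-1 <= ln 2 :> R.
  rewrite -ler_expR lnK ?posrE//.
  have -> : expR 2^-1 = (expR (- 2^-1))^-1 :> R by rewrite expRN invrK.
  rewrite -[leRHS]invrK lef_pV2 ?posrE ?expR_gt0// ?invr_gt0//.
  by have := @expR_ge1Dx R (- 2^-1); lra.
have sn : (2 ^ s <= n)%N by apply: trunc_logP.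
have h1 : s%:R * ln 2 <= ln n%:R :> R.
  rewrite mulr_natl -lnXn// ler_ln ?posrE ?exprn_gt0 ?ltr0n//.
  by rewrite -natrX ler_nat.
have h2 : ln 2 <= ln n%:R :> R by rewrite ler_ln ?posrE ?ltr0n// ler_nat.
have h3 : s%:R * 2^-1 <= s%:R * ln 2 :> R by rewrite ler_wpM2l.
rewrite -natr1; lra.
Qed.

End quantitative.

(** * Choice of the parameters and the limit *)

Section asymptotics.
Context {R : realType}.

Lemma pow_le_expR m (x : R) : 0 <= x -> (x / m.+1%:R) ^+ m.+1 <= expR x.
Proof.
move=> x0; have m0 : m.+1%:R != 0 :> R by rewrite pnatr_eq0.
rewrite -{2}[x](mulVKf m0) expRM_natl; apply: lerXn2r; rewrite ?nnegrE ?expR_ge0//.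
  by rewrite divr_ge0.
have := expR_ge1Dx (m.+1%:R^-1 * x); rewrite [x / _]mulrC.
by move: (_ * x) (expR _) => y e; lra.
Qed.

(* The cap is kappa = C / omega; alternating cycles have at most 2 s edges, where
   s <= 4 ln n, so light edges may cost up to theta = kappa / (4 s), and the
   density of light edges is about p theta >= 24 (ln n) / n. *)
Lemma Pr_Gnnp_bound n (C p omega eps : R) : C = 48 * 16 -> (1 < n)%N -> 0 < p <= 1 -> 0 < eps -> eps <= 1 ->
  n%:R * p = omega * ln n%:R ^+ 2 -> C * 6 / eps <= omega -> 3 <= ln n%:R :> R ->
  200 / eps <= n%:R :> R ->
  pi ^+ 2 / 6 - eps / 3 <= zeta2 n -> zeta2 n <= pi ^+ 2 / 6 :> R ->
  1 - (C ^+ 2 * 5 ^+ 5 / eps ^+ 2 / ln n%:R + 16 / n%:R) <=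
  Pr_Gnnp p [set G : bigraph n |
     (`|expected_matching_cost R G - (pi ^+ 2 / (6 * p))%:E| <= (3 * (eps / p))%:E)%E].
Proof.
move=> CE n2 /andP[p0 p1] eps0 eps1 npw hw hl hn hz hz'.
have n0 : (0 < n)%N by exact: ltnW.
have nR : 0 < n%:R :> R by rewrite ltr0n.
have C0 : 0 < C by rewrite CE mulr_gt0// ltr0n.
set l := ln n%:R in npw hl *.
have l0 : 0 < l by exact: lt_le_trans hl.
have eC : C * 6 <= omega * eps by rewrite -ler_pdivrMr.
have w0 : 0 < omega by apply: lt_le_trans hw; rewrite divr_gt0// mulr_gt0.
pose kappa := C / omega; pose s := (trunc_log 2 n).+1; pose theta := kappa / (4 * s%:R).
have sl : s%:R <= 4 * l by exact: trunc_log_le_ln.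
have s0 : 0 < s%:R :> R by rewrite ltr0n.
have k0 : 0 < kappa by rewrite divr_gt0.
have k1 : kappa <= eps / 6.
  rewrite /kappa ler_pdivrMr// [leRHS]mulrC mulrA ler_pdivlMr//.
have th0 : 0 < theta by rewrite divr_gt0// mulr_gt0.
have thk : theta * s.*2%:R < kappa.
  rewrite -muln2 natrM /theta (_ : _ * _ = kappa / 2); first by move: (kappa) k0 => x x0; lra.
  by field; rewrite gt_eqF.
have th1 : theta <= 1.
  rewrite /theta ler_pdivrMr ?mulr_gt0// mul1r.
  have : 1 <= s%:R :> R by rewrite ler1n.
  by move: k1 eps1; move: (kappa) (s%:R) => x y *; lra.
have ns : (n./2 < 2 ^ s)%N.
  have := @trunc_log_ltn 2 n isT; apply: leq_ltn_trans.
  by rewrite leq_half_double; apply: leqW; rewrite -addnn leq_addr.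
have hq : 12 * l <= p * (1 - expR (- theta)) * n%:R / 2.
  have h1 : theta / 2 <= 1 - expR (- theta).
    have := expRN_le2 (ltW th0); move: (expR _) => e.
    have : 0 <= theta * (1 - theta) by rewrite mulr_ge0//; lra.
    lra.
  apply: (@le_trans _ _ (p * (theta / 2) * n%:R / 2)); last first.
    apply: ler_wpM2r; first by rewrite invr_ge0.
    apply: ler_wpM2r; first exact: ltW.
    by apply: ler_wpM2l => //; exact: ltW.
  (* Here [n p theta / 4] equals [C l^2 / (16 s)], and [s <= 4 l]. To reach [12 l] one needs
     [C = 48 * 16]. *)
  rewrite (_ : _ / 2 = n%:R * p * theta / 4); last by field.
  rewrite npw /theta /kappa CE (_ : _ / 4 = 48 * l ^+ 2 / s%:R); last first.
    by field; rewrite !gt_eqF.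
  rewrite ler_pdivlMr// expr2.
  have := ler_wpM2l (ltW l0) sl; move: (s%:R) => y; lra.
have p01 : 0 < p <= 1 by rewrite p0.
have p01' : 0 <= p <= 1 by rewrite ltW.
have fs := fail_prob_small n2 p01' (ltW th0) hq.
pose u : R := n%:R^-1.
have u0 : 0 < u by rewrite invr_gt0.
have nu : n%:R * u = 1 by rewrite mulfV ?gt_eqF.
have u1 : u < 1 by rewrite invf_lt1// ltr1n.
have hu : 200 * u <= eps.
  by move: hn; rewrite ler_pdivrMr// -(ler_pM2r u0) mulrAC nu mul1r.
have pwu m : u ^+ m.+1 <= u by apply: ler_iXnr => //; exact: ltW.
have d0 : 0 < u ^+ 4 by rewrite exprn_gt0.
have fs' : n%:R * n%:R * fail_prob (n := n) p theta <= 16 * u.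
  apply: (@le_trans _ _ (n%:R * n%:R * (16 * u ^+ 9))).
    by rewrite ler_wpM2l// mulr_ge0.
  have -> : n%:R * n%:R * (16 * u ^+ 9) = 16 * ((n%:R * u) * (n%:R * u) * u ^+ 7) by ring.
  by rewrite nu !mul1r ler_wpM2l.
have epsp : eps <= eps / p by rewrite ler_pdivlMr// ler_piMr// ltW.
have epsp0 : 0 < eps / p by rewrite divr_gt0.
(* The truncation level is [k = n] and the threshold for [fail] is [d = n^-4]: then [n^2 k d] is
   [1 / n], and Markov's bound [16 n^-9 / d] is still below [16 / n]. *)
apply: le_trans (Pr_Gnnp_close (L := pi ^+ 2 / (6 * p)) n2 p01 (ltn0Sn _) ns (ltW th0) thk (ler0n R n) d0
  (le_lt_trans (pwu 3) u1) epsp0 _ _).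
- rewrite lerD2l lerN2; apply: lerD; last first.
    rewrite ler_pdivrMr//; apply: (le_trans fs); rewrite -/u -mulrA -exprS ler_wpM2l//.
    by apply: ler_wiXn2l; rewrite // ltW.
  (* This turns Chebyshev's term into a multiple of [l^4 / n]. The bound [l^5 <= 5^5 n], from
     [(l / 5)^5 <= expR l], makes it of order [1 / l]. *)
  have pw : p / omega = l ^+ 2 * u.
    have -> : p = n%:R * p * u by rewrite mulrAC nu mul1r.
    by rewrite npw; field; rewrite gt_eqF.
  have -> : n%:R * (kappa ^+ 2 / 2) / (eps / p) ^+ 2 =
      (C ^+ 2 / eps ^+ 2) * (n%:R / 2 * (p / omega) ^+ 2).
    by rewrite /kappa; field; rewrite !gt_eqF.
  rewrite pw (_ : C ^+ 2 * 5 ^+ 5 / eps ^+ 2 / l = (C ^+ 2 / eps ^+ 2) * (5 ^+ 5 / l)); last first.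
    by field; rewrite !gt_eqF.
  rewrite ler_wpM2l ?divr_ge0 ?sqr_ge0// ler_pdivlMr//.
  have -> : n%:R / 2 * (l ^+ 2 * u) ^+ 2 * l = (n%:R * u) * (l ^+ 5 * u) / 2 by field.
  rewrite nu mul1r.
  have h5 : l ^+ 5 * u <= 5 ^+ 5.
    rewrite ler_pdivrMr//; have := pow_le_expR 4%N (ltW l0).
    rewrite lnK ?posrE// expr_div_n ler_pdivrMr ?exprn_gt0 ?ltr0n//.
    by rewrite mulrC.
  have h5' : 0 <= l ^+ 5 * u by rewrite mulr_ge0 ?exprn_ge0// ltW.
  by move: h5 h5'; move: (l ^+ 5 * u) (5 ^+ 5) => x y; lra.
- have A3 : pi ^+ 2 / 6 <= 3 :> R.
    have p4 : pi <= 4 :> R by have := @pihalf_lt2 R; move: pi => x; lra.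
    have : pi ^+ 2 <= 4 * 4 :> R by rewrite expr2; apply: ler_pM; rewrite ?pi_ge0.
    by move: (pi ^+ 2) => x; lra.
  have LE : pi ^+ 2 / (6 * p) = pi ^+ 2 / 6 / p by field; rewrite gt_eqF.
  have k12 : kappa <= 1 / 2 by move: k1 eps1; move: (kappa) => x; lra.
  rewrite LE ler_distl; apply/andP; split; last first.
    apply: (le_trans (EG_gcost_le n2 p01 (ltW k0) k12)).
    rewrite -mulrDl [p * _]mulrC invfM mulrA ler_wpM2r ?invr_ge0 ?(ltW p0)//.
    rewrite ler_pdivrMr; last by move: k12; move: (kappa) => x; lra.
    have A0 : 0 <= pi ^+ 2 / 6 :> R by rewrite divr_ge0// sqr_ge0.
    apply: (le_trans hz'); move: A3 A0 k1; move: (pi ^+ 2 / 6) => A A3 A0 k1.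
    have kA : kappa * (A + eps) <= eps / 6 * 6.
      by apply: ler_pM => //; [exact: ltW|exact: addr_ge0 (ltW eps0)|lra].
    by move: kA; move: (kappa) => x; lra.
  apply: le_trans (EG_gcost_ge n2 p01 (ltn0Sn _) ns (ltW th0) thk (ler0n R n)).
  (* At cap [n] the exponent [p n = omega l^2] exceeds [3 l], so the truncation error beats [n^2]
     with a factor [1 / n] to spare. *)
  have hpn : (n * n)%:R * expR (- (p * n%:R)) <= u.
    have wl : 3 * l <= p * n%:R.
      rewrite [leRHS]mulrC npw expr2 mulrA ler_wpM2r ?(ltW l0)//.
      have : 3 * 1 <= l * omega.
        apply: ler_pM => //; apply: le_trans (le_trans eC _); last by rewrite ler_piMr// ltW.
        by rewrite CE -!natrM ler1n.
      by rewrite mulr1 mulrC.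
    apply: (@le_trans _ _ (n%:R * n%:R * u ^+ 3)).
      rewrite natrM ler_wpM2l ?mulr_ge0//.
      apply: (@le_trans _ _ (expR (- (3 * l)))); first by rewrite ler_expR lerN2.
      by rewrite -mulrN expRM_natl expRN lnK.
    by have -> : n%:R * n%:R * u ^+ 3 = (n%:R * u) * (n%:R * u) * u; [ring|rewrite nu !mul1r].
  have hf : n%:R * n%:R * fail_prob (n := n) p theta * p <= 16 * u.
    by apply: le_trans fs'; rewrite ler_piMr// !mulr_ge0//; apply: EG_ge0 => // G; exact: fail_ge0.
  have -> : zeta2 n / p - (n * n)%:R * (expR (- (p * n%:R)) / p)
      - n%:R * n%:R * fail_prob (n := n) p theta =
      (zeta2 n - (n * n)%:R * expR (- (p * n%:R)) - n%:R * n%:R * fail_prob (n := n) p theta * p) / p.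
    by field; rewrite gt_eqF.
  rewrite -mulrBl ler_wpM2r ?invr_ge0 ?(ltW p0)//.
  move: hz hpn hf hu u0; move: (pi ^+ 2 / 6) (zeta2 n) (_ * expR _) (_ * p) => A z v w.
  by move: u eps {nu pwu d0 fs' u1 epsp epsp0 eps0 eps1 hw eC k1 hn} => u' eps' *; lra.
- apply: le_trans epsp; rewrite natrM.
  have -> : n%:R * n%:R * n%:R * u ^+ 4 = (n%:R * u) ^+ 3 * u by ring.
  rewrite nu expr1n mul1r.
  have h27 : n%:R * n%:R * expR (- n%:R) <= 27 * u.
    have := @pow_le_expR 2 n%:R (ltW nR); rewrite expRN => h.
    have n30 : 0 < (n%:R / 3) ^+ 3 :> R by rewrite exprn_gt0// divr_gt0.
    apply: (@le_trans _ _ (n%:R * n%:R * ((n%:R / 3) ^+ 3)^-1)).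
      by rewrite ler_wpM2l ?mulr_ge0// lef_pV2 ?posrE ?expR_gt0.
    by rewrite le_eqVlt; apply/orP; left; apply/eqP; rewrite /u; field; rewrite gt_eqF.
  by move: h27 hu u0; move: (u) (_ * expR _) => x y; clear; lra.
Qed.
End asymptotics.

Lemma Pr_Gnnp_le {R : realType} n (p : R) (A B : set (bigraph n)) :
  0 <= p <= 1 -> A `<=` B -> Pr_Gnnp p A <= Pr_Gnnp p B.
Proof.
move=> p01 AB; rewrite !Pr_GnnpE; apply: EG_le => // G.
have [/set_mem/AB/mem_set ->|_] := boolP (G \in A); first by [].
by case: (G \in B).
Qed.

Theorem theorem1 (R : realType) (p omega : nat -> R)
    (p01 : forall n : nat, 0 < p n <= 1)
    (omega_infty : omega n @[n --> \oo] --> +oo)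
    (np_omega : \forall n \near \oo, n%:R * p n = omega n * ln n%:R ^+ 2)
    (eps : R) (eps_gt0 : 0 < eps) :
  Pr_Gnnp (p n) [set G : bigraph n |
      (`|expected_matching_cost R G - (pi ^+ 2 / (6 * p n))%:E|
         <= (eps * (pi ^+ 2 / (6 * p n)))%:E)%E] @[n --> \oo] --> (1 : R).
Proof.
have pi0 : 0 < pi ^+ 2 / 6 :> R by rewrite divr_gt0// exprn_gt0// pi_gt0.
(* The division by 3 pays for the three errors of [Pr_Gnnp_close]; the bound by 1 is required by
   [Pr_Gnnp_bound]. *)
pose e : R := Num.min 1 (eps * (pi ^+ 2 / 6) / 3).
have e0 : 0 < e by rewrite lt_min ltr01/= divr_gt0// mulr_gt0.
have e1 : e <= 1 by rewrite ge_min lexx.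
have e3 : 3 * e <= eps * (pi ^+ 2 / 6).
  by rewrite mulrC -ler_pdivlMr// ge_min lexx orbT.
have [C CE] : exists C : R, C = 48 * 16 by exists (48 * 16).
apply/cvgrPdist_le => d d0.
near=> n.
have /andP[pn0 pn1] := p01 n.
have pn01 : 0 <= p n <= 1 by rewrite ltW.
have n0 : 0 < n%:R :> R by near: n; exact: nbhs_infty_gtr.
have l0 (M : R) : expR M <= n%:R -> M <= ln n%:R.
  by move=> Mn; rewrite -ler_expR lnK.
set A := [set G | _]; have Ple := Pr_Gnnp_le1 A pn01.
rewrite ger0_norm ?subr_ge0// lerBlDr -lerBlDl.
apply: le_trans (Pr_Gnnp_le (A := [set G : bigraph n |
    (`|expected_matching_cost R G - (pi ^+ 2 / (6 * p n))%:E| <= (3 * (e / p n))%:E)%E]) pn01 _); last first.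
  move=> G /= /le_trans; apply; rewrite lee_fin.
  rewrite (_ : eps * _ = eps * (pi ^+ 2 / 6) / p n); last by field; rewrite gt_eqF.
  by rewrite mulrA ler_wpM2r// invr_ge0 ltW.
apply: le_trans (Pr_Gnnp_bound CE _ (p01 n) e0 e1 (omega := omega n) _ _ _ _ _ _); first last.
- exact: zeta2_le.
- near: n; have /cvgrPdist_le/(_ (e / 3)) := @cvg_zeta2 R.
  have e30 : 0 < e / 3 by rewrite divr_gt0.
  move=> /(_ e30); apply: filterS => n.
  by rewrite ler_distlC => /andP[].
- by near: n; exact: nbhs_infty_ger.
- by apply: l0; near: n; exact: nbhs_infty_ger.
- by near: n; move/cvgryPge : omega_infty; exact.
- by near: n; exact: np_omega.
- by near: n; exact: nbhs_infty_gt.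
rewrite lerD2l lerN2 [leRHS](splitr d); apply: lerD.
  rewrite ler_pdivrMr; last first.
    by apply: lt_le_trans (l0 1 _) => //; near: n; exact: nbhs_infty_ger.
  rewrite [leRHS]mulrC -ler_pdivrMr ?divr_gt0//.
  by apply: l0; near: n; exact: nbhs_infty_ger.
rewrite ler_pdivrMr// [leRHS]mulrC -ler_pdivrMr ?divr_gt0//.
by near: n; exact: nbhs_infty_ger.
Unshelve. all: by end_near.
Qed.
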